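(* Let $\beta>0$, let $b\geq 2$ be an integer, and fix $\theta\in[0,2\pi)$. For $N\in\mathbb{N}$ let $(\theta_1,\dots,\theta_N)$ be distributed according to the circular $\beta$-ensemble, let $D_{N,\beta}(\theta)=\prod_{j=1}^N(e^{i\theta}-e^{i\theta_j})$, and write the base-$b$ expansion $|D_{N,\beta}(\theta)|=\big(\sum_{k=1}^\infty d_{k,N}\,b^{1-k}\big)b^{M}$ with $M\in\mathbb{Z}$, $d_{k,N}\in\{0,1,\dots,b-1\}$ and $d_{1,N}\neq0$. Let $L\in\mathbb{N}$ and, for $\ell=1,\dots,L$, let $m_\ell:\mathbb{N}\to\mathbb{N}$ be functions with $m_\ell(N)\to\infty$ as $N\to\infty$ and $m_i(N)<m_j(N)$ for $i<j$. Then for all $k_1,\dots,k_L\in\{0,1,\dots,b-1\}$ and every $\varepsilon>0$, $$\left|\mathbb{P}\big(d_{m_1(N),N}=k_1,\dots,d_{m_L(N),N}=k_L\big)-\frac{1}{b^L}\right|=\mathcal{O}\Big(\frac{1}{(\log N)^{3/2-\varepsilon}}+\frac{1}{b^{m_1(N)}}\Big)\quad\text{as }N\to\infty.$$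
   Context: The circular $\beta$-ensemble (C$\beta$E) with $N$ points is the random vector $(\theta_1,\dots,\theta_N)\in[0,2\pi)^N$ whose law has density proportional to $\prod_{1\leq j<k\leq N}|e^{i\theta_j}-e^{i\theta_k}|^\beta$ with respect to Lebesgue measure. *)

(* Defs.v *)
From HB Require Import structures.
From mathcomp Require Import all_boot all_order all_algebra.
From mathcomp Require Import all_classical all_reals all_analysis.
Set Implicit Arguments. Unset Strict Implicit. Unset Printing Implicit Defensive.
Import Order.TTheory GRing.Theory Num.Theory.
Import numFieldNormedType.Exports.
Local Open Scope classical_set_scope.
Local Open Scope ring_scope.

Section CbetaE.
Variable R : realType.

(* |e^{ia} - e^{ib}| written out through real and imaginary parts *)
Definition cdist (a c : R) : R :=
  Num.sqrt ((cos a - cos c) ^+ 2 + (sin a - sin c) ^+ 2).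

Definition cbe_density (beta : R) (N : nat) (v : nat -> R) : R :=
  \prod_(j < N) \prod_(k < N | (j < k)%N) (cdist (v j) (v k)) `^ beta.

Definition absD (N : nat) (theta : R) (v : nat -> R) : R :=
  \prod_(j < N) cdist theta (v j).

Fixpoint iter_int (n : nat) (F : (nat -> R) -> \bar R) : \bar R :=
  match n with
  | 0 => F (fun _ => 0)
  | n'.+1 => (\int[lebesgue_measure]_(x in `[0%R, (2 * pi)%R[)
               iter_int n' (fun w => F (fun j => if j == 0%N then x else w j.-1)))%E
  end.

Definition cbe_prob (beta : R) (N : nat) (E : set (nat -> R)) : R :=
  fine (iter_int N (fun v => ((\1_E v : R) * cbe_density beta N v)%:E)) /
  fine (iter_int N (fun v => (cbe_density beta N v)%:E)).

(* exponent M with b^M <= x < b^(M+1), for x > 0 *)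
Definition bexp (b : nat) (x : R) : int := Num.floor (ln x / ln b%:R).

(* k-th base-b digit d_k of x > 0, where x = (sum_k d_k b^(1-k)) b^M, d_1 <> 0
   (standard expansion, not ending in infinitely many digits b-1);
   set to 0 for x <= 0 (a null event). *)
Definition bdigit (b : nat) (x : R) (k : nat) : int :=
  if 0 < x then
    ((Num.floor (x * (b%:R) ^ (k%:Z - 1 - bexp b x))) %% (b%:Z))%Z
  else 0.

End CbetaE.

(* Main.v *)
Require Import Defs.
From HB Require Import structures.
From mathcomp Require Import all_boot all_order all_algebra perm.
From mathcomp Require Import all_classical all_reals all_analysis.
From mathcomp Require Import measurable_realfun complex ring lra zify.
Set Implicit Arguments. Unset Strict Implicit. Unset Printing Implicit Defensive.
Import Order.TTheory GRing.Theory Num.Theory.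
Import numFieldNormedType.Exports.
Local Open Scope classical_set_scope.
Local Open Scope ring_scope.

(** Let [F s] be the integral of [|D|^s] against the unnormalized density.
    Integrating by parts in one angle and symmetrizing (Aomoto's method), the
    moments [<u_0 ... u_(p-1) prod_j (1 - z_j^-1)^m>], with
    [z_j = e^(i (theta_j - theta))] and [u_j = 1 - z_j], satisfy a two-term
    recursion in [p]. It yields [F (s + 2) = R s * F s] where, with
    [lam = beta / 2],
      [R s = prod_(j < N) (1+s+lam j) (2+s+lam j) / (1+s/2+lam j)^2].
    As [|F (2K + i t)| <= F (2K)], iterating gives
      [|F (i t)| / F 0 <= prod_(k < K) R (2k) / |R (2k + i t)|],
    which is [O (t^-2 (ln N)^-2)] uniformly in [t >= t0 > 0]. Hence the Fourier
    coefficients of [log_b |D|] modulo 1 have sum [O ((ln N)^-2)], so that its law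
    gives any interval at most [1 + O ((ln N)^-2)] times its length; taking
    complements, the probability of a finite union of intervals is its length up
    to [O ((ln N)^-2)]. Finally, under the uniform law of [log_b |D|] modulo 1,
    digits beyond the first [m_1 - 1] are uniform up to [O (b^-m_1)]. *)

(** * Iterated integrals as a product measure *)

(** Differentiating the density gives factors unbounded near the diagonal when [beta < 1]. The
    weight is therefore regularized by [delta], and [delta] is sent to 0 only after symmetrization
    has turned each singular factor into one bounded by 1.

    With [A = 2 + 2k + 2 lam j], the [j]-th factor of [R (2k) / |R (2k + i t)|] is at most the
    exponential of minus [lam j t^2 / (A (A^2 + t^2))]. A single fixed [j] with [lam j >= 8], summed
    over [k] up to about [t / 2], yields [t^-2], which makes the Fourier coefficients summable. The
    larger [j], each with [k < j], contribute order [1 / j], hence a negative power of [N], of which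
    only [(ln N)^-2] is kept; this already beats the exponent [3/2 - eps].

    The positions [m_l] may grow at any speed, so the digit event is a union of intervals whose
    number, exponential in [m_L], is out of control. An additive error for each interval would be
    useless: the error must be proportional to the length. Positivity of the Fejer kernel gives
    upper bounds of that form, and the lower bound has to come from the complement. *)

Definition rseq (R : realType) : Type := nat -> R.

Section product_measure.
Variable R : realType.
Notation T := (rseq R).

HB.instance Definition _ := Choice.on T.
HB.instance Definition _ := Pointed.copy T (nat -> R).

Definition coord_measurable : set (set T) :=
  <<s \bigcup_i preimage_set_system setT (fun v : T => v i) measurable >>.

Let coord_set0 : coord_measurable set0.
Proof. exact: sigma_algebra0. Qed.

Let coord_setC A : coord_measurable A -> coord_measurable (~` A).
Proof. exact: sigma_algebraC. Qed.

Let coord_bigcup (F : _^nat) : (forall i, coord_measurable (F i)) ->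
  coord_measurable (\bigcup_i (F i)).
Proof. exact: sigma_algebra_bigcup. Qed.

HB.instance Definition _ := @isMeasurable.Build default_measure_display
  T coord_measurable coord_set0 coord_setC coord_bigcup.

Lemma measurable_coord (i : nat) : measurable_fun [set: T] (fun v : T => v i).
Proof.
move=> _ Y mY; rewrite setTI; apply: sub_sigma_algebra => /=.
by exists i => //; exists Y => //; rewrite setTI.
Qed.

Lemma measurable_rseq d (T1 : measurableType d) (f : T1 -> T) :
  (forall i, measurable_fun [set: T1] (fun x => f x i)) ->
  measurable_fun [set: T1] f.
Proof.
move=> mf.
apply: (@measurability _ _ T1 T _ _ (\bigcup_i preimage_set_system setT (fun v : T => v i) measurable)) => //.
move=> A [B [i _ [C mC <-]] <-].
rewrite setTI preimage_setI preimage_setT setTI.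
by have := mf i measurableT C mC; rewrite setTI.
Qed.

Definition rcons0 (p : measurableTypeR R * T) : T := fun j => if j == 0%N then p.1 else p.2 j.-1.

Lemma measurable_rcons0 : measurable_fun [set: measurableTypeR R * T] rcons0.
Proof.
apply: measurable_rseq => -[|i] /=.
  exact: measurable_fst.
rewrite /rcons0/=.
by apply: (measurableT_comp (measurable_coord i)) => //; exact: measurable_snd.
Qed.

HB.instance Definition _ := isMeasurableFun.Build _ _ _ _ rcons0 measurable_rcons0.

Lemma twopi_gt0 : (0 : R) < 2 * pi.
Proof. by rewrite mulr_gt0// pi_gt0. Qed.

Definition unif : probability (measurableTypeR R) R := uniform_prob twopi_gt0.

(** The law of [n] independent uniform angles followed by zeros, built by the same prepending as
    [iter_int]. Normalizing to total mass 1 makes every bounded measurable function integrable. *)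
Fixpoint mu (n : nat) : probability T R :=
  if n is n'.+1 then distribution (unif \x mu n')%E rcons0
  else \d_((fun _ => 0) : T).

Local Open Scope ereal_scope.

Lemma integral_muS n (f : T -> \bar R) :
  measurable_fun [set: T] f -> (forall v, 0 <= f v) ->
  \int[mu n.+1]_v f v = \int[unif]_x \int[mu n]_w f (rcons0 (x, w)).
Proof.
move=> mf f0.
rewrite [LHS](@ge0_integral_distribution _ _ _ _ _ (unif \x mu n) rcons0)//.
rewrite (fubini_tonelli1 (m1 := unif) (m2 := mu n) (f \o rcons0))//.
- exact: (measurableT_comp mf measurable_rcons0).
- by move=> p; exact: f0.
Qed.

Lemma measurable_rcons0l (x : measurableTypeR R) :
  measurable_fun [set: T] (fun w => rcons0 (x, w)).
Proof.
apply: measurable_rseq => -[|i]; rewrite /rcons0/=; first exact: measurable_cst.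
exact: measurable_coord.
Qed.

Lemma measurable_integral_mu n (f : T -> \bar R) :
  measurable_fun [set: T] f -> (forall v, 0 <= f v) ->
  measurable_fun [set: measurableTypeR R]
    (fun x => \int[mu n]_w f (rcons0 (x, w))).
Proof.
move=> mf f0.
apply: (measurable_fun_fubini_tonelli_F (m2 := mu n) (f \o rcons0)).
  exact: (measurableT_comp mf measurable_rcons0).
by move=> p; exact: f0.
Qed.

Lemma iter_intE n (F : (nat -> R) -> \bar R) :
  measurable_fun [set: T] (F : T -> \bar R) -> (forall v, 0 <= F v) ->
  iter_int n F = ((2 * pi) ^+ n)%:E * \int[mu n]_v (F v).
Proof.
elim: n F => [|n IH] F mF F0.
  by rewrite /= expr0 mul1e integral_dirac// diracT mul1e.
have mF' x : measurable_fun [set: T] (fun w => F (rcons0 (x, w))).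
  exact: (measurableT_comp mF (measurable_rcons0l x)).
have mI := measurable_integral_mu n mF F0.
rewrite [LHS]/=.
under eq_integral do rewrite (IH _ (mF' _))//.
have pn0 : 0 <= ((2 * pi : R) ^+ n)%:E.
  by rewrite lee_fin exprn_ge0// ltW// twopi_gt0.
rewrite integral_itv_bndo_bndc; last first.
  apply: measurable_funTS; apply: emeasurable_funM => //.
rewrite ge0_integralZl//; last 2 first.
  exact: measurable_funTS.
  by move=> x _; exact: integral_ge0.
rewrite integral_muS// (integral_uniform twopi_gt0)//; last first.
  by move=> x; exact: integral_ge0.
by rewrite muleA -EFinM exprSr subr0 mulfK// gt_eqF// twopi_gt0.
Qed.

Definition reindex_coord (sigma : nat -> nat) (v : T) : T := fun k => v (sigma k).

Lemma measurable_reindex_coord sigma :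
  measurable_fun [set: T] (reindex_coord sigma).
Proof. by apply: measurable_rseq => i; exact: measurable_coord. Qed.

Definition mu_invariant n sigma := forall f : T -> \bar R,
  measurable_fun [set: T] f -> (forall v, 0 <= f v) ->
  \int[mu n]_v f (reindex_coord sigma v) = \int[mu n]_v f v.

Lemma mu_invariant_comp n sigma tau : mu_invariant n sigma ->
  mu_invariant n tau -> mu_invariant n (sigma \o tau).
Proof.
move=> hs ht f mf f0; rewrite -[RHS]ht//.
rewrite -(hs (fun v => f (reindex_coord tau v)))//.
exact: (measurableT_comp mf (measurable_reindex_coord tau)).
Qed.

Definition liftn (sigma : nat -> nat) k := if k is k'.+1 then (sigma k').+1 else 0%N.

Lemma mu_invariant_lift n sigma : mu_invariant n sigma ->
  mu_invariant n.+1 (liftn sigma).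
Proof.
move=> hs f mf f0.
rewrite integral_muS//; last first.
  exact: (measurableT_comp mf (measurable_reindex_coord (liftn sigma))).
rewrite (integral_muS _ mf f0); apply: eq_integral => x _.
rewrite -(hs (fun w => f (rcons0 (x, w))))//; last first.
  exact: (measurableT_comp mf (measurable_rcons0l x)).
by apply: eq_integral => w _; congr f; apply/funext => -[|k].
Qed.

Definition swapn (i j k : nat) := if k == i then j else if k == j then i else k.

Lemma mu_invariant01 n : mu_invariant n.+2 (swapn 0 1).
Proof.
move=> f mf f0.
have mfs : measurable_fun [set: T] (fun v => f (reindex_coord (swapn 0 1) v)).
  exact: (measurableT_comp mf (measurable_reindex_coord _)).
have E g : measurable_fun [set: T] g -> (forall v, 0 <= g v) ->
    \int[mu n.+2]_v g v = \int[unif]_x \int[unif]_y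
       \int[mu n]_w g (rcons0 (x, rcons0 (y, w))).
  move=> mg g0; rewrite integral_muS//; apply: eq_integral => x _.
  by rewrite integral_muS//; exact: (measurableT_comp mg (measurable_rcons0l x)).
rewrite (E _ mfs (fun v => f0 _)) (E _ mf f0).
pose ibp_fun (p : measurableTypeR R * measurableTypeR R) :=
  \int[mu n]_w f (rcons0 (p.1, rcons0 (p.2, w))).
have mG : measurable_fun setT ibp_fun.
  apply: (measurable_fun_fubini_tonelli_F (m2 := mu n)
   (fun q : (measurableTypeR R * measurableTypeR R) * T => f (rcons0 (q.1.1, rcons0 (q.1.2, q.2))))) => //.
  apply: (measurableT_comp mf); apply: measurable_rseq => -[|[|i]] /=.
  - exact: (measurableT_comp measurable_fst measurable_fst).
  - exact: (measurableT_comp measurable_snd measurable_fst).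
  - by apply: (measurableT_comp (measurable_coord i)); exact: measurable_snd.
have G0 p : 0 <= ibp_fun p by exact: integral_ge0.
transitivity (\int[unif]_x \int[unif]_y ibp_fun (y, x)).
  apply: eq_integral => x _; apply: eq_integral => y _; apply: eq_integral => w _.
  by congr f; apply/funext => -[|[|k]].
symmetry.
exact: (fubini_tonelli (m1 := unif) (m2 := unif) ibp_fun mG G0).
Qed.

Lemma mu_invariant_eq n sigma tau : sigma =1 tau -> mu_invariant n sigma ->
  mu_invariant n tau.
Proof. by move=> /funext ->. Qed.

(** Transpositions that fix 0 are lifted from [n - 1] coordinates, the exchange of 0 and 1 is
    Tonelli, and the remaining ones are conjugates: [(0 j) = (1 j) (0 1) (1 j)]. *)
Lemma mu_invariant_swap n i j : (i < j)%N -> (j < n)%N -> mu_invariant n (swapn i j).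
Proof.
elim: n i j => // n IH i j ij jn.
case: i => [|i] in ij *; last first.
  case: j => // j in ij jn *.
  apply: (mu_invariant_eq _ (mu_invariant_lift (IH i j ij jn))).
  by case => [|k] //=; rewrite /swapn !eqSS; case: eqP => //; case: eqP.
case: j => // -[|j] in ij jn *.
  by case: n IH jn => // n _ _; exact: mu_invariant01.
case: n IH jn => // n IH jn.
have h1 : mu_invariant n.+2 (swapn 1 j.+2).
  apply: (mu_invariant_eq _ (mu_invariant_lift (IH 0%N j.+1 _ jn))) => //.
  by case => [|k] //=; rewrite /swapn !eqSS; case: eqP => //; case: eqP.
apply: (mu_invariant_eq _ (mu_invariant_comp h1 (mu_invariant_comp (mu_invariant01 n) h1))).
move=> k; rewrite /swapn/=.
case: k => [|[|k]] //=; rewrite ?eqxx// !eqSS.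
by have [kj|kj] := boolP (k == j); rewrite /= ?eqxx ?eqSS ?kj// (negbTE kj).
Qed.

Lemma mu_preimage_swap n i j A : (i < j)%N -> (j < n)%N -> measurable A ->
  pushforward (mu n) (reindex_coord (swapn i j)) A = mu n A.
Proof.
move=> ij jn mA.
have mi : measurable_fun [set: T] (fun v => (\1_A v : R)%:E).
  by apply/measurable_EFinP; exact: measurable_indic.
have mP : measurable (reindex_coord (swapn i j) @^-1` A).
  by have := measurable_reindex_coord (swapn i j) measurableT mA; rewrite setTI.
have h0 v : 0 <= (\1_A v : R)%:E by rewrite lee_fin.
have e := mu_invariant_swap ij jn mi h0.
rewrite (integral_indic (mu n) measurableT mA) setIT in e.
rewrite -e /pushforward -[in LHS](setIT (_ @^-1` _)).
by rewrite -(integral_indic (mu n) measurableT mP).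
Qed.
End product_measure.

(** * Bounded measurable functions and expectations *)

Section bounded_measurable.
Context {d : measure_display} {T : measurableType d} {R : realType}.
Implicit Types f g : T -> R.

(** An algebra of functions integrable for every probability. The weights stay in it because [Re s]
    and [lam] are nonnegative, so integrability never needs a separate argument. *)
Definition bm f := measurable_fun [set: T] f /\ exists M : R, forall v, `|f v| <= M.

Lemma bm_cst c : bm (fun _ => c).
Proof. by split; [exact: measurable_cst|exists `|c|]. Qed.

Lemma bmD f g : bm f -> bm g -> bm (fun v => f v + g v).
Proof.
move=> [mf [M hM]] [mg [N hN]]; split; first exact: measurable_funD.
by exists (M + N) => v; rewrite (le_trans (ler_normD _ _))// lerD.
Qed.

Lemma bmN f : bm f -> bm (fun v => - f v).
Proof.
move=> [mf [M hM]]; split; first exact: measurableT_comp.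
by exists M => v; rewrite normrN.
Qed.

Lemma bmB f g : bm f -> bm g -> bm (fun v => f v - g v).
Proof. by move=> bf bg; apply: bmD => //; exact: bmN. Qed.

Lemma bmM f g : bm f -> bm g -> bm (fun v => f v * g v).
Proof.
move=> [mf [M hM]] [mg [N hN]]; split; first exact: measurable_funM.
by exists (M * N) => v; rewrite normrM ler_pM.
Qed.

Lemma bmZ c f : bm f -> bm (fun v => c * f v).
Proof. by move=> bf; apply: bmM => //; exact: bm_cst. Qed.

Lemma bm_sum I (r : seq I) (P : pred I) (F : I -> T -> R) :
  (forall i, P i -> bm (F i)) -> bm (fun v => \sum_(i <- r | P i) F i v).
Proof.
move=> h; elim: r => [|i r IH].
  by under eq_fun do rewrite big_nil; exact: bm_cst.
under eq_fun do rewrite big_cons; case: (boolP (P i)) => // Pi.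
by apply: bmD => //; exact: h.
Qed.

Lemma bm_comp (h : R -> R) f : measurable_fun [set: T] f ->
  measurable_fun [set: R] h -> (exists M : R, forall x, `|h x| <= M) ->
  bm (fun v => h (f v)).
Proof.
move=> mf mh [M hM]; split; last by exists M => v.
exact: measurableT_comp.
Qed.

Lemma bm_indic (A : set T) : measurable A -> bm (fun v => \1_A v).
Proof.
move=> mA; split; first exact: measurable_indic.
exists 1 => v; rewrite indicE; case: (_ \in _); rewrite ?normr1 ?normr0//.
Qed.

Variable P : probability T R.

Lemma bm_integrable f : bm f -> P.-integrable setT (EFin \o f).
Proof.
move=> [mf [M hM]]; apply: measurable_bounded_integrable => //.
  exact: (le_lt_trans (probability_le1 P measurableT) (ltry _)).
exists M; split; first exact: num_real.
by move=> y My x _ /=; rewrite (le_trans (hM x))// ltW.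
Qed.

Definition Ex f : R := \int[P]_v f v.

Lemma ExD f g : bm f -> bm g -> Ex (fun v => f v + g v) = Ex f + Ex g.
Proof. by move=> bf bg; rewrite /Ex RintegralD//; exact: bm_integrable. Qed.

Lemma ExZ c f : bm f -> Ex (fun v => c * f v) = c * Ex f.
Proof. by move=> bf; rewrite /Ex RintegralZl//; exact: bm_integrable. Qed.

Lemma ExN f : bm f -> Ex (fun v => - f v) = - Ex f.
Proof.
move=> bf; rewrite -mulN1r -ExZ//.
by congr Ex; apply/funext => v; rewrite mulN1r.
Qed.

Lemma ExB f g : bm f -> bm g -> Ex (fun v => f v - g v) = Ex f - Ex g.
Proof. by move=> bf bg; rewrite ExD ?ExN//; exact: bmN. Qed.

Lemma Ex_cst c : Ex (fun _ => c) = c.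
Proof.
rewrite /Ex Rintegral_cst//; transitivity (c * fine (1%E : \bar R)).
  by congr (_ * fine _); exact: probability_setT.
by rewrite mulr1.
Qed.

Lemma Ex_sum I (r : seq I) (Q : pred I) (F : I -> T -> R) :
  (forall i, Q i -> bm (F i)) ->
  Ex (fun v => \sum_(i <- r | Q i) F i v) = \sum_(i <- r | Q i) Ex (F i).
Proof.
move=> h; elim: r => [|i r IH].
  by rewrite big_nil; under eq_fun do rewrite big_nil; rewrite Ex_cst.
rewrite big_cons; under eq_fun do rewrite big_cons; case: (boolP (Q i)) => // Qi.
by rewrite ExD ?IH//; [exact: h|exact: bm_sum].
Qed.

Lemma Ex_le f g : bm f -> bm g -> (forall v, f v <= g v) -> Ex f <= Ex g.
Proof. by move=> bf bg h; apply: le_Rintegral => //; exact: bm_integrable. Qed.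

Lemma Ex_ae f g : bm f -> bm g -> {ae P, forall v, f v = g v} -> Ex f = Ex g.
Proof.
move=> [mf _] [mg _] h; rewrite /Ex /Rintegral; congr fine.
apply: ae_eq_integral => //; try exact/measurable_EFinP.
by apply: filterS h => v /= -> _.
Qed.

Lemma Ex_le_ae f g : bm f -> bm g -> {ae P, forall v, f v <= g v} -> Ex f <= Ex g.
Proof.
move=> bf bg h.
(* The maximum dominates [f] everywhere and equals [g] almost everywhere, which reduces the claim to
   [Ex_le] and [Ex_ae]. *)
have bmax : bm (fun v => Num.max (f v) (g v)).
  case: bf bg => mf [M hM] [mg [M' hM']]; split; first exact: measurable_maxr.
  exists (M + M') => v; have := hM v; have := hM' v.
  have := normr_ge0 (f v); have := normr_ge0 (g v).
  by rewrite maxEle; case: ifP => _; lra.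
rewrite (@Ex_ae g (fun v => Num.max (f v) (g v)))//.
  by apply: Ex_le => // v; rewrite le_max lexx.
by apply: filterS h => v fg; rewrite max_r.
Qed.

Lemma Ex_gt0 f : bm f -> (forall v, 0 <= f v) -> {ae P, forall v, 0 < f v} ->
  0 < Ex f.
Proof.
move=> bf f0 fpos.
have fi := bm_integrable bf.
rewrite lt_neqAle; apply/andP; split; last by apply: Rintegral_ge0 => v _.
apply/negP => /eqP/esym E0.
have I0 : (\int[P]_v `|(f v)%:E| = 0)%E.
  rewrite -[RHS]/(0%:E) -E0 /Ex /Rintegral fineK; last exact: integrable_fin_num.
  by apply: eq_integral => v _; rewrite /= ger0_norm.
have mf : measurable_fun [set: T] (EFin \o f) by apply/measurable_EFinP; case: bf.
have /(ae_eq_integral_abs P measurableT mf) h := I0.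
have : {ae P, forall v : T, False}.
  apply: filterS2 fpos h => v v0 /(_ I) /= [] e.
  by move: v0; rewrite e ltxx.
rewrite /almost_everywhere => -[A [mA PA sA]].
have : (P setT <= P A)%E by apply: le_measure; rewrite ?inE// => x _; exact: sA.
by rewrite probability_setT PA lee_fin ler10.
Qed.

Lemma Ex_dct (f_ : nat -> T -> R) f M :
  (forall k, measurable_fun [set: T] (f_ k)) -> measurable_fun [set: T] f ->
  (forall k v, `|f_ k v| <= M) ->
  {ae P, forall v, f_ k v @[k --> \oo] --> f v} ->
  Ex (f_ k) @[k --> \oo] --> Ex f.
Proof.
move=> mf_ mf hM hae.
have ig : P.-integrable setT (EFin \o (fun _ : T => M)) by apply/bm_integrable/bm_cst.
have [] := @dominated_convergence _ T R P setT measurableT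
  (fun k => EFin \o f_ k) (EFin \o f) (EFin \o (fun _ => M)) _ _ _ ig _.
- by move=> k; exact/measurable_EFinP.
- exact/measurable_EFinP.
- by apply: filterS hae => v /= h _; apply: cvg_EFin => //; near=> k.
- by apply: aeW => v k _ /=; rewrite lee_fin.
move=> fi _ h; rewrite /Ex /Rintegral.
by apply: fine_cvg; rewrite fineK//; exact: integrable_fin_num.
Unshelve. all: by end_near.
Qed.

End bounded_measurable.

(** * Exchange of coordinates and integration by parts under [mu] *)

Section mu_expectation.
Variable R : realType.
Notation T := (rseq R).
Implicit Types f g : T -> R.

Lemma Ex_swap n i j f : bm f -> (i < j)%N -> (j < n)%N ->
  Ex (mu R n) (fun v => f (reindex_coord (swapn i j) v)) = Ex (mu R n) f.
Proof.
move=> bf ij jn; rewrite /Ex /Rintegral; congr fine.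
have ms := @measurable_reindex_coord R (swapn i j).
have mf : measurable_fun [set: T] (EFin \o f) by apply/measurable_EFinP; case: bf.
rewrite -[RHS](@eq_measure_integral _ _ _ _ _ (pushforward (mu R n) (reindex_coord (swapn i j)))); last first.
  by move=> A mA _; exact: mu_preimage_swap.
rewrite (integral_pushforward ms)//.
apply: bm_integrable; case: bf => mf' [M hM]; split; last by exists M => v.
exact: (measurableT_comp mf' ms).
Qed.

Lemma bm_reindex sigma f : bm f -> bm (fun v => f (reindex_coord sigma v)).
Proof.
move=> [mf [M hM]]; split; last by exists M => v.
exact: (measurableT_comp mf (@measurable_reindex_coord R sigma)).
Qed.

Lemma integral_unif_derive (g g' : R -> R) :
  (forall x : R, is_derive x (1 : R) g (g' x)) -> continuous g' ->
  (exists M : R, forall x, `|g' x| <= M) -> g 0 = g (2 * pi) ->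
  (\int[unif R]_x (g' x)%:E = 0)%E.
Proof.
move=> dg cg [M hM] g02.
have mg : measurable_fun [set: measurableTypeR R] g' by exact: continuous_measurable_fun.
have bg : @bm _ (measurableTypeR R) R g' by split => //; exists M.
(* The formula for integrals against the uniform law asks for a nonnegative integrand. The shift by
   the bound [M] provides one and is subtracted again at the end. *)
pose h x := g' x + M.
have h0 x : (0 <= (h x)%:E)%E.
  by rewrite lee_fin /h -lerBlDr sub0r; have := hM x; rewrite ler_norml => /andP[].
have Eh : (\int[unif R]_x (h x)%:E = M%:E)%E.
  rewrite (integral_uniform (twopi_gt0 R))//; last first.
    by apply/measurable_EFinP; apply: measurable_funD => //; exact: measurable_cst.
  have dh x : is_derive x (1 : R) (fun x => g x + M * x) (h x).
    have := dg x => ?; rewrite /h.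
    by apply: is_derive_eq; rewrite /GRing.scale/= ?mulr1 ?mulr0 ?addr0.
  rewrite (@continuous_FTC2 _ _ (fun x => g x + M * x))//.
  - rewrite -g02 !subr0 -EFinB -EFinM; congr (_%:E).
    by rewrite mulr0 addr0 [g 0 + _]addrC addrK mulrC mulfK// gt_eqF// twopi_gt0.
  - exact: twopi_gt0.
  - apply: continuous_subspaceT => x; apply: cvgD; [exact: cg|exact: cvg_cst].
  - have cG : forall x, {for x, continuous (fun x => g x + M * x)}.
      move=> x; apply: differentiable_continuous; apply/derivable1_diffP.
      by have [] := dh x.
    split.
    + by move=> x _; have [] := dh x.
    + by apply: cvg_at_right_filter; exact: cG.
    + by apply: cvg_at_left_filter; exact: cG.
  - by move=> x _; rewrite derive1E; have [_ ->] := dh x.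
have : Ex (unif R) h = M by rewrite /Ex /Rintegral Eh.
rewrite ExD//; last exact: bm_cst.
rewrite Ex_cst => E.
have E0 : Ex (unif R) g' = 0 by apply: (addIr M); rewrite E add0r.
rewrite -[RHS]/(0%:E) -E0 /Ex /Rintegral fineK//.
by apply: integrable_fin_num => //; exact: bm_integrable.
Qed.

(** Fubini puts the integral over the first angle innermost; with the other angles frozen it is the
    integral of the derivative of a function with equal values at 0 and [2 * pi]. *)
Lemma Ex_ibp n (g g' : T -> R) : bm g' ->
  (forall w (x : R), is_derive x (1 : R) (fun x => g (rcons0 (x, w))) (g' (rcons0 (x, w)))) ->
  (forall w, continuous (fun x : R => g' (rcons0 (x, w)))) ->
  (forall w, g (rcons0 (0, w)) = g (rcons0 (2 * pi, w))) ->
  Ex (mu R n.+1) g' = 0.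
Proof.
move=> bg' dg cg g02; rewrite /Ex /Rintegral.
have mr := @measurable_rcons0 R.
have bgr : bm (g' \o @rcons0 R).
  by case: bg' => mg [M hM]; split; [exact: (measurableT_comp mg mr)|exists M => p; exact: hM].
rewrite (_ : integral _ _ _ = 0)//.
rewrite [LHS](@integral_distribution _ _ _ _ _ (unif R \x mu R n)%E (@rcons0 R))//; last 2 first.
  by apply/measurable_EFinP; case: bg'.
  exact: (@bm_integrable _ _ _ (unif R \x mu R n)%E _ bgr).
rewrite -(integral21_prod_meas1 (m1 := unif R) (m2 := mu R n)); last first.
  exact: (@bm_integrable _ _ _ (unif R \x mu R n)%E _ bgr).
rewrite -[RHS](integral0 (mu R n) setT); apply: eq_integral => w _.
rewrite /fubini_G; apply: (@integral_unif_derive (fun x => g (rcons0 (x, w)))) => //.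
  exact: (cg w).
by case: bg' => _ [M hM]; exists M => x.
Qed.

End mu_expectation.

(** * Chordal distance and null sets *)

Section null_sets.
Variable R : realType.
Notation T := (rseq R).

(** The squared chord [|e^(ia) - e^(ic)|^2], which is smooth where [cdist] is not. *)
Definition sqd (a c : R) : R := 2 - 2 * cos (a - c).

Lemma cdist_sqd a c : cdist a c = Num.sqrt (sqd a c).
Proof.
rewrite /cdist /sqd cosB; congr Num.sqrt.
have := cos2Dsin2 a; have := cos2Dsin2 c; rewrite !expr2 => h1 h2.
by nra.
Qed.

Lemma sqd_ge0 a c : 0 <= sqd a c.
Proof. by rewrite /sqd; have := cos_le1 (a - c); lra. Qed.

Lemma sqd_le4 a c : sqd a c <= 4.
Proof. by rewrite /sqd; have := cos_geN1 (a - c); lra. Qed.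

Lemma sqdC a c : sqd a c = sqd c a.
Proof. by rewrite /sqd -cosN opprB. Qed.

Lemma sqd_sin2 a c : sqd a c = 4 * sin ((a - c) / 2) ^+ 2.
Proof.
rewrite /sqd {1}(_ : a - c = (a - c) / 2 + (a - c) / 2); last by lra.
by rewrite cosD; have := cos2Dsin2 ((a - c) / 2); rewrite !expr2; lra.
Qed.

Lemma sqd_eq0_cos a c : sqd a c = 0 -> cos (a - c) = 1.
Proof. by rewrite /sqd; lra. Qed.

Lemma sqd_eq0 x y : sqd x y = 0 -> `|x - y| <= 2 * pi ->
  [\/ x = y, x = y + 2 * pi | x = y - 2 * pi].
Proof.
rewrite sqd_sin2 => /eqP; rewrite mulf_eq0 pnatr_eq0/= expf_eq0/= => /eqP s0 h.
have [xy|xy|->] := ltgtP x y; last by constructor 1.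
- have [e|ne] := eqVneq x (y - 2 * pi); first by constructor 3.
  have : 0 < sin ((y - x) / 2).
    apply: sin_gt0_pi; move: h; rewrite ltr0_norm ?subr_lt0// => h.
    move/eqP: ne => ne; apply/andP; split; first by lra.
    rewrite lt_neqAle; apply/andP; split; last by lra.
    by apply/negP => /eqP e; apply: ne; lra.
  by rewrite -opprB mulNr sinN s0 oppr0 ltxx.
- have [e|ne] := eqVneq x (y + 2 * pi); first by constructor 2.
  have : 0 < sin ((x - y) / 2).
    apply: sin_gt0_pi; move: h; rewrite gtr0_norm ?subr_gt0// => h.
    move/eqP: ne => ne; apply/andP; split; first by lra.
    rewrite lt_neqAle; apply/andP; split; last by lra.
    by apply/negP => /eqP e; apply: ne; lra.
  by rewrite s0 ltxx.
Qed.

Lemma sqd_trans c x y : sqd c x = 0 -> sqd c y = 0 -> sqd x y = 0.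
Proof.
move=> /sqd_eq0_cos h1 /sqd_eq0_cos h2.
have s1 : sin (c - x) = 0 by apply: cos1sin0; rewrite h1 normr1.
rewrite /sqd (_ : x - y = (c - y) - (c - x)); last by lra.
by rewrite cosB h1 h2 s1; lra.
Qed.

(** Two zeros in [[0, 2 pi]] are equal or differ by [2 pi], so there are at most three candidates;
    the uniform law sees nothing outside this interval. *)
Lemma unif_sqd_null c : unif R [set x | sqd c x = 0] = 0%E.
Proof.
set A := [set x | _].
have sA : exists x0 : R, A `&` `[0, 2 * pi] `<=` [set x0; x0 + 2 * pi; x0 - 2 * pi].
  have [E|/set0P[x0 [Ax0 x0I]]] := eqVneq (A `&` `[0, 2 * pi]) set0.
    by exists 0; rewrite E.
  exists x0 => x [Ax xI].
  have := sqd_eq0 (sqd_trans Ax Ax0).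
  move: x0I xI; rewrite /= !in_itv/= => /andP[? ?] /andP[? ?].
  have xx : `|x - x0| <= 2 * pi by rewrite ler_norml; apply/andP; split; lra.
  by move=> /(_ xx)[->|->|->]; [left; left|left; right|right].
have E : unif R A = unif R (A `&` `[0, 2 * pi]).
  rewrite /unif/= /uniform_prob integral_uniform_pdf [RHS]integral_uniform_pdf.
  by rewrite -setIA setIid.
rewrite E; case: sA => x0 sA.
have cA : countable (A `&` `[0, 2 * pi]%classic).
  by apply: sub_countable (finite_set_countable (finite_set3 _ _ _)); exact: subset_card_le sA.
have mA : measurable (A `&` `[0, 2 * pi]%classic).
  exact: countable_measurable.
have := dominates_uniform_prob (twopi_gt0 R).
move=> /null_content_dominatesP; apply => //.
exact: countable_lebesgue_measure0.
Qed.

Lemma mu_null_slice n (A : set T) : measurable A ->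
  (forall w, unif R [set x | A (rcons0 (x, w))] = 0%E) -> mu R n.+1 A = 0%E.
Proof.
move=> mA hA.
have mi : measurable_fun [set: T] (fun v => (\1_A v : R)%:E).
  by apply/measurable_EFinP; exact: measurable_indic.
rewrite -[A]setIT -(integral_indic (mu R n.+1) measurableT mA).
rewrite [LHS](@ge0_integral_distribution _ _ _ _ _ (unif R \x mu R n)%E (@rcons0 R))//.
rewrite (fubini_tonelli2 (m1 := unif R) (m2 := mu R n)
  (fun p => (\1_A (rcons0 p) : R)%:E) (measurableT_comp mi (@measurable_rcons0 R)))//.
rewrite -[RHS](integral0 (mu R n) setT); apply: eq_integral => w _.
rewrite /fubini_G -(hA w) -[in RHS](setIT [set x | A (rcons0 (x, w))]).
rewrite -(integral_indic (unif R) measurableT)//.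
rewrite (_ : [set x | _] = (fun x : measurableTypeR R => rcons0 (x, w)) @^-1` A)//.
rewrite -[X in measurable X]setTI.
have mr : measurable_fun [set: measurableTypeR R] (fun x => rcons0 (x, w)).
  by apply: measurable_rseq => -[|i]; rewrite /rcons0/=; [exact: measurable_id|exact: measurable_cst].
exact: (mr measurableT A mA).
Qed.

Lemma measurable_sqd d (T' : measurableType d) (f g : T' -> R) :
  measurable_fun [set: T'] f -> measurable_fun [set: T'] g ->
  measurable_fun [set: T'] (fun v => sqd (f v) (g v)).
Proof.
move=> mf mg; apply: measurable_funB; first exact: measurable_cst.
apply: measurable_funM; first exact: measurable_cst.
apply: (@measurableT_comp _ _ _ _ _ _ (@cos R)).
  exact: (continuous_measurable_fun (@continuous_cos R)).
exact: measurable_funB.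
Qed.

Lemma measurable_sqd0 (f g : T -> R) :
  measurable_fun [set: T] f -> measurable_fun [set: T] g ->
  measurable [set v : T | sqd (f v) (g v) = 0].
Proof.
move=> mf mg; have := measurable_sqd mf mg measurableT (measurable_set1 0).
by rewrite setTI.
Qed.

Lemma measurable_sqd0_cst theta j : measurable [set v : T | sqd theta (v j) = 0].
Proof.
exact: (@measurable_sqd0 (fun _ => theta) (fun v => v j) (measurable_cst _) (@measurable_coord R j)).
Qed.

Lemma measurable_sqd0_pair i j : measurable [set v : T | sqd (v i) (v j) = 0].
Proof.
exact: (@measurable_sqd0 (fun v => v i) (fun v => v j) (@measurable_coord R i) (@measurable_coord R j)).
Qed.

Lemma mu_sqd_cst_null n theta j : (j < n)%N ->
  mu R n [set v : T | sqd theta (v j) = 0] = 0%E.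
Proof.
case: n => // n jn.
have A0 : mu R n.+1 [set v : T | sqd theta (v 0%N) = 0] = 0%E.
  apply: mu_null_slice; last by move=> w; exact: unif_sqd_null.
  exact: measurable_sqd0_cst.
case: j jn => // j jn; rewrite -[RHS]A0.
by rewrite -(@mu_preimage_swap R n.+1 0 j.+1 _ _ jn (measurable_sqd0_cst theta 0)).
Qed.

Lemma mu_sqd_pair_null n i j : (i < j)%N -> (j < n)%N ->
  mu R n [set v : T | sqd (v i) (v j) = 0] = 0%E.
Proof.
case: n => // n ij jn.
have mA k : measurable [set v : T | sqd (v 0%N) (v k) = 0].
  exact: measurable_sqd0_pair.
have A0 k : (0 < k)%N -> mu R n.+1 [set v : T | sqd (v 0%N) (v k) = 0] = 0%E.
  move=> k0; apply: mu_null_slice => // w.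
  rewrite (_ : [set x | _] = [set x | sqd (w k.-1) x = 0]); first exact: unif_sqd_null.
  by apply/seteqP; split => x /=; rewrite /rcons0/= gtn_eqF//= sqdC.
case: i ij => [|i] ij; first exact: A0.
rewrite -(A0 j (leq_trans _ ij))// -(@mu_preimage_swap R n.+1 0 i.+1 _ _ (ltn_trans ij jn) (mA j))//.
rewrite /pushforward/= /reindex_coord/=; congr (mu R n.+1 _).
apply/seteqP; split => v /=; rewrite /swapn/= (gtn_eqF ij) ifF//;
  by apply/negbTE; rewrite -lt0n (leq_trans _ ij).
Qed.

(** On this almost sure event no factor of the density or of [D] vanishes, so [expR] inverts [ln] on
    all of them. *)
Definition generic (N : nat) (theta : R) (v : T) :=
  (forall j : 'I_N, 0 < sqd theta (v j)) /\
  (forall i j : 'I_N, i != j -> 0 < sqd (v i) (v j)).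

Lemma generic_ae N theta : {ae mu R N, forall v, generic N theta v}.
Proof.
have h1 (j : 'I_N) : {ae mu R N, forall v : T, 0 < sqd theta (v j)}.
  exists [set v : T | sqd theta (v j) = 0]; split.
  - exact: measurable_sqd0_cst.
  - exact: mu_sqd_cst_null.
  - move=> v /= /negP; rewrite -leNgt => h; apply/eqP.
    by rewrite eq_le h sqd_ge0.
have h2 (p : 'I_N * 'I_N) : {ae mu R N, forall v : T, p.1 != p.2 -> 0 < sqd (v p.1) (v p.2)}.
  case: p => i j /=; wlog : i j / (i <= j)%N.
    move=> h; have [|/ltnW] := leqP i j; first exact: h.
    move=> /h; apply: filterS => v hv ij; rewrite sqdC; apply: hv.
    by rewrite eq_sym.
  rewrite leq_eqVlt => /orP[/eqP e|ij].
    by apply: aeW => v /negP; rewrite (val_inj e) eqxx.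
  exists [set v : T | sqd (v i) (v j) = 0]; split.
  - exact: measurable_sqd0_pair.
  - exact: mu_sqd_pair_null.
  - move=> v /= /not_implyP[_ /negP]; rewrite -leNgt => h; apply/eqP.
    by rewrite eq_le h sqd_ge0.
have H1 := filter_forall _ h1; have H2 := filter_forall _ h2.
apply: (filterS2 _ _ (H1 _) (H2 _)) => v a b; split => // i j ij; exact: (b (i, j)).
Qed.

End null_sets.

(** * Complex-valued functions of a real variable *)

Section complex_analysis.
Variable R : realType.
Implicit Types z w : R[i].
Local Notation Re := complex.Re.
Local Notation Im := complex.Im.

Lemma complex_ext z w : Re z = Re w -> Im z = Im w -> z = w.
Proof. by case: z => a b; case: w => c d /= -> ->. Qed.

Lemma cReM z w : Re (z * w) = Re z * Re w - Im z * Im w.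
Proof. by case: z => a b; case: w. Qed.

Lemma cImM z w : Im (z * w) = Re z * Im w + Im z * Re w.
Proof. by case: z => a b; case: w => c d; rewrite /= addrC [b * c]mulrC addrC. Qed.

Lemma cReD z w : Re (z + w) = Re z + Re w.
Proof. by case: z => a b; case: w. Qed.

Lemma cImD z w : Im (z + w) = Im z + Im w.
Proof. by case: z => a b; case: w. Qed.

Lemma cReN z : Re (- z) = - Re z.
Proof. by case: z. Qed.

Lemma cImN z : Im (- z) = - Im z.
Proof. by case: z. Qed.

Definition cexp z : R[i] := ((expR (Re z) * cos (Im z))%R +i* (expR (Re z) * sin (Im z))%R)%C.

Lemma cexpD z w : cexp (z + w) = cexp z * cexp w.
Proof.
apply: complex_ext; rewrite ?cReM ?cImM /cexp/= cReD cImD expRD ?cosD ?sinD; ring.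
Qed.

Lemma cexp0 : cexp 0 = 1.
Proof. by apply: complex_ext; rewrite /cexp/= expR0 ?cos0 ?sin0 ?mulr0 ?mul1r. Qed.

Lemma cexp_real (x : R) : cexp x%:C%C = (expR x)%:C%C.
Proof. by apply: complex_ext; rewrite /cexp/= ?cos0 ?sin0 ?mulr0 ?mulr1. Qed.

Lemma cexp_conj z : cexp (z^*)%C = ((cexp z)^*)%C.
Proof.
by case: z => a b; apply: complex_ext; rewrite /cexp/= ?cosN ?sinN ?mulrN.
Qed.

Definition cabs z : R := Num.sqrt (Re z ^+ 2 + Im z ^+ 2).

Lemma cabs_ge0 z : 0 <= cabs z. Proof. exact: sqrtr_ge0. Qed.

Lemma cabs_sqr z : cabs z ^+ 2 = Re z ^+ 2 + Im z ^+ 2.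
Proof. by rewrite sqr_sqrtr// addr_ge0// sqr_ge0. Qed.

Lemma cabsM z w : cabs (z * w) = cabs z * cabs w.
Proof.
apply/eqP; rewrite -(@eqrXn2 _ 2) ?mulr_ge0 ?cabs_ge0//.
by rewrite exprMn !cabs_sqr cReM cImM; apply/eqP; ring.
Qed.

Lemma cabs_real (x : R) : 0 <= x -> cabs x%:C%C = x.
Proof. by move=> x0; rewrite /cabs/= expr0n/= addr0 sqrtr_sqr ger0_norm. Qed.

Lemma cabs_cexp z : cabs (cexp z) = expR (Re z).
Proof.
apply/eqP; rewrite -(@eqrXn2 _ 2) ?cabs_ge0 ?expR_ge0//.
rewrite cabs_sqr /= !exprMn -mulrDr cos2Dsin2 mulr1; exact: eqxx.
Qed.

Lemma Re_le_cabs z : `|Re z| <= cabs z.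
Proof.
rewrite -(@ler_pXn2r _ 2) ?nnegrE ?cabs_ge0 ?normr_ge0//.
by rewrite cabs_sqr real_normK ?num_real// lerDl sqr_ge0.
Qed.

Lemma Im_le_cabs z : `|Im z| <= cabs z.
Proof.
rewrite -(@ler_pXn2r _ 2) ?nnegrE ?cabs_ge0 ?normr_ge0//.
by rewrite cabs_sqr real_normK ?num_real// lerDr sqr_ge0.
Qed.

(** Limits, and derivatives in [cder], are taken componentwise, so that every fact about them
    reduces to the real case. *)
Definition ccvg {I} (F : set_system I) (f : I -> R[i]) (l : R[i]) :=
  (Re (f x) @[x --> F] --> Re l) /\ (Im (f x) @[x --> F] --> Im l).

Section ccvg.
Context {I : Type} {F : set_system I} {FF : Filter F}.
Implicit Types f g : I -> R[i].

Lemma ccvg_cst z : ccvg F (fun _ => z) z.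
Proof. by split; exact: cvg_cst. Qed.

Lemma ccvgD f g a b : ccvg F f a -> ccvg F g b -> ccvg F (fun x => f x + g x) (a + b).
Proof.
move=> [f1 f2] [g1 g2]; split; rewrite ?cReD ?cImD.
  by under eq_fun do rewrite cReD; exact: cvgD.
by under eq_fun do rewrite cImD; exact: cvgD.
Qed.

Lemma ccvgM f g a b : ccvg F f a -> ccvg F g b -> ccvg F (fun x => f x * g x) (a * b).
Proof.
move=> [f1 f2] [g1 g2]; split; rewrite ?cReM ?cImM.
  under eq_fun do rewrite cReM; apply: cvgB; exact: cvgM.
under eq_fun do rewrite cImM; apply: cvgD; exact: cvgM.
Qed.

Lemma ccvgN f a : ccvg F f a -> ccvg F (fun x => - f x) (- a).
Proof.
move=> [f1 f2]; split; rewrite ?cReN ?cImN.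
  by under eq_fun do rewrite cReN; exact: cvgN.
by under eq_fun do rewrite cImN; exact: cvgN.
Qed.

Lemma ccvg_real (h : I -> R) (a : R) : h x @[x --> F] --> a ->
  ccvg F (fun x => (h x)%:C%C) a%:C%C.
Proof. by move=> ha; split => //=; exact: cvg_cst. Qed.

Lemma ccvg_sum J (r : seq J) (Q : pred J) (f : J -> I -> R[i]) a :
  (forall j, Q j -> ccvg F (f j) (a j)) ->
  ccvg F (fun x => \sum_(j <- r | Q j) f j x) (\sum_(j <- r | Q j) a j).
Proof.
move=> h; elim: r => [|j r IH].
  by rewrite big_nil; under eq_fun do rewrite big_nil; exact: ccvg_cst.
rewrite big_cons; under eq_fun do rewrite big_cons.
by case: (boolP (Q j)) => // Qj; apply: ccvgD => //; exact: h.
Qed.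

Lemma ccvg_prod J (r : seq J) (Q : pred J) (f : J -> I -> R[i]) a :
  (forall j, Q j -> ccvg F (f j) (a j)) ->
  ccvg F (fun x => \prod_(j <- r | Q j) f j x) (\prod_(j <- r | Q j) a j).
Proof.
move=> h; elim: r => [|j r IH].
  by rewrite big_nil; under eq_fun do rewrite big_nil; exact: ccvg_cst.
rewrite big_cons; under eq_fun do rewrite big_cons.
by case: (boolP (Q j)) => // Qj; apply: ccvgM => //; exact: h.
Qed.

Lemma ccvgX f a n : ccvg F f a -> ccvg F (fun x => f x ^+ n) (a ^+ n).
Proof.
move=> fa; elim: n => [|n IH].
  by under eq_fun do rewrite expr0; rewrite expr0; exact: ccvg_cst.
by under eq_fun do rewrite exprS; rewrite exprS; exact: ccvgM.
Qed.

Lemma ccvg_cexp f a : ccvg F f a -> ccvg F (fun x => cexp (f x)) (cexp a).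
Proof.
move=> [f1 f2].
have e1 : expR (Re (f x)) @[x --> F] --> expR (Re a).
  by apply: (cvg_comp _ _ f1); exact: continuous_expR.
split => /=.
  by apply: cvgM => //; apply: (cvg_comp _ _ f2); exact: continuous_cos.
by apply: cvgM => //; apply: (cvg_comp _ _ f2); exact: continuous_sin.
Qed.
End ccvg.

Definition cder (f : R -> R[i]) (x : R) (df : R[i]) :=
  is_derive x (1 : R) (fun y => Re (f y)) (Re df) /\
  is_derive x (1 : R) (fun y => Im (f y)) (Im df).

Lemma cder_cst z x : cder (fun _ => z) x 0.
Proof. by split => /=; exact: is_derive_cst. Qed.

Lemma cderD f g x a b : cder f x a -> cder g x b -> cder (fun y => f y + g y) x (a + b).
Proof.
move=> [f1 f2] [g1 g2]; split; rewrite ?cReD ?cImD.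
  by under eq_fun do rewrite cReD; exact: is_deriveD.
by under eq_fun do rewrite cImD; exact: is_deriveD.
Qed.

Lemma cderM f g x a b : cder f x a -> cder g x b ->
  cder (fun y => f y * g y) x (a * g x + f x * b).
Proof.
move=> [f1 f2] [g1 g2]; split.
  under eq_fun do rewrite cReM.
  by apply: is_derive_eq; rewrite /GRing.scale/= cReD !cReM; ring.
under eq_fun do rewrite cImM.
by apply: is_derive_eq; rewrite /GRing.scale/= cImD !cImM; ring.
Qed.

Lemma cderN f x a : cder f x a -> cder (fun y => - f y) x (- a).
Proof.
move=> [f1 f2]; split; rewrite ?cReN ?cImN.
  by under eq_fun do rewrite cReN; exact: is_deriveN.
by under eq_fun do rewrite cImN; exact: is_deriveN.
Qed.

Lemma cderX f x a n : cder f x a ->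
  cder (fun y => f y ^+ n) x (n%:R * f x ^+ n.-1 * a).
Proof.
move=> fa; elim: n => [|n IH].
  by under eq_fun do rewrite expr0; rewrite !mul0r; exact: cder_cst.
under eq_fun do rewrite exprS.
have := cderM fa IH; congr cder => /=.
case: n {IH} => [|n]; first by rewrite expr0 mulr0n; ring.
by rewrite [n.+1.-1]/= exprS -[n.+2%:R]natr1; ring.
Qed.

Lemma cder_real (h : R -> R) (x dh : R) : is_derive x (1 : R) h dh ->
  cder (fun y => (h y)%:C%C) x dh%:C%C.
Proof. by move=> hd; split => //=; exact: is_derive_cst. Qed.

Lemma cder_cexp f x a : cder f x a -> cder (fun y => cexp (f y)) x (a * cexp (f x)).
Proof.
move=> [f1 f2].
have e1 : is_derive x (1 : R) (fun y => expR (Re (f y))) (Re a * expR (Re (f x))).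
  by have := is_derive1_comp (is_derive_expR (Re (f x))) f1; rewrite mulrC.
have c1 : is_derive x (1 : R) (fun y => cos (Im (f y))) (- sin (Im (f x)) * Im a).
  exact: is_derive1_comp.
have s1 : is_derive x (1 : R) (fun y => sin (Im (f y))) (cos (Im (f x)) * Im a).
  exact: is_derive1_comp.
split; rewrite ?cReM ?cImM /cexp/=.
  by apply: is_derive_eq; rewrite /GRing.scale/=; ring.
by apply: is_derive_eq; rewrite /GRing.scale/=; ring.
Qed.

End complex_analysis.

(** * Complex expectations *)

Section complex_expectation.
Context {d : measure_display} {T : measurableType d} {R : realType}.
Implicit Types f g : T -> R[i].
Local Notation Re := complex.Re.
Local Notation Im := complex.Im.

Definition cbm f := bm (fun v => Re (f v)) /\ bm (fun v => Im (f v)).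

Lemma cbm_cst z : cbm (fun _ => z).
Proof. by split; exact: bm_cst. Qed.

Lemma cbmD f g : cbm f -> cbm g -> cbm (fun v => f v + g v).
Proof.
move=> [f1 f2] [g1 g2]; split.
  by under eq_fun do rewrite cReD; exact: bmD.
by under eq_fun do rewrite cImD; exact: bmD.
Qed.

Lemma cbmN f : cbm f -> cbm (fun v => - f v).
Proof.
move=> [f1 f2]; split.
  by under eq_fun do rewrite cReN; exact: bmN.
by under eq_fun do rewrite cImN; exact: bmN.
Qed.

Lemma cbmB f g : cbm f -> cbm g -> cbm (fun v => f v - g v).
Proof. by move=> cf cg; apply: cbmD => //; exact: cbmN. Qed.

Lemma cbmM f g : cbm f -> cbm g -> cbm (fun v => f v * g v).
Proof.
move=> [f1 f2] [g1 g2]; split.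
  by under eq_fun do rewrite cReM; apply: bmB; exact: bmM.
by under eq_fun do rewrite cImM; apply: bmD; exact: bmM.
Qed.

Lemma cbmZ z f : cbm f -> cbm (fun v => z * f v).
Proof. by apply: cbmM; exact: cbm_cst. Qed.

Lemma cbmX f n : cbm f -> cbm (fun v => f v ^+ n).
Proof.
move=> cf; elim: n => [|n IH]; first by under eq_fun do rewrite expr0; exact: cbm_cst.
by under eq_fun do rewrite exprS; exact: cbmM.
Qed.

Lemma cbm_conj f : cbm f -> cbm (fun v => (f v)^*%C).
Proof.
move=> [f1 f2]; split.
  by rewrite (_ : (fun v => _) = (fun v => Re (f v)))//; apply/funext => v; case: (f v).
rewrite (_ : (fun v => _) = (fun v => - Im (f v))); first exact: bmN.
by apply/funext => v; case: (f v).
Qed.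

Lemma cbm_real (h : T -> R) : bm h -> cbm (fun v => (h v)%:C%C).
Proof. by move=> bh; split => //=; exact: bm_cst. Qed.

Lemma cbm_sum J (r : seq J) (Q : pred J) (f : J -> T -> R[i]) :
  (forall j, Q j -> cbm (f j)) -> cbm (fun v => \sum_(j <- r | Q j) f j v).
Proof.
move=> h; elim: r => [|j r IH].
  by under eq_fun do rewrite big_nil; exact: cbm_cst.
under eq_fun do rewrite big_cons.
by case: (boolP (Q j)) => // Qj; apply: cbmD => //; exact: h.
Qed.

Lemma cbm_prod J (r : seq J) (Q : pred J) (f : J -> T -> R[i]) :
  (forall j, Q j -> cbm (f j)) -> cbm (fun v => \prod_(j <- r | Q j) f j v).
Proof.
move=> h; elim: r => [|j r IH].
  by under eq_fun do rewrite big_nil; exact: cbm_cst.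
under eq_fun do rewrite big_cons.
by case: (boolP (Q j)) => // Qj; apply: cbmM => //; exact: h.
Qed.

Lemma cbm_cexp (a b : T -> R) (M : R) : measurable_fun [set: T] a ->
  measurable_fun [set: T] b -> (forall v, a v <= M) ->
  cbm (fun v => cexp (a v +i* b v)%C).
Proof.
move=> ma mb hM.
have be : bm (fun v => expR (a v)).
  split; first exact: measurableT_comp.
  by exists (expR M) => v; rewrite ger0_norm ?expR_ge0// ler_expR.
split => /=; apply: bmM => //.
- apply: (@bm_comp _ _ _ (@cos R)) => //.
    exact: (continuous_measurable_fun (@continuous_cos R)).
  by exists 1 => x; rewrite ler_norml cos_geN1 cos_le1.
- apply: (@bm_comp _ _ _ (@sin R)) => //.
    exact: (continuous_measurable_fun (@continuous_sin R)).
  by exists 1 => x; rewrite ler_norml sin_geN1 sin_le1.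
Qed.

Variable P : probability T R.

Definition CE f : R[i] := (Ex P (fun v => Re (f v)) +i* Ex P (fun v => Im (f v)))%C.

Lemma CED f g : cbm f -> cbm g -> CE (fun v => f v + g v) = CE f + CE g.
Proof.
move=> [f1 f2] [g1 g2]; apply: complex_ext; rewrite ?cReD ?cImD /=.
  by rewrite -ExD//; congr Ex; apply/funext => v; rewrite cReD.
by rewrite -ExD//; congr Ex; apply/funext => v; rewrite cImD.
Qed.

Lemma CEZ z f : cbm f -> CE (fun v => z * f v) = z * CE f.
Proof.
move=> [f1 f2]; apply: complex_ext; rewrite ?cReM ?cImM /=.
  rewrite -!ExZ// -ExB//; try exact: bmZ.
  by congr Ex; apply/funext => v; rewrite cReM.
rewrite -!ExZ// -ExD//; try exact: bmZ.
by congr Ex; apply/funext => v; rewrite cImM.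
Qed.

Lemma CEN f : cbm f -> CE (fun v => - f v) = - CE f.
Proof.
move=> cf; rewrite -mulN1r -CEZ//.
by congr CE; apply/funext => v; rewrite mulN1r.
Qed.

Lemma CEB f g : cbm f -> cbm g -> CE (fun v => f v - g v) = CE f - CE g.
Proof. by move=> cf cg; rewrite CED ?CEN//; exact: cbmN. Qed.

Lemma CE0 : CE (fun _ => 0) = 0.
Proof. by apply: complex_ext; rewrite /= Ex_cst. Qed.

Lemma CE_sum J (r : seq J) (Q : pred J) (f : J -> T -> R[i]) :
  (forall j, Q j -> cbm (f j)) ->
  CE (fun v => \sum_(j <- r | Q j) f j v) = \sum_(j <- r | Q j) CE (f j).
Proof.
move=> h; elim: r => [|j r IH].
  by rewrite big_nil; under eq_fun do rewrite big_nil; exact: CE0.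
rewrite big_cons; under eq_fun do rewrite big_cons.
by case: (boolP (Q j)) => // Qj; rewrite CED ?IH//; [exact: h|exact: cbm_sum].
Qed.

Lemma CE_ae f g : cbm f -> cbm g -> {ae P, forall v, f v = g v} -> CE f = CE g.
Proof.
move=> [f1 f2] [g1 g2] h; apply: complex_ext => /=.
  by apply: Ex_ae => //; apply: filterS h => v ->.
by apply: Ex_ae => //; apply: filterS h => v ->.
Qed.

Lemma CE_conj f : cbm f -> CE (fun v => (f v)^*%C) = ((CE f)^*)%C.
Proof.
move=> [f1 f2]; apply: complex_ext => /=.
  by congr Ex; apply/funext => v; case: (f v).
by rewrite -ExN//; congr Ex; apply/funext => v; case: (f v).
Qed.

Lemma CE_real (h : T -> R) : CE (fun v => (h v)%:C%C) = (Ex P h)%:C%C.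
Proof. by apply: complex_ext => //=; rewrite Ex_cst. Qed.

(* Rotate the expectation to the positive real axis. *)
Lemma cabs_CE f (g : T -> R) : cbm f -> bm g -> (forall v, cabs (f v) <= g v) ->
  cabs (CE f) <= Ex P g.
Proof.
move=> cf bg h; have [e0|z0] := eqVneq (cabs (CE f)) 0.
  rewrite e0; apply: (@le_trans _ _ (Ex P (fun _ => 0))); first by rewrite Ex_cst.
  by apply: Ex_le => //; [exact: bm_cst|move=> v; exact: le_trans (cabs_ge0 _) (h v)].
have zp : 0 < cabs (CE f) by rewrite lt_def z0 cabs_ge0.
rewrite -(ler_pM2l zp) -expr2 cabs_sqr -ExZ//.
have cz : cbm (fun v => ((CE f)^*)%C * f v) by exact: cbmZ.
rewrite (_ : _ + _ = Re (CE (fun v => ((CE f)^*)%C * f v))); last first.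
  by rewrite CEZ// cReM /=; ring.
apply: Ex_le; [by case: cz|exact: bmZ|move=> v].
apply: (le_trans (ler_norm _)); apply: (le_trans (Re_le_cabs _)).
rewrite cabsM (_ : cabs ((CE f)^*)%C = cabs (CE f)); last first.
  by rewrite /cabs/= sqrrN.
by rewrite ler_wpM2l ?cabs_ge0.
Qed.

Lemma CE_dct0 (f_ : nat -> T -> R[i]) f (M : R) :
  (forall k, cbm (f_ k)) -> cbm f -> (forall k v, cabs (f_ k v) <= M) ->
  {ae P, forall v, ccvg \oo (f_ ^~ v) (f v)} ->
  (forall k, CE (f_ k) = 0) -> CE f = 0.
Proof.
move=> cf_ [[m1 _] [m2 _]] hM hae h0.
have e1 : Ex P (fun v => Re (f_ k v)) @[k --> \oo] --> Ex P (fun v => Re (f v)).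
  apply: (@Ex_dct _ _ _ _ _ _ M) => //.
  - by move=> k; have [[]] := cf_ k.
  - by move=> k v; apply: le_trans (Re_le_cabs _) _.
  - by apply: filterS hae => v [].
have e2 : Ex P (fun v => Im (f_ k v)) @[k --> \oo] --> Ex P (fun v => Im (f v)).
  apply: (@Ex_dct _ _ _ _ _ _ M) => //.
  - by move=> k; have [_ []] := cf_ k.
  - by move=> k v; apply: le_trans (Im_le_cabs _) _.
  - by apply: filterS hae => v [].
have r0 k : Ex P (fun v => Re (f_ k v)) = 0 by have := h0 k; rewrite /CE => -[].
have i0 k : Ex P (fun v => Im (f_ k v)) = 0 by have := h0 k; rewrite /CE => -[].
apply: complex_ext => /=.
  apply: (cvg_unique _ e1) => //.
  by rewrite (_ : (fun k => _) = (fun _ => 0)); [exact: cvg_cst|exact/funext].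
apply: (cvg_unique _ e2) => //.
by rewrite (_ : (fun k => _) = (fun _ => 0)); [exact: cvg_cst|exact/funext].
Qed.

End complex_expectation.

(** * Exchange and integration by parts for complex integrands *)

Section mu_complex.
Variable R : realType.
Notation T := (rseq R).
Implicit Types f g : T -> R[i].
Local Notation Re := complex.Re.
Local Notation Im := complex.Im.

Lemma cbm_reindex sigma f : cbm f -> cbm (fun v => f (reindex_coord sigma v)).
Proof.
by move=> [f1 f2]; split; [exact: (bm_reindex sigma f1)|exact: (bm_reindex sigma f2)].
Qed.

Lemma CE_swap n i j f : cbm f -> (i < j)%N -> (j < n)%N ->
  CE (mu R n) (fun v => f (reindex_coord (swapn i j) v)) = CE (mu R n) f.
Proof.
move=> [f1 f2] ij jn; apply: complex_ext => /=; first exact: (Ex_swap f1 ij jn).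
exact: (Ex_swap f2 ij jn).
Qed.

Lemma CE_ibp n g g' : cbm g' ->
  (forall w (x : R), cder (fun x => g (rcons0 (x, w))) x (g' (rcons0 (x, w)))) ->
  (forall w (x : R), ccvg (nbhs x) (fun x : R => g' (rcons0 (x, w))) (g' (rcons0 (x, w)))) ->
  (forall w, g (rcons0 (0, w)) = g (rcons0 (2 * pi, w))) ->
  CE (mu R n.+1) g' = 0.
Proof.
move=> [b1 b2] dg cg g02; apply: complex_ext => /=.
- apply: (@Ex_ibp R n (fun v => Re (g v))) => //.
  + by move=> w x; have [] := dg w x.
  + by move=> w x; have [] := cg w x.
  + by move=> w; rewrite g02.
- apply: (@Ex_ibp R n (fun v => Im (g v))) => //.
  + by move=> w x; have [] := dg w x.
  + by move=> w x; have [] := cg w x.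
  + by move=> w; rewrite g02.
Qed.
End mu_complex.

(** * The regularized weight *)

Section weights.
Variable R : realType.
Notation T := (rseq R).
Local Notation Re := complex.Re.
Local Notation Im := complex.Im.

Definition cis (x : R) : R[i] := cexp (0 +i* x)%C.

Lemma cisE x : cis x = (cos x +i* sin x)%C.
Proof. by rewrite /cis /cexp/= expR0 !mul1r. Qed.

Lemma cis_conjE x : ((cis x)^*)%C = cis (- x).
Proof. by rewrite !cisE cosN sinN. Qed.

Lemma cisD x y : cis (x + y) = cis x * cis y.
Proof. by rewrite /cis -cexpD; congr cexp; apply: complex_ext; rewrite /= ?addr0. Qed.

Lemma cisJ x : cis x * ((cis x)^*)%C = 1.
Proof. by rewrite cis_conjE -cisD subrr /cis cexp0. Qed.

Lemma cis_periodic x : cis (2 * pi + x) = cis x.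
Proof.
rewrite cisD (_ : cis (2 * pi) = 1) ?mul1r// cisE.
by rewrite mulr_natl cos2pi sin2pi.
Qed.

Lemma cder_cis a (x : R) : cder (fun y => cis (y - a)) x ('i%C * cis (x - a)).
Proof.
apply: cder_cexp; split => /=; first exact: is_derive_cst.
by apply: is_derive_eq; rewrite subr0.
Qed.

Lemma sin_cis x : (2 * sin x)%:C%C = - 'i%C * (cis x - ((cis x)^*)%C) :> R[i].
Proof.
by rewrite !cisE; apply: complex_ext; rewrite ?cReM ?cImM /=; ring.
Qed.

Lemma sqd_cis a c : (sqd a c)%:C%C = 2 - cis a * ((cis c)^*)%C - ((cis a)^*)%C * cis c.
Proof.
by rewrite /sqd cosB !cisE; apply: complex_ext; rewrite /=; ring.
Qed.

Lemma is_derive_sqd c (x : R) : is_derive x (1 : R) (sqd c) (2 * sin (x - c)).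
Proof.
rewrite /sqd.
have h : is_derive x (1 : R) (fun y => cos (c - y)) (sin (c - x)).
  have h1 : is_derive x (1 : R) (fun y => c - y) (-1).
    by apply: is_derive_eq; rewrite add0r mul1r.
  have := @is_derive1_comp _ (@cos R) (fun y => c - y) x _ _ (is_derive_cos (c - x)) h1.
  by rewrite mulrN1 opprK.
apply: is_derive_eq; rewrite /GRing.scale/= add0r mul1r -(opprB x c) sinN.
by ring.
Qed.

Lemma is_derive_ln_sqd c delta (x : R) : 0 < delta ->
  is_derive x (1 : R) (fun y => ln (sqd c y + delta)) (2 * sin (x - c) / (sqd c x + delta)).
Proof.
move=> d0.
have p : 0 < sqd c x + delta by rewrite ltr_wpDl// sqd_ge0.
have h1 : is_derive x (1 : R) (fun y => sqd c y + delta) (2 * sin (x - c)).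
  by have := is_derive_sqd c x => ?; apply: is_derive_eq; rewrite addr0.
by have := @is_derive1_comp _ (@ln R) (fun y => sqd c y + delta) x _ _ (is_derive1_ln p) h1; rewrite mulrC.
Qed.

Lemma ln_le_id (x : R) : 0 < x -> ln x <= x.
Proof. by move=> x0; have := expR_ge1Dx (ln x); rewrite lnK ?posrE//; lra. Qed.

Lemma ln_sqd_le a c (delta : R) : 0 <= delta <= 1 -> ln (sqd a c + delta) <= 5.
Proof.
move=> /andP[d0 d1]; have [p|n] := ltP 0 (sqd a c + delta).
  by apply: (le_trans (ln_le_id p)); have := sqd_le4 a c; lra.
by rewrite ln0.
Qed.

Lemma bm_inv d (T' : measurableType d) (f : T' -> R) (delta : R) : 0 < delta ->
  measurable_fun [set: T'] f -> (forall v, 0 <= f v) -> bm (fun v => (f v + delta)^-1).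
Proof.
move=> d0 mf f0; have p v : 0 < f v + delta by rewrite ltr_wpDl.
split.
  rewrite (_ : (fun v => _) = (fun v => expR (- ln (f v + delta)))).
    apply: measurableT_comp => //; apply: measurableT_comp => //.
    apply: measurableT_comp => //; apply: measurable_funD => //; exact: measurable_cst.
  by apply/funext => v; rewrite expRN lnK// posrE.
exists delta^-1 => v; rewrite gtr0_norm ?invr_gt0//.
by rewrite lef_pV2 ?posrE// lerDr.
Qed.

Lemma bm_sin d (T' : measurableType d) (f : T' -> R) :
  measurable_fun [set: T'] f -> bm (fun v => sin (f v)).
Proof.
move=> mf; apply: (@bm_comp _ _ _ (@sin R)) => //.
  exact: (continuous_measurable_fun (@continuous_sin R)).
by exists 1 => x; rewrite ler_norml sin_geN1 sin_le1.
Qed.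

Lemma bm_sqd d (T' : measurableType d) (f g : T' -> R) :
  measurable_fun [set: T'] f -> measurable_fun [set: T'] g ->
  bm (fun v => sqd (f v) (g v)).
Proof.
move=> mf mg; split; first exact: measurable_sqd.
by exists 4 => v; rewrite ger0_norm ?sqd_ge0// sqd_le4.
Qed.

Lemma cbm_cis d (T' : measurableType d) (f : T' -> R) :
  measurable_fun [set: T'] f -> cbm (fun v => cis (f v)).
Proof.
move=> mf; apply: (@cbm_cexp _ _ _ (fun _ => 0) f 0) => //.
Qed.

Variables (n : nat) (theta lam : R).
Local Notation N := n.+1.

Lemma swapn_tperm (i j k : 'I_N) : swapn i j k = tperm i j k.
Proof.
rewrite /swapn; case: tpermP => [->|->|/eqP ki /eqP kj]; rewrite ?eqxx//.
  by case: eqP.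
by rewrite !val_eqE (negbTE ki) (negbTE kj).
Qed.

Lemma big_swap (V : Type) (idx : V) (op : Monoid.com_law idx) (i j : 'I_N)
    (Q : pred 'I_N) (F : R -> V) (v : T) :
  \big[op/idx]_(k < N | Q k) F (reindex_coord (swapn i j) v k) =
  \big[op/idx]_(k < N | Q (tperm i j k)) F (v k).
Proof.
rewrite (reindex_inj (perm_inj (s := tperm i j)))/=.
by apply: eq_bigr => k _; rewrite /reindex_coord swapn_tperm tpermK.
Qed.

(* [uu v j * ub v j] is the squared distance between [v j] and [theta] on the circle. *)
Definition zz (v : T) (j : nat) : R[i] := cis (v j - theta).
Definition uu v j := 1 - zz v j.
Definition ub v j := 1 - ((zz v j)^*)%C.

(* [delta > 0] makes the weight smooth even where [beta < 1]; at [delta = 0] the junk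
   value [ln 0 = 0] only occurs on a null set. *)
Definition logsum delta (v : T) := \sum_(j < N) ln (sqd theta (v j) + delta).
Definition pairsum delta (v : T) :=
  \sum_(i < N) \sum_(j < N | j != i) ln (sqd (v i) (v j) + delta).

(** At [delta = 0], off a null set, this is [|D|^s] times the density: [logsum / 2] is [ln |D|], and
    since [pairsum] counts each pair twice and uses squared distances, the exponent [beta = 2 lam]
    becomes the factor [lam / 2]. *)
Definition cbe_weight (s : R[i]) delta (v : T) : R[i] :=
  cexp ((Re s * (logsum delta v / 2) + lam / 2 * pairsum delta v)%R +i*
        (Im s * (logsum delta v / 2))%R)%C.

Lemma WE s delta v : cbe_weight s delta v =
  cexp (s * (logsum delta v / 2)%:C%C + (lam / 2 * pairsum delta v)%:C%C).
Proof.
by congr cexp; apply: complex_ext; rewrite ?cReD ?cImD ?cReM ?cImM /=; ring.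
Qed.

Definition umprod (Q : pred 'I_N) v := \prod_(j < N | Q j) uu v j.
Definition ubprod (m : nat) v := \prod_(j < N) ub v j ^+ m.

Lemma logsum_swap delta (i j : 'I_N) v :
  logsum delta (reindex_coord (swapn i j) v) = logsum delta v.
Proof.
exact: (big_swap _ i j predT (fun x => ln (sqd theta x + delta))).
Qed.

Lemma pairsum_swap delta (i j : 'I_N) v :
  pairsum delta (reindex_coord (swapn i j) v) = pairsum delta v.
Proof.
rewrite /pairsum (reindex_inj (perm_inj (s := tperm i j)))/=.
apply: eq_bigr => k _.
rewrite (big_swap _ i j (fun l => l != tperm i j k)
  (fun x => ln (sqd (reindex_coord (swapn i j) v (tperm i j k)) x + delta))).
apply: eq_big => l; first by rewrite (inj_eq perm_inj).
by rewrite /reindex_coord swapn_tperm tpermK.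
Qed.

Lemma W_swap s delta (i j : 'I_N) v :
  cbe_weight s delta (reindex_coord (swapn i j) v) = cbe_weight s delta v.
Proof. by rewrite /cbe_weight logsum_swap pairsum_swap. Qed.

Lemma ubprod_swap m (i j : 'I_N) v :
  ubprod m (reindex_coord (swapn i j) v) = ubprod m v.
Proof. exact: (big_swap _ i j predT (fun x => (1 - ((cis (x - theta))^*)%C) ^+ m)). Qed.

Lemma umprod_swap (Q : pred 'I_N) (i j : 'I_N) v : Q i = Q j ->
  umprod Q (reindex_coord (swapn i j) v) = umprod Q v.
Proof.
move=> Qij; rewrite [LHS](big_swap _ i j Q (fun x => 1 - cis (x - theta))).
by apply: eq_bigl => k; case: tpermP => [->|->|].
Qed.

Lemma cbm_zz j : cbm (fun v => zz v j).
Proof.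
by apply: cbm_cis; apply: measurable_funB; [exact: measurable_coord|exact: measurable_cst].
Qed.

Lemma cbm_uu j : cbm (fun v => uu v j).
Proof. by apply: cbmB; [exact: cbm_cst|exact: cbm_zz]. Qed.

Lemma cbm_ub j : cbm (fun v => ub v j).
Proof. by apply: cbmB; [exact: cbm_cst|exact/cbm_conj/cbm_zz]. Qed.

Lemma cbm_umprod Q : cbm (umprod Q).
Proof. by apply: cbm_prod => j _; exact: cbm_uu. Qed.

Lemma cbm_ubprod m : cbm (ubprod m).
Proof. by apply: cbm_prod => j _; apply: cbmX; exact: cbm_ub. Qed.

Hypothesis lam_ge0 : 0 <= lam.

Lemma logsum_le delta v : 0 <= delta <= 1 -> logsum delta v <= 5 * N%:R.
Proof.
move=> d01; apply: (@le_trans _ _ (\sum_(j < N) 5)).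
  by apply: ler_sum => j _; exact: ln_sqd_le.
by rewrite sumr_const card_ord mulr_natr.
Qed.

Lemma pairsum_le delta v : 0 <= delta <= 1 -> pairsum delta v <= 5 * N%:R * N%:R.
Proof.
move=> d01; apply: (@le_trans _ _ (\sum_(i < N) (5 * N%:R))); last first.
  by rewrite sumr_const card_ord -[leLHS]mulr_natr.
apply: ler_sum => i _; apply: (@le_trans _ _ (\sum_(j < N | j != i) 5)).
  by apply: ler_sum => j _; exact: ln_sqd_le.
rewrite big_mkcond/= (le_trans (y := \sum_(j < N) 5))//.
  by apply: ler_sum => j _; case: ifP.
by rewrite sumr_const card_ord mulr_natr.
Qed.

Definition Wbound (s : R[i]) : R := Re s * (5 * N%:R / 2) + lam / 2 * (5 * N%:R * N%:R).

Lemma ReW_le s delta v : 0 <= Re s -> 0 <= delta <= 1 ->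
  Re s * (logsum delta v / 2) + lam / 2 * pairsum delta v <= Wbound s.
Proof.
move=> s0 d01; apply: lerD.
  by rewrite ler_wpM2l// ler_wpM2r// logsum_le.
by rewrite ler_wpM2l ?pairsum_le// divr_ge0.
Qed.

Lemma measurable_ln_sqd (f g : T -> R) delta : measurable_fun [set: T] f ->
  measurable_fun [set: T] g -> measurable_fun [set: T] (fun v => ln (sqd (f v) (g v) + delta)).
Proof.
move=> mf mg; apply: measurableT_comp => //; apply: measurable_funD; last exact: measurable_cst.
exact: measurable_sqd.
Qed.

Lemma measurable_logsum delta : measurable_fun [set: T] (logsum delta).
Proof.
apply: measurable_sum => j; apply: measurable_ln_sqd; first exact: measurable_cst.
exact: measurable_coord.
Qed.

Lemma measurable_pairsum delta : measurable_fun [set: T] (pairsum delta).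
Proof.
have -> : pairsum delta = (fun v : T => \sum_(i < N) \sum_(j < N)
    (if j != i then ln (sqd (v i) (v j) + delta) else 0)).
  by apply/funext => v; apply: eq_bigr => i _; rewrite big_mkcond.
apply: measurable_sum => i; apply: measurable_sum => j.
case: (j != i); last exact: measurable_cst.
by apply: measurable_ln_sqd; exact: measurable_coord.
Qed.

Lemma cbm_W s delta : 0 <= Re s -> 0 <= delta <= 1 -> cbm (cbe_weight s delta).
Proof.
move=> s0 d01; apply: (@cbm_cexp _ _ _ _ _ (Wbound s)).
- apply: measurable_funD; apply: measurable_funM; try exact: measurable_cst.
    by apply: measurable_funM; [exact: measurable_logsum|exact: measurable_cst].
  exact: measurable_pairsum.
- apply: measurable_funM; first exact: measurable_cst.
  by apply: measurable_funM; [exact: measurable_logsum|exact: measurable_cst].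
- by move=> v; exact: ReW_le.
Qed.

Lemma cabs_W s delta v : 0 <= Re s -> 0 <= delta <= 1 -> cabs (cbe_weight s delta v) <= expR (Wbound s).
Proof. by move=> s0 d01; rewrite cabs_cexp ler_expR /=; exact: ReW_le. Qed.

End weights.

(** * Differentiating along the first coordinate *)

Lemma real_complexM (R : realType) (a b : R) : (a * b)%:C%C = a%:C%C * b%:C%C :> R[i].
Proof. exact: rmorphM. Qed.

Lemma conjcMJ (R : realType) (a b : R[i]) : ((a * (b^*)%C)%R^*)%C = (a^*)%C * b.
Proof. by case: a => a1 a2; case: b => b1 b2; apply: complex_ext => /=; ring. Qed.

Section aomoto.
Variable R : realType.
Notation T := (rseq R).
Local Notation Re := complex.Re.
Local Notation Im := complex.Im.
Variables (n : nat) (theta lam : R).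
Local Notation N := n.+1.
Variables (s : R[i]) (m p : nat).

Local Notation zt := (zz theta).
Local Notation ut := (uu theta).
Local Notation bt := (ub theta).
Local Notation umt := (@umprod R n theta).
Local Notation Et := (@ubprod R n theta m).
Local Notation Wt := (@cbe_weight R n theta lam s).






(** [U] collects [u_1 ... u_p] and leaves out [u_0], the factor through which the first angle is
    differentiated; [Uf] has all of [u_0 ... u_p]. *)
Let U := umt (fun k => (0 < k <= p)%N).
Let Uf := umt (fun k => (k <= p)%N).

Lemma umprod_recl v : Uf v = ut v 0 * U v.
Proof.
rewrite /Uf /U /umprod (bigD1 ord0)//=; congr (_ * _).
by apply: eq_bigl => k; rewrite andbC -lt0n.
Qed.

(* [dpt] is the logarithmic derivative of the regularized distance, and [qpt], which
   tends to 1 off the diagonal, is what the regularization leaves of the factor 1. *)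
Definition qpt (delta x y : R) := sqd x y / (sqd x y + delta).
Definition dpt (delta x y : R) := 2 * sin (x - y) / (sqd x y + delta).

Lemma dptC delta x y : dpt delta x y = - dpt delta y x.
Proof. by rewrite /dpt -(opprB y x) sinN sqdC mulrN mulNr. Qed.

(* Both identities use only [z * z^* = 1] for points on the unit circle. *)
Lemma uu_dpt_theta delta v : ut v 0 * (dpt delta (v 0%N) theta)%:C%C =
  - 'i%C * (zt v 0 + 1) * (qpt delta theta (v 0%N))%:C%C.
Proof.
rewrite /dpt /qpt sqdC (real_complexM (2 * _)) (real_complexM (sqd _ _)) !mulrA; congr (_ * _).
have := cisJ (v 0%N - theta).
rewrite sin_cis (_ : sqd theta (v 0%N) = sqd 0 (v 0%N - theta)); last first.
  by rewrite /sqd; congr (2 - 2 * cos _); ring.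
rewrite sqd_cis (_ : cis 0 = 1) ?rmorph1; last exact: cexp0.
rewrite /uu /zz; set a := cis _; set b := (_^*)%C => ab.
apply/eqP; rewrite -subr_eq0; apply/eqP.
transitivity (- 'i%C * (2 * (a * b - 1))); last by rewrite ab; ring.
by ring.
Qed.

Lemma sub_uu_dpt delta v j : (ut v 0 - ut v j) * (dpt delta (v 0%N) (v j))%:C%C =
  - 'i%C * (zt v 0 + zt v j) * (qpt delta (v 0%N) (v j))%:C%C.
Proof.
rewrite /dpt /qpt (real_complexM (2 * _)) (real_complexM (sqd _ _)) !mulrA; congr (_ * _).
have := cisJ (v 0%N - theta); have := cisJ (v j - theta).
rewrite sin_cis (_ : v 0%N - v j = (v 0%N - theta) - (v j - theta)); last by ring.
rewrite (_ : sqd (v 0%N) (v j) = sqd (v 0%N - theta) (v j - theta)); last first.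
  by rewrite /sqd; congr (2 - 2 * cos _); ring.
rewrite sqd_cis (cisD (v 0%N - theta)) -(cis_conjE (v j - theta)) conjcMJ.
rewrite /uu /zz; set a := cis (v 0%N - theta); set a' := (a^*)%C.
set b := cis _; set b' := (b^*)%C => bb aa.
apply/eqP; rewrite -subr_eq0; apply/eqP.
transitivity (- 'i%C * (2 * ((a * a' - 1) * b + (b * b' - 1) * a))); last by rewrite aa bb; ring.
by ring.
Qed.

Lemma umprod_rcons0 (Q : pred 'I_N) x w : ~~ Q ord0 ->
  umt Q (rcons0 (x, w)) = umt Q (rcons0 (0, w)).
Proof.
move=> Q0; apply: eq_bigr => j Qj; rewrite /uu /zz /rcons0/=.
by case: eqP => // j0; move: Q0; rewrite (_ : ord0 = j) ?Qj//; exact: val_inj.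
Qed.

Definition ubrest (v : T) := \prod_(j < n) bt v j.+1 ^+ m.

Lemma ubprod_recl v : Et v = bt v 0 ^+ m * ubrest v.
Proof. by rewrite /ubprod big_ord_recl; congr (_ * _); apply: eq_bigr => j _. Qed.

Lemma is_derive_logsum delta w (x : R) : 0 < delta ->
  is_derive x (1 : R) (fun x => logsum n theta delta (rcons0 (x, w))) (dpt delta x theta).
Proof.
move=> d0.
rewrite (_ : (fun x => _) = (fun x => ln (sqd theta x + delta) +
    \sum_(j < n) ln (sqd theta (w j) + delta))).
  have := is_derive_ln_sqd theta x d0 => h.
  by apply: is_derive_eq; rewrite addr0 /dpt (sqdC x).
by apply/funext => y; rewrite /logsum big_ord_recl; congr (_ + _); apply: eq_bigr => j _.
Qed.

Lemma pairsum_recl delta (v : T) : pairsum n delta v =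
  2 * \sum_(j < n) ln (sqd (v j.+1) (v 0%N) + delta) +
  \sum_(i < n) \sum_(j < n | j != i) ln (sqd (v i.+1) (v j.+1) + delta).
Proof.
rewrite /pairsum big_ord_recl big_mkcond big_ord_recl /= add0r.
rewrite mulr_natl mulr2n -addrA; congr (_ + _).
  by apply: eq_bigr => j _; rewrite sqdC.
rewrite -big_split; apply: eq_bigr => i _ /=.
rewrite big_mkcond big_ord_recl /=; congr (_ + _).
rewrite [RHS]big_mkcond; apply: eq_bigr => j _.
by rewrite (inj_eq lift_inj).
Qed.

Lemma is_derive_pairsum delta w (x : R) : 0 < delta ->
  is_derive x (1 : R) (fun x => pairsum n delta (rcons0 (x, w)))
    (2 * \sum_(j < n) dpt delta x (w j)).
Proof.
move=> d0.
rewrite (_ : (fun x => _) = (fun x => 2 * (\sum_(j < n) (fun j x => ln (sqd (w j) x + delta)) j) x +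
  \sum_(i < n) \sum_(j < n | j != i) ln (sqd (w i) (w j) + delta))); last first.
  apply/funext => y; rewrite pairsum_recl; congr (2 * _ + _).
  by rewrite fct_sumE.
have h : is_derive x (1 : R) (\sum_(j < n) (fun j x => ln (sqd (w j) x + delta)) j)
    (\sum_(j < n) (fun j => dpt delta x (w j)) j).
  apply: is_derive_sum => j.
  by have := is_derive_ln_sqd (w j) x d0; rewrite /dpt (sqdC x).
by apply: is_derive_eq; rewrite addr0.
Qed.

(** The integrand [u_0 ... u_p prod_j (1 - z_j^-1)^m] against the regularized weight. Apart from the
    weight, the first angle enters only the two leading factors. The extra factor [u_0] cancels the
    singularity at [theta]. *)
Definition ibp_fun delta v := ut v 0 * bt v 0 ^+ m * (U v * ubrest v) * Wt delta v.

Definition ibp_deriv delta v := U v * Et v * Wt delta v *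
  (- 'i%C * (zt v 0 + m%:R) + ut v 0 *
    (s / 2 * (dpt delta (v 0%N) theta)%:C%C +
     lam%:C%C * \sum_(j < n) (dpt delta (v 0%N) (v j.+1))%:C%C)).

(** Since [(1 - z) z^-1 = - (1 - z^-1)], differentiating the power does not lower it: the factor
    [1 - z] restores what is lost and leaves [- i m]. *)
Lemma cder_ubm (x : R) : cder (fun x => (1 - cis (x - theta)) * (1 - ((cis (x - theta))^*)%C) ^+ m) x
  (- 'i%C * (cis (x - theta) + m%:R) * (1 - ((cis (x - theta))^*)%C) ^+ m).
Proof.
have dz := cder_cis theta x.
have dzb : cder (fun x => ((cis (x - theta))^*)%C) x (- 'i%C * ((cis (x - theta))^*)%C).
  case: dz => d1 d2; split.
    move: d1; rewrite (_ : Re (- _ * _) = Re ('i%C * cis (x - theta))).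
      congr is_derive; apply/funext => y; by case: (cis _).
    by case: (cis _) => a b; rewrite !cReM /=; ring.
  have := is_deriveN d2.
  rewrite (_ : Im (- _ * _) = - Im ('i%C * cis (x - theta))).
    congr is_derive; apply/funext => y; by rewrite /= cisE.
  by case: (cis _) => a b; rewrite !cImM /=; ring.
have du := cderD (cder_cst 1 x) (cderN dz).
have db := cderX m (cderD (cder_cst 1 x) (cderN dzb)).
have := cderM du db; congr cder.
have := cisJ (x - theta); set a := cis _; set b := (_^*)%C => ab.
case: m => [|k]; first by rewrite !expr0; ring.
rewrite /= exprS.
have e : (1 - a) * b = - (1 - b) by rewrite mulrBl mul1r ab; ring.
transitivity (- 'i%C * a * ((1 - b) * (1 - b) ^+ k) +
  ((1 - a) * b) * (k.+1%:R * (1 - b) ^+ k * 'i%C)); first by ring.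
by rewrite e; ring.
Qed.

Lemma cder_ibp_fun delta w (x : R) : 0 < delta ->
  cder (fun x => ibp_fun delta (rcons0 (x, w))) x (ibp_deriv delta (rcons0 (x, w))).
Proof.
move=> d0.
pose c := U (rcons0 (0, w)) * ubrest (rcons0 (0, w)).
have cE y : U (rcons0 (y, w)) * ubrest (rcons0 (y, w)) = c.
  by rewrite /c /U (umprod_rcons0 y).
have dl := cder_real (is_derive_logsum w x d0).
have dp := cder_real (is_derive_pairsum w x d0).
have dW : cder (fun x => Wt delta (rcons0 (x, w))) x
   ((s / 2 * (dpt delta x theta)%:C%C + lam%:C%C * \sum_(j < n) (dpt delta x (w j))%:C%C)
     * Wt delta (rcons0 (x, w))).
  rewrite (_ : (fun x => _) = (fun x => cexp (s / 2 * (logsum n theta delta (rcons0 (x, w)))%:C%C +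
      (lam / 2)%:C%C * (pairsum n delta (rcons0 (x, w)))%:C%C))); last first.
    apply/funext => y; rewrite WE; congr cexp.
    by rewrite !real_complexM fmorphV/= rmorph_nat; ring.
  rewrite WE.
  have h := cder_cexp (cderD (cderM (cder_cst (s / 2) x) dl) (cderM (cder_cst (lam / 2)%:C%C x) dp)).
  have := h; congr cder; congr (_ * _).
    rewrite !mul0r !add0r; congr (_ + _).
    rewrite !real_complexM fmorphV/= rmorph_nat rmorph_sum/= mulrA mulfVK//.
  by congr cexp; rewrite !real_complexM fmorphV/= rmorph_nat; ring.
have := cderM (cderM (cder_ubm x) (cder_cst c x)) dW.
rewrite (_ : (fun y => _) = (fun x => ibp_fun delta (rcons0 (x, w)))); last first.
  by apply/funext => y; rewrite /ibp_fun cE.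
congr cder; rewrite /ibp_deriv ubprod_recl /ub /uu /zz /=.
rewrite -(cE x) /rcons0/=.
by ring.
Qed.
End aomoto.

(** * Limits of the regularized quantities, in the angles and in [delta] *)

Section limits.
Variable R : realType.
Notation T := (rseq R).
Variables (n : nat) (theta lam : R).
Context {I : Type} {F : set_system I} {FF : ProperFilter F}.
Variables (v_ : I -> T) (v : T) (delta_ : I -> R) (delta : R).
Hypothesis hv : forall j, v_ i j @[i --> F] --> v j.
Hypothesis hd : delta_ i @[i --> F] --> delta.

Lemma cvg_bigsum J (r : seq J) (Q : pred J) (f : J -> I -> R) a :
  (forall j, Q j -> f j i @[i --> F] --> a j) ->
  (\sum_(j <- r | Q j) f j i) @[i --> F] --> \sum_(j <- r | Q j) a j.
Proof.
move=> h; elim: r => [|j r IH].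
  rewrite big_nil; under eq_fun do rewrite big_nil; exact: cvg_cst.
rewrite big_cons; under eq_fun do rewrite big_cons.
by case: (boolP (Q j)) => // Qj; apply: cvgD => //; exact: h.
Qed.

Lemma cvg_sqd (f g : I -> R) (a b : R) : f i @[i --> F] --> a -> g i @[i --> F] --> b ->
  sqd (f i) (g i) @[i --> F] --> sqd a b.
Proof.
move=> fa gb; apply: cvgB; first exact: cvg_cst.
apply: cvgM; first exact: cvg_cst.
by apply: (cvg_comp (fun i => f i - g i) (@cos R) (cvgB fa gb)); exact: continuous_cos.
Qed.

Lemma cvg_ln_sqd (f g : I -> R) (a b : R) : f i @[i --> F] --> a -> g i @[i --> F] --> b ->
  0 < sqd a b + delta -> ln (sqd (f i) (g i) + delta_ i) @[i --> F] --> ln (sqd a b + delta).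
Proof.
move=> fa gb p.
apply: (cvg_comp (fun i => sqd (f i) (g i) + delta_ i) (@ln R) (cvgD (cvg_sqd fa gb) hd)).
exact: continuous_ln.
Qed.

Lemma cvg_inv_sqd (f g : I -> R) (a b : R) : f i @[i --> F] --> a -> g i @[i --> F] --> b ->
  0 < sqd a b + delta -> (sqd (f i) (g i) + delta_ i)^-1 @[i --> F] --> (sqd a b + delta)^-1.
Proof.
move=> fa gb p; apply: cvgV; first by rewrite gt_eqF.
exact: (cvgD (cvg_sqd fa gb) hd).
Qed.

Lemma cvg_dpt (f g : I -> R) (a b : R) : f i @[i --> F] --> a -> g i @[i --> F] --> b ->
  0 < sqd a b + delta -> dpt (delta_ i) (f i) (g i) @[i --> F] --> dpt delta a b.
Proof.
move=> fa gb p; apply: cvgM; last exact: cvg_inv_sqd.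
apply: cvgM; first exact: cvg_cst.
by apply: (cvg_comp (fun i => f i - g i) (@sin R) (cvgB fa gb)); exact: continuous_sin.
Qed.

Lemma cvg_qpt (f g : I -> R) (a b : R) : f i @[i --> F] --> a -> g i @[i --> F] --> b ->
  0 < sqd a b + delta -> qpt (delta_ i) (f i) (g i) @[i --> F] --> qpt delta a b.
Proof.
by move=> fa gb p; apply: cvgM; [exact: cvg_sqd|exact: cvg_inv_sqd].
Qed.

Lemma ccvg_zz j : ccvg F (fun i => zz theta (v_ i) j) (zz theta v j).
Proof.
apply: ccvg_cexp; split => /=; first exact: cvg_cst.
by apply: cvgB; [exact: hv|exact: cvg_cst].
Qed.

Lemma ccvg_uu j : ccvg F (fun i => uu theta (v_ i) j) (uu theta v j).
Proof. by apply: ccvgD; [exact: ccvg_cst|apply: ccvgN; exact: ccvg_zz]. Qed.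

Lemma ccvg_ub j : ccvg F (fun i => ub theta (v_ i) j) (ub theta v j).
Proof.
apply: ccvgD; first exact: ccvg_cst.
apply: ccvgN; have [h1 h2] := ccvg_zz j; split.
  have -> : (fun i => complex.Re ((zz theta (v_ i) j)^*)%C) = (fun i => complex.Re (zz theta (v_ i) j)).
    by apply/funext => i; case: (zz _ _ _).
  by move: h1; case: (zz theta v j).
have -> : (fun i => complex.Im ((zz theta (v_ i) j)^*)%C) = (fun i => - complex.Im (zz theta (v_ i) j)).
  by apply/funext => i; case: (zz _ _ _).
by move/cvgN: h2; case: (zz theta v j).
Qed.

Hypothesis p1 : forall j : 'I_n.+1, 0 < sqd theta (v j) + delta.
Hypothesis p2 : forall i j : 'I_n.+1, i != j -> 0 < sqd (v i) (v j) + delta.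

Lemma ccvg_W s : ccvg F (fun i => cbe_weight n theta lam s (delta_ i) (v_ i)) (cbe_weight n theta lam s delta v).
Proof.
have hl : logsum n theta (delta_ i) (v_ i) @[i --> F] --> logsum n theta delta v.
  by apply: cvg_bigsum => j _; apply: cvg_ln_sqd => //; exact: cvg_cst.
have hp : pairsum n (delta_ i) (v_ i) @[i --> F] --> pairsum n delta v.
  apply: cvg_bigsum => i _; apply: cvg_bigsum => j ij; apply: cvg_ln_sqd => //.
  by apply: p2; rewrite eq_sym.
apply: ccvg_cexp; split => /=.
  apply: cvgD; apply: cvgM; try exact: cvg_cst => //.
    by apply: cvgM => //; exact: cvg_cst.
  exact: hp.
by apply: cvgM; [exact: cvg_cst|apply: cvgM => //; exact: cvg_cst].
Qed.

Lemma ccvg_umprod Q : ccvg F (fun i => @umprod R n theta Q (v_ i)) (umprod theta Q v).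
Proof. by apply: ccvg_prod => j _; exact: ccvg_uu. Qed.

Lemma ccvg_ubprod m : ccvg F (fun i => @ubprod R n theta m (v_ i)) (ubprod n theta m v).
Proof. by apply: ccvg_prod => j _; apply: ccvgX; exact: ccvg_ub. Qed.
End limits.

(** * Aomoto's recursion *)

Section uniformly_bounded.
Context {d : measure_display} {T : measurableType d} {R : realType}.
Local Notation Re := complex.Re.
Local Notation Im := complex.Im.

(** A norm equivalent to [cabs] whose sum and product bounds follow directly from those of the real
    absolute value. *)
Definition l1 (z : R[i]) : R := `|Re z| + `|Im z|.

Lemma cabs_l1 z : cabs z <= l1 z.
Proof.
rewrite -(@ler_pXn2r _ 2) ?nnegrE ?cabs_ge0 ?addr_ge0//.
rewrite cabs_sqr sqrrD !real_normK ?num_real// -addrA lerD2l lerDr.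
by rewrite mulrn_wge0// mulr_ge0.
Qed.

Lemma l1_cabs z : l1 z <= 2 * cabs z.
Proof. by rewrite mulr_natl mulr2n lerD// ?Re_le_cabs ?Im_le_cabs. Qed.

Lemma l1D z w : l1 (z + w) <= l1 z + l1 w.
Proof. by rewrite /l1 cReD cImD addrACA lerD// ler_normD. Qed.

Lemma l1M z w : l1 (z * w) <= l1 z * l1 w.
Proof.
rewrite /l1 cReM cImM mulrDl !mulrDr -!normrM.
apply: (le_trans (lerD (ler_normB _ _) (ler_normD _ _))).
by rewrite le_eqVlt; apply/orP; left; apply/eqP; ring.
Qed.

Definition ubd (f : nat -> T -> R[i]) := exists M : R, forall k v, l1 (f k v) <= M.

Lemma ubdD f g : ubd f -> ubd g -> ubd (fun k v => f k v + g k v).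
Proof.
move=> [M hM] [M' hM']; exists (M + M') => k v.
by apply: (le_trans (l1D _ _)); exact: lerD.
Qed.

Lemma ubdM f g : ubd f -> ubd g -> ubd (fun k v => f k v * g k v).
Proof.
move=> [M hM] [M' hM']; exists (M * M') => k v.
by apply: (le_trans (l1M _ _)); apply: ler_pM => //; rewrite addr_ge0.
Qed.

Lemma ubd_cbm f : cbm f -> ubd (fun _ => f).
Proof.
by move=> [[_ [M hM]] [_ [M' hM']]]; exists (M + M') => k v; exact: lerD.
Qed.

Lemma ubd_cabs M f : (forall k v, cabs (f k v) <= M) -> ubd f.
Proof.
move=> h; exists (2 * M) => k v; apply: (le_trans (l1_cabs _)).
by rewrite ler_wpM2l.
Qed.

Lemma ubd_real M (h : nat -> T -> R) : (forall k v, `|h k v| <= M) ->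
  ubd (fun k v => (h k v)%:C%C).
Proof. by move=> hM; exists M => k v; rewrite /l1/= normr0 addr0. Qed.

Lemma ubd_sum J (r : seq J) (Q : pred J) (f : J -> nat -> T -> R[i]) :
  (forall j, Q j -> ubd (f j)) -> ubd (fun k v => \sum_(j <- r | Q j) f j k v).
Proof.
move=> h; elim: r => [|j r [M IH]].
  by exists 0 => k v; rewrite big_nil /l1/= normr0 addr0.
case: (boolP (Q j)) => Qj; last first.
  by exists M => k v; rewrite big_cons (negbTE Qj).
have [M' hM'] := h j Qj; exists (M' + M) => k v; rewrite big_cons Qj.
by apply: (le_trans (l1D _ _)); exact: lerD.
Qed.
End uniformly_bounded.

Section recursion.
Variable R : realType.
Notation T := (rseq R).
Local Notation Re := complex.Re.
Variables (n : nat) (theta lam : R).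
Local Notation N := n.+1.
Hypothesis lam_ge0 : 0 <= lam.
Variables (s : R[i]) (m p : nat).
Hypothesis s_ge0 : 0 <= Re s.
Hypothesis pn : (p <= n)%N.

Local Notation zt := (zz theta).
Local Notation ut := (uu theta).
Local Notation Et := (@ubprod R n theta m).
Local Notation Wt := (@cbe_weight R n theta lam s).
Local Notation U := (@umprod R n theta (fun k => (0 < k <= p)%N)).
Local Notation Uf := (@umprod R n theta (fun k => (k <= p)%N)).
Local Notation E0 := (CE (mu R N)).

Lemma cbm_dpt delta (f g : T -> R) : 0 < delta -> measurable_fun [set: T] f ->
  measurable_fun [set: T] g -> cbm (fun v => (dpt delta (f v) (g v))%:C%C).
Proof.
move=> d0 mf mg; apply: cbm_real; apply: bmM.
  by apply: bmZ; apply: bm_sin; exact: measurable_funB.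
by apply: bm_inv => //; [exact: measurable_sqd|move=> v; exact: sqd_ge0].
Qed.

Lemma cbm_qpt delta (f g : T -> R) : 0 < delta -> measurable_fun [set: T] f ->
  measurable_fun [set: T] g -> cbm (fun v => (qpt delta (f v) (g v))%:C%C).
Proof.
move=> d0 mf mg; apply: cbm_real; apply: bmM; first exact: bm_sqd.
by apply: bm_inv => //; [exact: measurable_sqd|move=> v; exact: sqd_ge0].
Qed.

Section fixed_delta.
Variable delta : R.
Hypothesis d0 : 0 < delta.
Hypothesis d1 : delta <= 1.

Let d01 : 0 <= delta <= 1. Proof. by rewrite ltW. Qed.

Let cW : cbm (Wt delta). Proof. exact: cbm_W. Qed.

Let cUEW : cbm (fun v => U v * Et v * Wt delta v).
Proof. by apply: cbmM => //; apply: cbmM; [exact: cbm_umprod|exact: cbm_ubprod]. Qed.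

Let cUfEW : cbm (fun v => Uf v * Et v * Wt delta v).
Proof. by apply: cbmM => //; apply: cbmM; [exact: cbm_umprod|exact: cbm_ubprod]. Qed.

Let cd0 : cbm (fun v : T => (dpt delta (v 0%N) theta)%:C%C).
Proof. by apply: cbm_dpt => //; exact: measurable_coord. Qed.

Let cdj j : cbm (fun v : T => (dpt delta (v 0%N) (v j))%:C%C).
Proof. by apply: cbm_dpt => //; exact: measurable_coord. Qed.

Lemma CE_ibp_deriv : E0 (@ibp_deriv R n theta lam s m p delta) = 0.
Proof.
apply: (@CE_ibp R n (@ibp_fun R n theta lam s m p delta)).
- apply: cbmM; first exact: cUEW.
  apply: cbmD; first by apply: cbmZ; apply: cbmD; [exact: cbm_zz|exact: cbm_cst].
  apply: cbmM; first exact: cbm_uu.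
  apply: cbmD; first exact: cbmZ.
  by apply: cbmZ; apply: cbm_sum => j _; exact: cdj.
- by move=> w x; exact: cder_ibp_fun.
- move=> w x.
  have pos a c : 0 < sqd a c + delta by rewrite ltr_wpDl// sqd_ge0.
  have hv j : (rcons0 (y, w) : T) j @[y --> x] --> (rcons0 (x, w) : T) j.
    by rewrite /rcons0/=; case: eqP => _; [exact: cvg_id|exact: cvg_cst].
  have hd : delta @[_ --> x] --> delta by exact: cvg_cst.
  have h0 := hv 0%N.
  apply: ccvgM.
    by apply: ccvgM; [apply: ccvgM; [exact: ccvg_umprod|exact: ccvg_ubprod]|exact: ccvg_W].
  apply: ccvgD.
    apply: ccvgM; first exact: ccvg_cst.
    by apply: ccvgD; [exact: ccvg_zz|exact: ccvg_cst].
  apply: ccvgM; first exact: ccvg_uu.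
  apply: ccvgD; apply: ccvgM; try exact: ccvg_cst.
    by apply: ccvg_real; apply: cvg_dpt => //; exact: cvg_cst.
  apply: ccvg_sum => j _; apply: ccvg_real.
  by apply: (cvg_dpt hd h0 (hv j.+1)).
- move=> w; rewrite /ibp_fun.
  have e j : (j != 0)%N -> (rcons0 (2 * pi, w) : T) j = (rcons0 (0, w) : T) j.
    by rewrite /rcons0/= => /negbTE ->.
  have ez j : zt (rcons0 (2 * pi, w)) j = zt (rcons0 (0, w)) j.
    rewrite /zz; have [->|j0] := eqVneq j 0%N; last by rewrite e.
    by rewrite /rcons0/= cis_periodic add0r.
  have es a j : sqd a ((rcons0 (2 * pi, w) : T) j) = sqd a ((rcons0 (0, w) : T) j).
    have [->|j0] := eqVneq j 0%N; last by rewrite e.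
    by rewrite /rcons0/= /sqd !cosB [2 * pi]mulr_natl cos2pi sin2pi cos0 sin0.
  have es' a j : sqd ((rcons0 (2 * pi, w) : T) j) a = sqd ((rcons0 (0, w) : T) j) a.
    by rewrite sqdC es sqdC.
  have e1 j : ut (rcons0 (2 * pi, w)) j = ut (rcons0 (0, w)) j by rewrite /uu ez.
  have e2 j : ub theta (rcons0 (2 * pi, w)) j = ub theta (rcons0 (0, w)) j by rewrite /ub ez.
  have e3 : U (rcons0 (2 * pi, w)) = U (rcons0 (0, w)).
    by apply: eq_bigr => j _; exact: e1.
  have e4 : ubrest n theta m (rcons0 (2 * pi, w)) = ubrest n theta m (rcons0 (0, w)).
    by apply: eq_bigr => j _; rewrite e2.
  have e5 : Wt delta (rcons0 (2 * pi, w)) = Wt delta (rcons0 (0, w)).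
    have el : logsum n theta delta (rcons0 (2 * pi, w)) = logsum n theta delta (rcons0 (0, w)).
      by apply: eq_bigr => j _; rewrite es.
    have ep : pairsum n delta (rcons0 (2 * pi, w)) = pairsum n delta (rcons0 (0, w)).
      by apply: eq_bigr => i _; apply: eq_bigr => j _; rewrite es es'.
    by rewrite /cbe_weight el ep.
  by rewrite e1 e2 e3 e4 e5.
Qed.


(** The contribution to [ibp_deriv] of the interaction between the first angle and the [j]-th one,
    not bounded uniformly in [delta]. *)
Definition pair_term (j : nat) (v : T) := Uf v * Et v * Wt delta v * (dpt delta (v 0%N) (v j))%:C%C.

Let cH j : cbm (pair_term j).
Proof. by apply: cbmM; [exact: cUfEW|exact: cdj]. Qed.

Definition sym_pair_term (j : nat) (v : T) :=
  U v * Et v * Wt delta v * ((zt v 0 + zt v j) * (qpt delta (v 0%N) (v j))%:C%C).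

Let cK j : cbm (sym_pair_term j).
Proof.
apply: cbmM; first exact: cUEW.
apply: cbmM; first by apply: cbmD; exact: cbm_zz.
by apply: cbm_qpt => //; exact: measurable_coord.
Qed.

(* [dpt] is antisymmetric: exchanging the coordinates 0 and [j] cancels the term when
   [uu v j] is among the factors, and otherwise replaces [uu v 0] by half of
   [uu v 0 - uu v j], which removes the singularity on the diagonal. *)
Lemma CE_pair_term (j : 'I_n) : 2 * E0 (pair_term j.+1) =
  if (p <= j)%N then - 'i%C * E0 (sym_pair_term j.+1) else 0.
Proof.
pose jj : 'I_N := lift ord0 j.
have sw : E0 (fun v => pair_term j.+1 (reindex_coord (swapn 0 j.+1) v)) = E0 (pair_term j.+1).
  by apply: CE_swap => //; rewrite ltnS.
have swE v : Et (reindex_coord (swapn 0 j.+1) v) = Et v.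
  exact: (ubprod_swap theta m ord0 jj v).
have swW v : Wt delta (reindex_coord (swapn 0 j.+1) v) = Wt delta v.
  exact: (W_swap theta lam s delta ord0 jj v).
have swd (v : T) : dpt delta (reindex_coord (swapn 0 j.+1) v 0%N)
    (reindex_coord (swapn 0 j.+1) v j.+1) = - dpt delta (v 0%N) (v j.+1).
  by rewrite /reindex_coord /swapn/= eqxx dptC.
rewrite mulr_natl mulr2n -{2}sw; case: leqP => pj.
- rewrite -CED//; last exact: cbm_reindex.
  rewrite -CEZ//; congr (CE _ _); apply/funext => v.
  have swU : U (reindex_coord (swapn 0 j.+1) v) = U v.
    apply: (umprod_swap theta (i := ord0) (j := jj)) => /=.
    by rewrite /bump/= add1n ltnNge pj.
  rewrite /pair_term swE swW swd !umprod_recl// swU.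
  rewrite (_ : ut (reindex_coord _ v) 0 = ut v j.+1)// rmorphN/=.
  transitivity (U v * Et v * Wt delta v * ((ut v 0 - ut v j.+1) * (dpt delta (v 0%N) (v j.+1))%:C%C)).
    by ring.
  by rewrite sub_uu_dpt /sym_pair_term; ring.
- rewrite -CED//; last exact: cbm_reindex.
  rewrite -[RHS](CE0 (mu R N)); congr (CE _ _); apply/funext => v.
  have swU : Uf (reindex_coord (swapn 0 j.+1) v) = Uf v.
    apply: (umprod_swap theta (i := ord0) (j := jj)) => /=.
    by rewrite /bump/= add1n pj.
  by rewrite /pair_term swE swW swd swU rmorphN/= mulrN subrr.
Qed.

(** What symmetrization makes of [ibp_deriv]: the two have the same expectation up to the factor
    [- i]. Only the angles beyond index [p] still interact with the first one, and every denominator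
    sits in a factor [qpt], which lies between 0 and 1. *)
Definition sym_ibp_deriv (v : T) := U v * Et v * Wt delta v * (zt v 0 + m%:R +
  s / 2 * (zt v 0 + 1) * (qpt delta theta (v 0%N))%:C%C +
  (lam / 2)%:C%C * \sum_(j < n | (p <= j)%N) (zt v 0 + zt v j.+1) * (qpt delta (v 0%N) (v j.+1))%:C%C).

Lemma cbm_sym_ibp_deriv : cbm sym_ibp_deriv.
Proof.
apply: cbmM; first exact: cUEW.
apply: cbmD; last first.
  apply: cbmZ; apply: cbm_sum => j _; apply: cbmM; first by apply: cbmD; exact: cbm_zz.
  by apply: cbm_qpt => //; exact: measurable_coord.
apply: cbmD; first by apply: cbmD; [exact: cbm_zz|exact: cbm_cst].
apply: cbmM; first by apply: cbmZ; apply: cbmD; [exact: cbm_zz|exact: cbm_cst].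
by apply: cbm_qpt => //; exact: measurable_coord.
Qed.

Lemma CE_sym_ibp_deriv : E0 sym_ibp_deriv = 0.
Proof.
pose K0 v := U v * Et v * Wt delta v * (zt v 0 + m%:R +
  s / 2 * (zt v 0 + 1) * (qpt delta theta (v 0%N))%:C%C).
have cK0 : cbm K0.
  apply: cbmM; first exact: cUEW.
  apply: cbmD; first by apply: cbmD; [exact: cbm_zz|exact: cbm_cst].
  apply: cbmM; first by apply: cbmZ; apply: cbmD; [exact: cbm_zz|exact: cbm_cst].
  by apply: cbm_qpt => //; exact: measurable_coord.
have e1 : E0 sym_ibp_deriv = E0 K0 + (lam / 2)%:C%C * \sum_(j < n | (p <= j)%N) E0 (sym_pair_term j.+1).
  rewrite -CE_sum//.
  rewrite -CEZ; last by apply: cbm_sum => j _; exact: cK.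
  rewrite -CED//; last by apply: cbmZ; apply: cbm_sum => j _; exact: cK.
  congr (CE _ _); apply/funext => v; rewrite /sym_ibp_deriv mulrDr; congr (_ + _).
  by rewrite mulrCA; congr (_ * _); rewrite mulr_sumr; apply: eq_bigr.
have e2 : E0 (@ibp_deriv R n theta lam s m p delta) =
    - 'i%C * E0 K0 + lam%:C%C * \sum_(j < n) E0 (pair_term j.+1).
  rewrite -CE_sum//.
  rewrite -!CEZ//; last by apply: cbm_sum => j _; exact: cH.
  rewrite -CED//; last 2 first.
    exact: cbmZ.
    by apply: cbmZ; apply: cbm_sum => j _; exact: cH.
  congr (CE _ _); apply/funext => v; rewrite /ibp_deriv /K0.
  have -> : \sum_(j < n) pair_term j.+1 v =
      U v * Et v * Wt delta v * (ut v 0 * \sum_(j < n) (dpt delta (v 0%N) (v j.+1))%:C%C).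
    rewrite !mulr_sumr; apply: eq_bigr => j _.
    by rewrite /pair_term umprod_recl//; ring.
  have := uu_dpt_theta theta delta v; set S := \sum_(j < n) _.
  set d := (dpt _ _ _)%:C%C; set q := (qpt _ _ _)%:C%C => e.
  transitivity (U v * Et v * Wt delta v * (- 'i%C * (zt v 0 + m%:R) + s / 2 * (ut v 0 * d) +
     lam%:C%C * (ut v 0 * S))); first by ring.
  by rewrite e; ring.
have e3 : 2 * \sum_(j < n) E0 (pair_term j.+1) = - 'i%C * \sum_(j < n | (p <= j)%N) E0 (sym_pair_term j.+1).
  rewrite !mulr_sumr [RHS]big_mkcond; apply: eq_bigr => j _; exact: CE_pair_term.
have : 2 * (- 'i%C * E0 sym_ibp_deriv) = 0.
  rewrite e1; transitivity (2 * E0 (@ibp_deriv R n theta lam s m p delta)); last by rewrite CE_ibp_deriv mulr0.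
  rewrite e2; transitivity (2 * (- 'i%C * E0 K0) + lam%:C%C * (2 * \sum_(j < n) E0 (pair_term j.+1))); last by ring.
  by rewrite e3 real_complexM fmorphV/= rmorph_nat; field.
move/eqP; rewrite mulf_eq0 pnatr_eq0/= mulf_eq0 oppr_eq0 => /orP[|/eqP//].
by rewrite eq_complex/= oner_eq0 andbF.
Qed.

End fixed_delta.

Definition sym_ibp_lim (v : T) := U v * Et v * Wt 0 v * (zt v 0 + m%:R +
  s / 2 * (zt v 0 + 1) + (lam / 2)%:C%C * \sum_(j < n | (p <= j)%N) (zt v 0 + zt v j.+1)).

Let o01 : 0 <= (0 : R) <= 1. Proof. by rewrite lexx ler01. Qed.

Let cUEW0 : cbm (fun v => U v * Et v * Wt 0 v).
Proof.
apply: cbmM; last exact: cbm_W.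
by apply: cbmM; [exact: cbm_umprod|exact: cbm_ubprod].
Qed.

(** Dominated convergence along [delta = 1 / (k + 1)]: the factors [qpt] are at most 1 for every
    [delta] and tend to 1 on the generic set. The same limit could not be taken directly in
    [ibp_deriv], whose factors [dpt] have no uniform bound. *)
Lemma CE_sym_ibp_lim : E0 sym_ibp_lim = 0.
Proof.
pose dl (k : nat) : R := k.+1%:R^-1.
have dl0 k : 0 < dl k by rewrite invr_gt0.
have dl1 k : dl k <= 1 by rewrite invf_le1// ler1n.
have dl01 k : 0 <= dl k <= 1 by rewrite ltW ?dl0 ?dl1.
have qb k x y : `|qpt (dl k) x y| <= 1.
  have h := sqd_ge0 x y; have h2 := dl0 k.
  rewrite /qpt ger0_norm; last by rewrite divr_ge0// addr_ge0// ltW.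
  by rewrite ler_pdivrMr ?mul1r ?lerDl ?ltW// ltr_wpDl.
have [M hM] : ubd (fun k => sym_ibp_deriv (dl k)).
  apply: ubdM.
    apply: ubdM; first by apply: ubd_cbm; apply: cbmM; [exact: cbm_umprod|exact: cbm_ubprod].
    by apply: (ubd_cabs (M := expR (Wbound n lam s))) => k v; exact: cabs_W.
  apply: ubdD.
    apply: ubdD; first by apply: ubd_cbm; apply: cbmD; [exact: cbm_zz|exact: cbm_cst].
    apply: ubdM; first by apply: ubd_cbm; apply: cbmZ; apply: cbmD; [exact: cbm_zz|exact: cbm_cst].
    exact: (ubd_real (M := 1)).
  apply: ubdM; first by apply: ubd_cbm; exact: cbm_cst.
  apply: ubd_sum => j _; apply: ubdM; first by apply: ubd_cbm; apply: cbmD; exact: cbm_zz.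
  exact: (ubd_real (M := 1)).
apply: (@CE_dct0 _ _ _ _ (fun k => sym_ibp_deriv (dl k)) _ M).
- by move=> k; exact: cbm_sym_ibp_deriv.
- apply: cbmM; first exact: cUEW0.
  apply: cbmD; last first.
    by apply: cbmZ; apply: cbm_sum => j _; apply: cbmD; exact: cbm_zz.
  apply: cbmD; first by apply: cbmD; [exact: cbm_zz|exact: cbm_cst].
  by apply: cbmZ; apply: cbmD; [exact: cbm_zz|exact: cbm_cst].
- by move=> k v; apply: le_trans (cabs_l1 _) (hM k v).
- apply: filterS (generic_ae N theta) => v [g1 g2].
  have hv j : (fun _ : nat => v) k j @[k --> \oo] --> v j by exact: cvg_cst.
  have hd : dl k @[k --> \oo] --> (0 : R) by exact: cvg_harmonic.
  have ccq x y : 0 < sqd x y -> ccvg \oo (fun k => (qpt (dl k) x y)%:C%C) 1.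
    move=> xy; have -> : (1 : R[i]) = (qpt 0 x y)%:C%C by rewrite /qpt addr0 divff ?gt_eqF.
    apply: ccvg_real; apply: (cvg_qpt hd); rewrite ?addr0//; exact: cvg_cst.
  rewrite /sym_ibp_deriv /sym_ibp_lim; apply: ccvgM.
    apply: ccvgM; first exact: ccvg_cst.
    apply: (ccvg_W lam hv hd) => [j|i j ij]; rewrite addr0; [exact: g1|exact: g2].
  apply: ccvgD.
    apply: ccvgD; first exact: ccvg_cst.
    rewrite -[X in ccvg _ _ X]mulr1; apply: ccvgM; first exact: ccvg_cst.
    by apply: ccq; exact: (g1 ord0).
  apply: ccvgM; first exact: ccvg_cst.
  apply: ccvg_sum => j _; rewrite -[X in ccvg _ _ X]mulr1; apply: ccvgM; first exact: ccvg_cst.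
  by apply: ccq; exact: (g2 ord0 (lift ord0 j)).
- by move=> k; exact: CE_sym_ibp_deriv.
Qed.

(** The unnormalized moment of [u_0 ... u_(q-1) prod_j (1 - z_j^-1)^m]. *)
Definition Bmom (q : nat) := E0 (fun v => @umprod R n theta (fun k => (k < q)%N) v * Et v * Wt 0 v).

(** Let [Z] be the moment of [u_1 ... u_p] times [z_0]. Expanding [u_0 = 1 - z_0] gives
    [Bmom p.+1 = Bmom p - Z]. By symmetry each of the [n - p] angles beyond [p] may replace [z_0] in
    [Z], so [CE_sym_ibp_lim] is a linear relation between [Z] and [Bmom p]; eliminating [Z] gives
    the recursion. *)
Lemma Bmom_rec : (1 + m%:R + s + lam%:C%C * (n - p)%:R) * Bmom p =
  (1 + s / 2 + lam%:C%C * (n - p)%:R) * Bmom p.+1.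
Proof.
pose X v := U v * Et v * Wt 0 v.
have cX : cbm X := cUEW0.
have cXz j : cbm (fun v => X v * zt v j) by apply: cbmM => //; exact: cbm_zz.
pose Z := E0 (fun v => X v * zt v 0).
(* Exchanging the coordinates 0 and [p] turns [u_0 ... u_(p-1)] into [u_1 ... u_p]. *)
have EA : Bmom p = E0 X.
  rewrite /Bmom /X; case: p pn => [|p'] p'n.
    congr (CE _ _); apply/funext => v; congr (_ * _ * _).
    by apply: eq_bigl => k; case: (k : nat).
  pose pp : 'I_N := Ordinal (n := N) (m := p'.+1) p'n.
  rewrite -(@CE_swap R N 0 p'.+1)//; last first.
    by apply: cbmM; [apply: cbmM; [exact: cbm_umprod|exact: cbm_ubprod]|exact: cbm_W].
  congr (CE _ _); apply/funext => v.
  rewrite (ubprod_swap theta m ord0 pp v) (W_swap theta lam s 0 ord0 pp v).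
  congr (_ * _ * _).
  rewrite [LHS](big_swap _ ord0 pp (fun k => (k < p'.+1)%N) (fun x => 1 - cis (x - theta))).
  apply: eq_bigl => k; case: tpermP => [->|->|/eqP k0 /eqP kp] /=.
  - by rewrite ltnn.
  - by rewrite leqnn.
  - rewrite -val_eqE/= -lt0n in k0; rewrite k0/= [RHS]leq_eqVlt.
    by rewrite -val_eqE/= in kp; rewrite (negbTE kp).
have EB : Bmom p.+1 = Bmom p - Z.
  rewrite EA /Z -CEB//; congr (CE _ _); apply/funext => v; rewrite /X.
  rewrite (_ : umprod _ _ v = Uf v)// umprod_recl// /uu; ring.
have EZ (j : 'I_n) : (p <= j)%N -> E0 (fun v => X v * zt v j.+1) = Z.
  move=> pj; pose jj : 'I_N := lift ord0 j.
  rewrite -(@CE_swap R N 0 j.+1 _ (cXz j.+1))//; last by rewrite ltnS.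
  congr (CE _ _); apply/funext => v; rewrite /X.
  rewrite (ubprod_swap theta m ord0 jj v) (W_swap theta lam s 0 ord0 jj v).
  rewrite (umprod_swap theta (i := ord0) (j := jj))//=; last by rewrite /bump/= add1n ltnNge pj.
  by congr (_ * _); rewrite /zz /reindex_coord /swapn/= eqxx.
have := CE_sym_ibp_lim.
have -> : E0 sym_ibp_lim = (1 + s / 2) * Z + (m%:R + s / 2) * E0 X +
    (lam / 2)%:C%C * \sum_(j < n | (p <= j)%N) (Z + E0 (fun v => X v * zt v j.+1)).
  under eq_bigr do rewrite -CED//.
  rewrite -CE_sum; last by move=> j _; apply: cbmD.
  rewrite /Z -!CEZ//; last by apply: cbm_sum => j _; apply: cbmD.
  rewrite -!CED//; first last.
  - exact: cbmZ.
  - exact: cbmZ.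
  - by apply: cbmZ; apply: cbm_sum => j _; apply: cbmD.
  - by apply: cbmD; exact: cbmZ.
  congr (CE _ _); apply/funext => v; rewrite /sym_ibp_lim -/(X v).
  have -> : \sum_(j < n | (p <= j)%N) (X v * zt v 0 + X v * zt v j.+1) =
     X v * \sum_(j < n | (p <= j)%N) (zt v 0 + zt v j.+1).
    by rewrite mulr_sumr; apply: eq_bigr => j _; rewrite mulrDr.
  by ring.
rewrite (eq_bigr (fun _ => Z + Z)); last by move=> j pj; rewrite EZ.
have -> : \sum_(j < n | (p <= j)%N) (Z + Z) = (n - p)%:R * (2 * Z).
  rewrite sumr_const -[_ *+ _]mulr_natl; congr (_%:R * _); last by ring.
  rewrite -sum1_card -(@big_mkord _ _ _ n (fun j => (p <= j)%N) (fun _ => 1%N)) /=.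
  rewrite (big_cat_nat (n := p))//= big1_seq ?add0n; last first.
    by move=> j; rewrite mem_index_iota => /andP[pj /andP[_ jp]]; move: pj; rewrite leqNgt jp.
  rewrite big_nat_cond (eq_bigl (fun j => (p <= j < n)%N && true)); last first.
    by move=> j; case: (p <= j)%N; rewrite ?andbT.
  by rewrite -big_nat_cond sum_nat_const_nat muln1.
rewrite -EA real_complexM fmorphV/= rmorph_nat => h.
have e : Z = Bmom p - Bmom p.+1 by rewrite EB; ring.
rewrite e in h.
apply/eqP; rewrite -subr_eq0; apply/eqP; rewrite -[RHS]h.
by field.
Qed.

End recursion.

(** * The Mellin transform of the characteristic polynomial *)

Lemma conjc_mul (R : realType) (a b : R[i]) : ((a * b)%R^*)%C = (a^*)%C * (b^*)%C.
Proof. exact: rmorphM. Qed.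

Lemma halfc (R : realType) (z : R[i]) : z / 2 = (2^-1)%:C%C * z.
Proof. by rewrite fmorphV/= rmorph_nat mulrC. Qed.

Lemma natc (R : realType) (k : nat) : k%:R = (k%:R : R)%:C%C :> R[i].
Proof. by rewrite rmorph_nat. Qed.

Section moments.
Variable R : realType.
Local Notation Re := complex.Re.
Variables (n : nat) (theta lam : R).
Local Notation N := n.+1.
Hypothesis lam_ge0 : 0 <= lam.
Local Notation E0 := (CE (mu R N)).

Definition mellin (s : R[i]) := E0 (cbe_weight n theta lam s 0).

(* [Dprod 0 s * Dprod 1 s / Qprod s ^+ 2] is the factor [R s]. *)
Definition Dprod (m : nat) (s : R[i]) := \prod_(j < N) (1 + m%:R + s + lam%:C%C * j%:R).
Definition Qprod (s : R[i]) := \prod_(j < N) (1 + s / 2 + lam%:C%C * j%:R).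

Let o01 : 0 <= (0 : R) <= 1. Proof. by rewrite lexx ler01. Qed.

Lemma prod_rev_ord (f : nat -> R[i]) : \prod_(p < N) f (n - p)%N = \prod_(j < N) f j.
Proof.
rewrite [RHS](reindex_inj rev_ord_inj)/=; apply: eq_bigr => p _.
by rewrite subSS.
Qed.

Lemma Bmom_prod (s : R[i]) m : 0 <= Re s ->
  Qprod s * Bmom n theta lam s m N = Dprod m s * Bmom n theta lam s m 0.
Proof.
move=> s0.
suff H q : (q <= N)%N ->
   \prod_(p < q) (1 + s / 2 + lam%:C%C * (n - p)%:R) * Bmom n theta lam s m q =
   \prod_(p < q) (1 + m%:R + s + lam%:C%C * (n - p)%:R) * Bmom n theta lam s m 0.
  have := H N (leqnn _).
  rewrite (prod_rev_ord (fun j => 1 + s / 2 + lam%:C%C * j%:R)).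
  by rewrite (prod_rev_ord (fun j => 1 + m%:R + s + lam%:C%C * j%:R)).
elim: q => [|q IH] qN; first by rewrite !big_ord0.
rewrite !big_ord_recr /= -mulrA -(Bmom_rec theta lam_ge0 m s0) //.
by rewrite mulrCA IH 1?ltnW// mulrA; congr (_ * _); rewrite mulrC.
Qed.

Lemma Bmom00 s : Bmom n theta lam s 0 0 = mellin s.
Proof.
congr (CE _ _); apply/funext => v.
rewrite /umprod big_pred0// /ubprod big1 ?mul1r//.
Qed.

Lemma W_conj s v : cbe_weight n theta lam (s^*)%C 0 v = ((cbe_weight n theta lam s 0 v)^*)%C.
Proof.
rewrite /cbe_weight -cexp_conj; congr cexp; apply: complex_ext => /=; case: s => a b /=; ring.
Qed.

Lemma mellin_conj s : 0 <= Re s -> mellin (s^*)%C = ((mellin s)^*)%C.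
Proof.
move=> s0; rewrite /mellin -CE_conj; last exact: cbm_W.
by congr (CE _ _); apply/funext => v; exact: W_conj.
Qed.

Lemma conjc_prod (J : finType) (Q : pred J) (f : J -> R[i]) :
  ((\prod_(j | Q j) f j)^*)%C = \prod_(j | Q j) ((f j)^*)%C.
Proof. exact: rmorph_prod. Qed.

(** Conjugation exchanges [1 - z_j] and [1 - z_j^-1]. This links the end of the recursion for
    [m = 0] to the start of the one for [m = 1]. *)
Lemma Bmom10 s : 0 <= Re s ->
  Bmom n theta lam s 1 0 = ((Bmom n theta lam (s^*)%C 0 N)^*)%C.
Proof.
move=> s0; have s0' : 0 <= Re (s^*)%C by case: s s0.
rewrite /Bmom -CE_conj; last first.
  by apply: cbmM; [apply: cbmM; [exact: cbm_umprod|exact: cbm_ubprod]|exact: cbm_W].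
congr (CE _ _); apply/funext => v.
have e : ubprod n theta 0 v = 1 by rewrite /ubprod big1.
rewrite W_conj e mulr1 conjc_mul conjcK; congr (_ * _).
rewrite {1}/umprod big_pred0// mul1r /ubprod /umprod conjc_prod [RHS](eq_bigl predT); last by move=> k; rewrite /= ltn_ord.
by apply: eq_bigr => j _; rewrite expr1 /ub /uu; case: (zz _ _ _) => a b; apply: complex_ext => /=; ring.
Qed.

Lemma uu_ub v j : uu theta v j * ub theta v j = (sqd theta (v j))%:C%C.
Proof.
rewrite sqdC (_ : sqd _ _ = sqd (v j - theta) 0); last by rewrite /sqd subr0.
rewrite sqd_cis (_ : cis 0 = 1) ?rmorph1; last exact: cexp0.
rewrite /uu /ub /zz mulr1 mulrBl mul1r mulrBr mulr1 cisJ; ring.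
Qed.

(** With all factors present, [prod_j u_j (1 - z_j^-1)] is [|D|^2], which raises the exponent by
    2. *)
Lemma Bmom1N s : 0 <= Re s -> Bmom n theta lam s 1 N = mellin (s + 2).
Proof.
move=> s0; have s2 : 0 <= Re (s + 2) by rewrite cReD/= addr_ge0.
apply: CE_ae.
- by apply: cbmM; [apply: cbmM; [exact: cbm_umprod|exact: cbm_ubprod]|exact: cbm_W].
- exact: cbm_W.
apply: filterS (generic_ae N theta) => v [g1 _].
rewrite !WE (_ : (s + 2) * _ + _ = (logsum n theta 0 v)%:C%C +
  (s * (logsum n theta 0 v / 2)%:C%C + (lam / 2 * pairsum n 0 v)%:C%C)); last first.
  by rewrite !real_complexM fmorphV/= rmorph_nat; field.
rewrite cexpD; congr (_ * _).
have -> : umprod theta (fun k : 'I_N => (k < N)%N) v = \prod_(j < N) uu theta v j.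
  by apply: eq_bigl => k; rewrite ltn_ord.
rewrite cexp_real /logsum expR_sum rmorph_prod /ubprod.
rewrite -big_split; apply: eq_bigr => j _ /=; rewrite expr1 uu_ub.
by rewrite addr0 lnK// posrE.
Qed.

(** Two passes of the recursion, each costing one [Qprod]: for [m = 0] from 1 to [prod_j u_j], then,
    after conjugation, for [m = 1] from [prod_j (1 - z_j^-1)] to [|D|^2]. The conjugations cancel
    because the coefficients of [Qprod] and [Dprod] are real. *)
Lemma mellin_rec s : 0 <= Re s ->
  Qprod s ^+ 2 * mellin (s + 2) = Dprod 0 s * Dprod 1 s * mellin s.
Proof.
move=> s0; have s0' : 0 <= Re (s^*)%C by case: s s0.
rewrite -Bmom1N// expr2 -mulrA Bmom_prod// mulrCA.
rewrite Bmom10// (_ : Qprod s = ((Qprod (s^*)%C)^*)%C); last first.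
  rewrite conjc_prod; apply: eq_bigr => j _; rewrite !halfc natc.
  by case: s {s0 s0'} => a b; apply: complex_ext; rewrite /=; ring.
rewrite -conjc_mul Bmom_prod// Bmom00 conjc_mul mellin_conj// conjcK.
rewrite mulrA; congr (_ * _); rewrite mulrC; congr (_ * _).
rewrite conjc_prod; apply: eq_bigr => j _; rewrite !natc.
by case: s {s0 s0'} => a b; apply: complex_ext; rewrite /=; ring.
Qed.

Lemma cabs_prod (f : 'I_N -> R[i]) : cabs (\prod_(j < N) f j) = \prod_(j < N) cabs (f j).
Proof.
have c1 : cabs (1 : R[i]) = 1 by rewrite /cabs/= expr1n expr0n/= addr0 sqrtr1.
exact: (big_morph _ (@cabsM R) c1).
Qed.

(** [|a + i t| / a] decreases in [a], so the pair of numerator factors at [a] and [a + 1] may be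
    replaced by the square of the one at [a + 1]. *)
Lemma cabs_pair (a t : R) : 0 < a ->
  a * ((a + 1) ^+ 2 + t ^+ 2) <= (a + 1) * (cabs (a +i* t)%C * cabs ((a + 1)%R +i* t)%C).
Proof.
move=> a0; set x := cabs _; set y := cabs _.
have x2 : x ^+ 2 = a ^+ 2 + t ^+ 2 by rewrite cabs_sqr.
have y2 : y ^+ 2 = (a + 1) ^+ 2 + t ^+ 2 by rewrite cabs_sqr.
have x0 : 0 <= x by exact: cabs_ge0.
have y0 : 0 <= y by exact: cabs_ge0.
rewrite -y2 expr2 mulrA [leRHS]mulrA; apply: ler_wpM2r => //.
have a1 : 0 <= a + 1 by lra.
rewrite -(@ler_pXn2r _ 2)// ?nnegrE; [|by rewrite mulr_ge0// ltW|by rewrite mulr_ge0].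
rewrite !exprMn x2 y2.
have t2 := sqr_ge0 t; have : 0 <= (2 * a + 1) * t ^+ 2 by rewrite mulr_ge0//; lra.
by move=> h; rewrite -subr_ge0; apply: (le_trans h); rewrite le_eqVlt; apply/orP; left; apply/eqP; ring.
Qed.

(* Lower bound for minus the logarithm of the [j]-th factor of [R (2k) / |R (2k + i t)|]. *)
Definition decay_term (k : nat) (t : R) (j : nat) : R :=
  let A := 2 + 2 * k%:R + 2 * (lam * j%:R) in lam * j%:R * t ^+ 2 / (A * (A ^+ 2 + t ^+ 2)).

(** Without the exponential the two sides differ by [t^2 (A^2 - B^2)]. The number [e] is at most the
    corresponding relative gap, and [1 - e <= expR (- e)]. *)
Lemma eta_bound (A B t e : R) : 0 < B -> B <= A -> e = (A - B) * t ^+ 2 / (A * (A ^+ 2 + t ^+ 2)) ->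
  (A ^+ 2 + t ^+ 2) * B ^+ 2 <= expR (- e) * (A ^+ 2 * (B ^+ 2 + t ^+ 2)).
Proof.
move=> B0 BA eE.
have A0 : 0 < A by exact: lt_le_trans BA.
have t2 : 0 <= t ^+ 2 := sqr_ge0 t.
have A2 : 0 < A ^+ 2 by rewrite exprn_gt0.
have B2 : 0 < B ^+ 2 by rewrite exprn_gt0.
have AB : B ^+ 2 <= A ^+ 2 by rewrite ler_pXn2r// nnegrE ltW.
have At : 0 < A ^+ 2 + t ^+ 2 by rewrite ltr_wpDr.
apply: (@le_trans _ _ ((1 - e) * (A ^+ 2 * (B ^+ 2 + t ^+ 2)))); last first.
  apply: ler_wpM2r; first by rewrite mulr_ge0//; [exact: ltW|rewrite addr_ge0// ltW].
  by have := expR_ge1Dx (- e); lra.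
have : e * (A ^+ 2 * (B ^+ 2 + t ^+ 2)) <= (A - B) * t ^+ 2 * A.
  rewrite eE mulrAC ler_pdivrMr; last by rewrite mulr_gt0.
  rewrite [leLHS](_ : _ = (A - B) * t ^+ 2 * A * (A * (B ^+ 2 + t ^+ 2))); last by ring.
  apply: ler_wpM2l; first by apply: mulr_ge0; [apply: mulr_ge0; rewrite ?subr_ge0|exact: ltW].
  by rewrite ler_pM2l// lerD2r.
have : (A - B) * t ^+ 2 * A <= t ^+ 2 * (A ^+ 2 - B ^+ 2).
  rewrite [leLHS](_ : _ = t ^+ 2 * ((A - B) * A)); last by ring.
  rewrite (_ : A ^+ 2 - B ^+ 2 = (A - B) * (A + B)); last by ring.
  by rewrite ler_wpM2l// ler_wpM2l ?subr_ge0// lerDl ltW.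
by move=> h1 h2; rewrite mulrBl mul1r; lra.
Qed.

Lemma factor_bound (k j : nat) (t a c : R) : a = 1 + 2 * k%:R + lam * j%:R ->
  c = 1 + k%:R + lam * j%:R ->
  cabs (c +i* (t / 2))%C ^+ 2 * (a * (a + 1)) <=
  expR (- decay_term k t j) * (c ^+ 2 * (cabs (a +i* t)%C * cabs ((a + 1)%R +i* t)%C)).
Proof.
move=> aE cE.
have lj : 0 <= lam * j%:R by rewrite mulr_ge0.
have k0 : 0 <= k%:R :> R by [].
have a0 : 0 < a by rewrite aE; lra.
have c0 : 0 < c by rewrite cE; lra.
have a1 : 0 < a + 1 by lra.
(* Doubling [c + i t / 2] gives the same imaginary part [t] on both sides, and then
   [2 * c - (a + 1) = lam * j], the numerator in [decay_term]. *)
have h := @eta_bound (2 * c) (a + 1) t (decay_term k t j) a1 _ _.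
have {}h : (c ^+ 2 + (t / 2) ^+ 2) * (a + 1) ^+ 2 <= expR (- decay_term k t j) * (c ^+ 2 * ((a + 1) ^+ 2 + t ^+ 2)).
  rewrite -(@ler_pM2l _ 4)//.
  apply: le_trans (le_trans (h _ _) _).
  - by rewrite le_eqVlt; apply/orP; left; apply/eqP; field.
  - by rewrite aE cE; lra.
  - rewrite /decay_term (_ : 2 * c = 2 + 2 * k%:R + 2 * (lam * j%:R)); last by rewrite cE; ring.
    by rewrite (_ : _ - (a + 1) = lam * j%:R)// aE; ring.
  - by rewrite le_eqVlt; apply/orP; left; apply/eqP; ring.
rewrite cabs_sqr/= -(ler_pM2r a1).
have := cabs_pair t a0; set x := _ * cabs _ => hx.
apply: (@le_trans _ _ (a * (expR (- decay_term k t j) * (c ^+ 2 * ((a + 1) ^+ 2 + t ^+ 2))))).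
  rewrite [leLHS](_ : _ = a * ((c ^+ 2 + (t / 2) ^+ 2) * (a + 1) ^+ 2)); last by ring.
  by rewrite ler_pM2l.
rewrite [leLHS](_ : _ = expR (- decay_term k t j) * c ^+ 2 * (a * ((a + 1) ^+ 2 + t ^+ 2))); last by ring.
rewrite [leRHS](_ : _ = expR (- decay_term k t j) * c ^+ 2 * ((a + 1) * x)); last by ring.
by rewrite ler_wpM2l// mulr_ge0 ?expR_ge0 ?sqr_ge0.
Qed.

Lemma mellin_real (sigma : R) : mellin sigma%:C%C =
  (Ex (mu R N) (fun v => expR (sigma * (logsum n theta 0 v / 2) + lam / 2 * pairsum n 0 v)))%:C%C.
Proof.
rewrite -CE_real; congr (CE _ _); apply/funext => v.
by rewrite /cbe_weight /= mul0r -cexp_real.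
Qed.

Lemma bm_Wreal (sigma : R) : 0 <= sigma ->
  bm (fun v => expR (sigma * (logsum n theta 0 v / 2) + lam / 2 * pairsum n 0 v)).
Proof.
move=> s0; have [h _] := @cbm_W R n theta lam lam_ge0 sigma%:C%C 0 s0 o01.
move: h; congr bm; apply/funext => v.
by rewrite /cbe_weight /= mul0r cos0 mulr1.
Qed.

Lemma Ex_Wreal_gt0 (sigma : R) : 0 <= sigma ->
  0 < Ex (mu R N) (fun v => expR (sigma * (logsum n theta 0 v / 2) + lam / 2 * pairsum n 0 v)).
Proof.
move=> s0; apply: Ex_gt0; first exact: bm_Wreal.
- by move=> v; exact: expR_ge0.
- by apply: aeW => v; exact: expR_gt0.
Qed.

Lemma mellin_real_gt0 (sigma : R) : 0 <= sigma -> 0 < cabs (mellin sigma%:C%C).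
Proof.
move=> s0; have p := Ex_Wreal_gt0 s0.
by rewrite mellin_real cabs_real// ltW.
Qed.

Lemma mellin_le (sigma t : R) : 0 <= sigma ->
  cabs (mellin (sigma +i* t)%C) <= cabs (mellin sigma%:C%C).
Proof.
move=> s0; have p := Ex_Wreal_gt0 s0; rewrite mellin_real cabs_real; last exact: ltW.
apply: cabs_CE; [exact: cbm_W|exact: bm_Wreal|move=> v].
by rewrite cabs_cexp.
Qed.

(** Compares the moduli in [mellin_rec] at [2k + i t] and at [2k]: a bound on the line of real part
    [2k + 2] passes to the line of real part [2k], and each index [j] gains one [factor_bound]. *)
Lemma mellin_decay_step (k : nat) (t e : R) : 0 <= e ->
  cabs (mellin ((2 * k.+1%:R)%R +i* t)%C) <= e * cabs (mellin (2 * k.+1%:R)%:C%C) ->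
  cabs (mellin ((2 * k%:R)%R +i* t)%C) <=
    expR (- \sum_(j < N) decay_term k t j) * e * cabs (mellin (2 * k%:R)%:C%C).
Proof.
move=> e0 hk.
have k0 : 0 <= 2 * k%:R :> R by rewrite mulr_ge0.
pose s : R[i] := ((2 * k%:R)%R +i* t)%C.
pose s0 : R[i] := (2 * k%:R)%:C%C.
have sE : ((2 * k.+1%:R)%R +i* t)%C = s + 2.
  by rewrite natc; apply: complex_ext; rewrite /= ?addr0// -natr1; ring.
have s0E : (2 * k.+1%:R)%:C%C = s0 + 2.
  by rewrite natc; apply: complex_ext; rewrite /= ?addr0// -natr1; ring.
have r1 := congr1 (@cabs R) (mellin_rec (s := s) k0).
have r0 := congr1 (@cabs R) (mellin_rec (s := s0) k0).
rewrite sE s0E in hk; rewrite -/s -/s0.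
move: r1 r0; rewrite !expr2 !cabsM => r1 r0.
pose c j : R := 1 + k%:R + lam * j%:R.
pose a j : R := 1 + 2 * k%:R + lam * j%:R.
have lj j : 0 <= lam * j%:R by rewrite mulr_ge0.
have kk : 0 <= k%:R :> R by [].
have c0 j : 0 < c j by rewrite /c; have := lj j; lra.
have a0 j : 0 < a j by rewrite /a; have := lj j; lra.
have Qs : cabs (Qprod s) = \prod_(j < N) cabs (c j +i* (t / 2))%C.
  rewrite cabs_prod; apply: eq_bigr => l _; congr cabs.
  by rewrite halfc natc; apply: complex_ext; rewrite /= /c; field.
have Qs0 : cabs (Qprod s0) = \prod_(j < N) c j.
  rewrite cabs_prod; apply: eq_bigr => l _; rewrite -[RHS]cabs_real ?ltW//; congr cabs.
  by rewrite halfc natc; apply: complex_ext; rewrite /= /c; field.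
have D0s : cabs (Dprod 0 s) = \prod_(j < N) cabs (a j +i* t)%C.
  rewrite cabs_prod; apply: eq_bigr => l _; congr cabs.
  by rewrite !natc; apply: complex_ext; rewrite /= /a; ring.
have D1s : cabs (Dprod 1 s) = \prod_(j < N) cabs ((a j + 1)%R +i* t)%C.
  rewrite cabs_prod; apply: eq_bigr => l _; congr cabs.
  by rewrite !natc; apply: complex_ext; rewrite /= /a; ring.
have D0s0 : cabs (Dprod 0 s0) = \prod_(j < N) a j.
  rewrite cabs_prod; apply: eq_bigr => l _; rewrite -[RHS]cabs_real ?ltW//; congr cabs.
  by rewrite !natc; apply: complex_ext; rewrite /= /a; ring.
have D1s0 : cabs (Dprod 1 s0) = \prod_(j < N) (a j + 1).
  rewrite cabs_prod; apply: eq_bigr => l _.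
  rewrite -[RHS]cabs_real; last by rewrite addr_ge0// ltW.
  by congr cabs; rewrite !natc; apply: complex_ext; rewrite /= /a; ring.
have key : cabs (Qprod s) ^+ 2 * (cabs (Dprod 0 s0) * cabs (Dprod 1 s0)) <=
   expR (- \sum_(j < N) decay_term k t j) * (cabs (Qprod s0) ^+ 2 * (cabs (Dprod 0 s) * cabs (Dprod 1 s))).
  rewrite Qs Qs0 D0s D1s D0s0 D1s0 -sumrN expR_sum -!prodrXl -!big_split /=.
  apply: ler_prod => j _; apply/andP; split; last exact: factor_bound.
  by have aj := a0 j; apply: mulr_ge0; [exact: sqr_ge0|apply: mulr_ge0; lra].
have pQ0 : 0 < cabs (Qprod s0) by rewrite Qs0 prodr_gt0.
have pos (x : R) : 0 < x -> forall y, 0 < cabs (x +i* y)%C.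
  move=> x0 y; apply: lt_le_trans (Re_le_cabs _); rewrite /= gtr0_norm//.
have pD0 : 0 < cabs (Dprod 0 s) by rewrite D0s prodr_gt0// => j _; exact: pos.
have pD1 : 0 < cabs (Dprod 1 s) by rewrite D1s prodr_gt0// => j _; apply: pos; rewrite addr_gt0.
move: pQ0 pD0 pD1 key r1 r0 hk.
set Q := cabs (Qprod s); set Q0 := cabs (Qprod s0); set d0 := cabs (Dprod 0 s).
set d1 := cabs (Dprod 1 s); set b0 := cabs (Dprod 0 s0); set b1 := cabs (Dprod 1 s0).
set f := cabs (mellin s); set f0 := cabs (mellin s0); set g := cabs (mellin (s + 2)); set g0 := cabs (mellin (s0 + 2)).
set X := expR _ => pQ0 pD0 pD1 key r1 r0 hk.
have P0 : 0 < Q0 ^+ 2 * (d0 * d1) by rewrite mulr_gt0 ?exprn_gt0 ?mulr_gt0.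
rewrite -(ler_pM2l P0).
rewrite [leLHS](_ : _ = Q0 ^+ 2 * (d0 * d1 * f)); last by ring.
rewrite -r1.
apply: (@le_trans _ _ (Q0 ^+ 2 * (Q * Q * (e * g0)))).
  by rewrite ler_wpM2l ?sqr_ge0// ler_wpM2l// mulr_ge0 ?cabs_ge0.
rewrite [leLHS](_ : _ = e * Q ^+ 2 * (Q0 * Q0 * g0)); last by ring.
rewrite r0 [leLHS](_ : _ = e * f0 * (Q ^+ 2 * (b0 * b1))); last by ring.
rewrite [leRHS](_ : _ = e * f0 * (X * (Q0 ^+ 2 * (d0 * d1)))); last by ring.
by rewrite ler_wpM2l// mulr_ge0 ?cabs_ge0.
Qed.

Lemma mellin_decay (t : R) (K : nat) :
  cabs (mellin (0 +i* t)%C) <= expR (- \sum_(k < K) \sum_(j < N) decay_term k t j) * cabs (mellin 0).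
Proof.
suff H k : cabs (mellin ((2 * k%:R)%R +i* t)%C) <=
    expR (- \sum_(i < K) \sum_(j < N) decay_term (k + i) t j) * cabs (mellin (2 * k%:R)%:C%C).
  by have := H 0%N; rewrite mulr0.
elim: K k => [|K IH] k.
  rewrite big_ord0 oppr0 expR0 mul1r; apply: mellin_le; exact: mulr_ge0.
have h := mellin_decay_step (expR_ge0 _) (IH k.+1).
rewrite -expRD -opprD in h.
rewrite [X in expR (- X)](_ : _ = \sum_(j < N) decay_term k t j +
   \sum_(i < K) \sum_(j < N) decay_term (k.+1 + i) t j)//.
rewrite (big_ord_recl K) /= addn0; congr (_ + _); apply: eq_bigr => i _.
by rewrite addSnnS.
Qed.
End moments.

(** * Decay estimates *)

Section estimates.
Variable R : realType.
Variable lam : R.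
Hypothesis lam_gt0 : 0 < lam.
Let lam_ge0 : 0 <= lam := ltW lam_gt0.

Lemma ln_le_sub1 (x : R) : 0 < x -> ln x <= x - 1.
Proof. by move=> x0; have := expR_ge1Dx (ln x); rewrite lnK ?posrE//; lra. Qed.

Lemma ln_le_harmonic (x : R) (K : nat) : 0 < x ->
  ln (x + K%:R) - ln x <= \sum_(i < K) (x + i%:R)^-1.
Proof.
move=> x0; elim: K => [|K IH]; first by rewrite big_ord0 addr0 subrr.
rewrite big_ord_recr /=.
have p : 0 < x + K%:R by rewrite ltr_wpDr.
have p' : 0 < x + K.+1%:R by rewrite ltr_wpDr.
have := ln_le_sub1 (divr_gt0 p' p).
rewrite ln_div ?posrE// (_ : _ / _ - 1 = (x + K%:R)^-1); first by lra.
by rewrite -natr1; field; rewrite gt_eqF.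
Qed.

Lemma expRN_le (y : R) : 0 < y -> expR (- y) <= 4 / y ^+ 2.
Proof.
move=> y0; rewrite expRN.
have h : y ^+ 2 / 4 <= expR y.
  rewrite (_ : y = y / 2 + y / 2) ?expRD; last by lra.
  rewrite -expr2; apply: (@le_trans _ _ ((1 + y / 2) ^+ 2)); first by nra.
  by rewrite ler_pXn2r ?nnegrE ?expR_ge0 ?expR_ge1Dx//; lra.
rewrite -[4 / _]invf_div lef_pV2// posrE ?expR_gt0//.
by rewrite divr_gt0// exprn_gt0.
Qed.

Lemma decay_term_ge0 k t j : 0 <= decay_term lam k t j.
Proof.
rewrite /decay_term; have l0 : 0 <= lam * j%:R by rewrite mulr_ge0.
have k0 : 0 <= k%:R :> R by [].
apply: divr_ge0; first by rewrite mulr_ge0// sqr_ge0.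
by apply: mulr_ge0; [lra|rewrite addr_ge0 ?sqr_ge0].
Qed.

(** For [t >= A] the quotient [t^2 / (A^2 + t^2)] is at least [1/2], so [lam J >= 8] leaves [4 / A].
    The threshold 8 is what makes the numerator 2, and the sum over [k] then grows like [2 ln t]. *)
Lemma decay_term_large_t (J k : nat) (t : R) : 8 <= lam * J%:R ->
  2 + 2 * k%:R + 2 * (lam * J%:R) <= t ->
  2 / (1 + lam * J%:R + k%:R) <= decay_term lam k t J.
Proof.
move=> hJ; rewrite /decay_term; set A := 2 + _ + _ => At.
have k0 : 0 <= k%:R :> R by [].
have A0 : 0 < A by rewrite /A; lra.
have t0 : 0 < t by exact: lt_le_trans At.
rewrite (_ : 1 + lam * J%:R + k%:R = A / 2); last by rewrite /A; field.
have At2 : A ^+ 2 <= t ^+ 2 by rewrite ler_pXn2r ?nnegrE// ltW.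
have A2 : 0 < A ^+ 2 by rewrite exprn_gt0.
rewrite ler_pdivlMr; last by rewrite mulr_gt0// addr_gt0// exprn_gt0.
rewrite [leLHS](_ : _ = 4 * (A ^+ 2 + t ^+ 2)); last by field; rewrite gt_eqF.
by have := sqr_ge0 t; nra.
Qed.

(** For [k < j] one has [A <= kap * j], so the term is at least a constant times [j^-2], uniformly
    in [t >= t0]. The [j] admissible values of [k] add up to order [1 / j]. *)
Lemma decay_term_small_t (j k : nat) (t t0 : R) : (k < j)%N -> 0 < t0 -> t0 <= t ->
  let kap := 2 + 2 * lam in
  lam / kap * (t0 ^+ 2 / (kap ^+ 2 + t0 ^+ 2)) / j%:R ^+ 2 <= decay_term lam k t j.
Proof.
move=> kj t00 tt; cbv zeta; set kap := 2 + 2 * lam.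
have j1 : 1 <= j%:R :> R by rewrite ler1n (leq_trans _ kj).
have j0 : 0 < j%:R :> R by lra.
have k0 : 0 <= k%:R :> R by [].
have kj1 : k%:R + 1 <= j%:R :> R by rewrite natr1 ler_nat.
have kap0 : 0 < kap by rewrite /kap; have := lam_gt0; lra.
have t1 : 0 < t by exact: lt_le_trans tt.
rewrite /decay_term; set A := 2 + 2 * k%:R + _.
have l0 : 0 <= lam * j%:R by rewrite mulr_ge0.
have A0 : 0 < A by rewrite /A; lra.
have Aj : A <= kap * j%:R by rewrite /A /kap; lra.
have A2 : 0 < A ^+ 2 by rewrite exprn_gt0.
have t2 : 0 < t ^+ 2 by rewrite exprn_gt0.
have t02 : 0 < t0 ^+ 2 by rewrite exprn_gt0.
have tt2 : t0 ^+ 2 <= t ^+ 2 by rewrite ler_pXn2r ?nnegrE// ltW.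
have kap2 : 0 < kap ^+ 2 by rewrite exprn_gt0.
have j2 : 1 <= j%:R ^+ 2 :> R by rewrite expr_ge1.
have j20 : 0 < j%:R ^+ 2 :> R by lra.
have kj0 : 0 < kap * j%:R by rewrite mulr_gt0.
apply: (@le_trans _ _ (lam * j%:R * t ^+ 2 / (kap * j%:R * ((kap * j%:R) ^+ 2 + t ^+ 2)))); last first.
  apply: ler_wpM2l; first by rewrite mulr_ge0// ltW.
  rewrite lef_pV2 ?posrE; last 2 first.
    by rewrite mulr_gt0// addr_gt0// exprn_gt0.
    by rewrite mulr_gt0// addr_gt0.
  apply: ler_pM => //; [exact: ltW|by rewrite addr_ge0 ?ltW|].
  by rewrite lerD2r ler_pXn2r ?nnegrE// ltW.
rewrite [leRHS](_ : _ = lam / kap * (t ^+ 2 / ((kap * j%:R) ^+ 2 + t ^+ 2))); last first.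
  field; rewrite !gt_eqF//= addr_gt0// exprn_gt0//.
rewrite -mulrA; apply: ler_wpM2l; first by rewrite divr_ge0 ?ltW.
rewrite -mulrA -invfM ler_pdivrMr; last by rewrite mulr_gt0// addr_gt0.
rewrite mulrAC ler_pdivlMr; last by rewrite addr_gt0// exprn_gt0.
rewrite exprMn -subr_ge0.
rewrite (_ : _ - _ = kap ^+ 2 * j%:R ^+ 2 * (t ^+ 2 - t0 ^+ 2) + t ^+ 2 * t0 ^+ 2 * (j%:R ^+ 2 - 1)); last by ring.
by rewrite addr_ge0// !mulr_ge0// ?subr_ge0// ltW.
Qed.


Lemma decay_first (J : nat) (t : R) : 8 <= lam * J%:R -> 0 < t -> exists K1,
  expR (- \sum_(k < K1) decay_term lam k t J) <= (2 * (1 + lam * J%:R) / t) ^+ 2.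
Proof.
move=> hJ t0; set L := lam * J%:R.
(* Every [k < K] satisfies [2 + 2k + 2L <= t], the range of [decay_term_large_t]. When [t / 2 < L]
   this leaves [K = 0], and the claimed bound exceeds 1. *)
exists (Num.truncn (t / 2 - L)); set K := Num.truncn _.
have [tL|tL] := leP 0 (t / 2 - L); last first.
  have -> : K = 0%N by apply: truncn0Pn; rewrite -ltNge (lt_trans tL).
  rewrite big_ord0 oppr0 expR0; apply: exprn_ege1.
  by rewrite ler_pdivlMr// mul1r; lra.
have /andP[K1 K2] := truncn_itv tL; rewrite -/K in K1 K2.
have x0 : 0 < 1 + L by rewrite /L; lra.
apply: (@le_trans _ _ (expR (- (2 * (ln (1 + L + K%:R) - ln (1 + L)))))).
  rewrite ler_expR lerN2.
  apply: (@le_trans _ _ (2 * \sum_(i < K) (1 + L + i%:R)^-1)).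
    by rewrite ler_wpM2l// ln_le_harmonic.
  rewrite mulr_sumr; apply: ler_sum => k _; apply: decay_term_large_t => //.
  have : k%:R + 1 <= K%:R :> R by rewrite natr1 ler_nat.
  by rewrite -/L; lra.
have p : 0 < 1 + L + K%:R by rewrite ltr_wpDr.
rewrite -ln_div ?posrE// mulr_natl mulr2n opprD expRD expRN lnK ?posrE ?divr_gt0//.
rewrite -expr2 invf_div ler_pXn2r ?nnegrE//; last 2 first.
- by rewrite divr_ge0// ltW.
- by rewrite divr_ge0 ?mulr_ge0// ltW.
rewrite ler_pdivrMr// mulrAC ler_pdivlMr//.
have h : t <= 2 * (1 + L + K%:R) by rewrite -[K.+1]addn1 natrD in K2; lra.
have := ler_wpM2l (ltW x0) h.
by rewrite mulrCA mulrA.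
Qed.

(** The harmonic sum makes the exponent at least [c (ln N - ln J.+1)], and [J.+1 ^ 2 <= N] lets half
    of [c ln N] survive. The resulting power of [N] is weakened by [expRN_le], whence [16 / c^2]. *)
Lemma decay_second (J : nat) (t0 : R) : 0 < t0 -> exists2 c : R, 0 < c &
  forall n t, (0 < n)%N -> (J.+1 * J.+1 <= n.+1)%N -> t0 <= t ->
   expR (- \sum_(J.+1 <= j < n.+1) \sum_(k < j) decay_term lam k t j) <= c / (ln n.+1%:R) ^+ 2.
Proof.
move=> t00; pose kap := 2 + 2 * lam.
pose c := lam / kap * (t0 ^+ 2 / (kap ^+ 2 + t0 ^+ 2)).
have kap0 : 0 < kap by rewrite /kap; have := lam_gt0; lra.
have c0 : 0 < c.
  apply: mulr_gt0; first exact: divr_gt0.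
  by apply: divr_gt0; rewrite ?addr_gt0 ?exprn_gt0.
exists (16 / c ^+ 2); first by rewrite divr_gt0// exprn_gt0.
move=> n t n0 JN tt.
have J0 : 0 < J.+1%:R :> R by [].
have lJn : 2 * ln J.+1%:R <= ln n.+1%:R :> R.
  rewrite mulr_natl -lnXn// ler_ln ?posrE ?exprn_gt0// -natrX ler_nat.
  by rewrite expnS expn1.
have ln0 : 0 < ln n.+1%:R :> R by rewrite ln_gt0// ltr1n.
have JnN : (J.+1 <= n.+1)%N by apply: leq_trans JN; rewrite leq_pmulr.
apply: (@le_trans _ _ (expR (- (c / 2 * ln n.+1%:R)))); last first.
  have y0 : 0 < c / 2 * ln n.+1%:R by rewrite mulr_gt0// divr_gt0.
  apply: (le_trans (expRN_le y0)); rewrite le_eqVlt; apply/orP; left; apply/eqP.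
  by field; rewrite !gt_eqF.
rewrite ler_expR lerN2.
apply: (@le_trans _ _ (c * (ln n.+1%:R - ln J.+1%:R))).
  by rewrite -mulrA ler_pM2l//; lra.
apply: (@le_trans _ _ (c * \sum_(J.+1 <= j < n.+1) j%:R^-1)).
  rewrite ler_pM2l//.
  have := @ln_le_harmonic J.+1%:R (n.+1 - J.+1) J0.
  rewrite -natrD subnKC// => h; apply: (le_trans h).
  rewrite le_eqVlt; apply/orP; left; apply/eqP.
  rewrite [RHS](_ : _ = \sum_(0 + J.+1 <= j < n.+1) j%:R^-1)// big_addn big_mkord.
  by apply: eq_bigr => i _; rewrite addnC natrD.
rewrite mulr_sumr big_nat_cond [leRHS]big_nat_cond; apply: ler_sum => j /andP[/andP[Jj jn] _].
have j0 : 0 < j%:R :> R by rewrite ltr0n (leq_trans _ Jj).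
apply: (@le_trans _ _ (\sum_(k < j) (c / j%:R ^+ 2))).
  rewrite sumr_const card_ord -[_ *+ _]mulr_natr le_eqVlt; apply/orP; left; apply/eqP.
  by field; rewrite gt_eqF.
by apply: ler_sum => k _; exact: decay_term_small_t.
Qed.

(** The column [j = J.+1] pays for [t^-2] and the columns [j > J.+1] for [(ln N)^-2]. As the columns
    are disjoint and all terms nonnegative, the two gains multiply. *)
Lemma decay_main (t0 : R) : 0 < t0 -> exists2 C : R, 0 < C & exists N0 : nat,
  forall n t, (N0 <= n)%N -> t0 <= t -> exists K,
  expR (- \sum_(k < K) \sum_(j < n.+1) decay_term lam k t j) <= C / (t ^+ 2 * (ln n.+1%:R) ^+ 2).
Proof.
move=> t00; pose J := (Num.truncn (8 / lam) + 1)%N.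
have hJ : 8 <= lam * J.+1%:R.
  have /andP[_] := truncn_itv (divr_ge0 (ler0n R 8) lam_ge0).
  rewrite -(addn1 (Num.truncn _)) -/J ltr_pdivrMr// => h1.
  by rewrite -(addn1 J) natrD; have := lam_gt0; lra.
have [c c0 hc] := decay_second J.+1 t00.
pose a := 2 * (1 + lam * J.+1%:R).
have a0 : 0 < a by rewrite /a; lra.
exists (a ^+ 2 * c); first by rewrite mulr_gt0// exprn_gt0.
exists (J.+2 * J.+2)%N => n t nN tt.
have t1 : 0 < t by exact: lt_le_trans tt.
have [K1 hK1] := decay_first hJ t1.
have h2 := hc n t (leq_trans (isT : (0 < J.+2 * J.+2)%N) nN) (leq_trans nN (leqnSn n)) tt.
(* Enough steps for both sums: [K1] rows in the first column, and [k < j <= n] in the others. *)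
exists (maxn K1 n.+1).
apply: (@le_trans _ _ (expR (- \sum_(k < K1) decay_term lam k t J.+1) *
   expR (- \sum_(J.+2 <= j < n.+1) \sum_(k < j) decay_term lam k t j))); last first.
  rewrite (_ : _ / _ = (a / t) ^+ 2 * (c / (ln n.+1%:R) ^+ 2)).
    by apply: ler_pM => //; exact: expR_ge0.
  by rewrite expr_div_n invfM; ring.
rewrite -expRD ler_expR -opprD lerN2 exchange_big /=.
rewrite -(big_mkord xpredT (fun j => \sum_(k < maxn K1 n.+1) decay_term lam k t j)).
have JN : (J.+2 <= n.+1)%N.
  by apply: leq_trans (leq_trans nN (leqnSn n)); rewrite leq_pmulr.
have sub (p q j : nat) : (p <= q)%N -> \sum_(k < p) decay_term lam k t j <= \sum_(k < q) decay_term lam k t j.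
  move=> pq; rewrite -(subnKC pq) big_split_ord /= lerDl sumr_ge0// => i _; exact: decay_term_ge0.
rewrite [leRHS](@big_cat_nat _ _ _ J.+2)//= [X in _ <= X + _]big_nat_recr//=.
apply: lerD; last first.
  rewrite big_nat_cond [leRHS]big_nat_cond; apply: ler_sum => j /andP[/andP[_ jn] _].
  by apply: sub; rewrite (leq_trans (ltnW jn))// leq_maxr.
apply: (@le_trans _ _ (\sum_(k < maxn K1 n.+1) decay_term lam k t J.+1)).
  by apply: sub; exact: leq_maxl.
by rewrite lerDr sumr_ge0// => j _; rewrite sumr_ge0// => k _; exact: decay_term_ge0.
Qed.
End estimates.

(** * The Fejer kernel and equidistribution modulo 1 *)

Section fejer.
Variable R : realType.
Local Notation Re := complex.Re.
Local Notation Im := complex.Im.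

Definition fejer (M : nat) (x : R) : R :=
  M%:R^-1 * \sum_(k < M) \sum_(l < M) cos (2 * pi * (k%:R - l%:R) * x).

Definition expsum (M : nat) (x : R) : R[i] := \sum_(k < M) cis (2 * pi * x) ^+ k.

Lemma cisX (x : R) k : cis x ^+ k = cis (k%:R * x) :> R[i].
Proof.
elim: k => [|k IH]; first by rewrite expr0 mul0r /cis cexp0.
by rewrite exprS IH -cisD -natr1 mulrDl mul1r addrC.
Qed.

Lemma Re_sum J (r : seq J) (f : J -> R[i]) : Re (\sum_(j <- r) f j) = \sum_(j <- r) Re (f j).
Proof. by apply: (big_morph _ (@cReD R) (erefl : Re 0 = 0)). Qed.

Lemma Im_sum J (r : seq J) (f : J -> R[i]) : Im (\sum_(j <- r) f j) = \sum_(j <- r) Im (f j).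
Proof. by apply: (big_morph _ (@cImD R) (erefl : Im 0 = 0)). Qed.

Lemma fejerE M x : fejer M x = M%:R^-1 * cabs (expsum M x) ^+ 2.
Proof.
rewrite /fejer cabs_sqr /expsum Re_sum Im_sum; congr (_ * _).
rewrite !expr2 !mulr_suml -big_split; apply: eq_bigr => k _ /=.
rewrite !mulr_sumr -big_split; apply: eq_bigr => l _ /=.
rewrite !cisX !cisE /= -cosB; congr cos; ring.
Qed.

Lemma fejer_ge0 M x : 0 <= fejer M x.
Proof. by rewrite fejerE mulr_ge0 ?invr_ge0 ?sqr_ge0. Qed.

Lemma cabs_1Bcis (x : R) : cabs (1 - cis x) ^+ 2 = sqd x 0.
Proof.
rewrite cabs_sqr cisE /sqd subr0 /=; have := cos2Dsin2 x; rewrite !expr2 => h; nra.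
Qed.

Lemma geom_sum (z : R[i]) M : (\sum_(j < M) z ^+ j) * (1 - z) = 1 - z ^+ M.
Proof. by rewrite -[in RHS](opprB _ 1) subrX1 -mulNr opprB mulrC. Qed.

Lemma expsum_geom M (x : R) : expsum M x * (1 - cis (2 * pi * x)) = 1 - cis (2 * pi * x) ^+ M.
Proof. exact: geom_sum. Qed.

Lemma fejer_tail M (x : R) : (0 < M)%N -> fejer M x * sqd (2 * pi * x) 0 <= 4 / M%:R.
Proof.
move=> M0; rewrite fejerE -cabs_1Bcis -[leLHS]mulrA -exprMn -cabsM expsum_geom cisX.
by rewrite cabs_1Bcis mulrC; apply: ler_wpM2r; [rewrite invr_ge0|exact: sqd_le4].
Qed.

Lemma cis_neq1 (x : R) : 0 < x < 2 * pi -> cis x != 1 :> R[i].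
Proof.
move=> /andP[x0 x1]; apply/eqP => e.
have : sqd x 0 = 0 by rewrite -cabs_1Bcis e subrr /cabs/= expr0n/= addr0 sqrtr0 expr0n.
move=> /sqd_eq0; rewrite subr0 gtr0_norm// => /(_ (ltW x1))[]; lra.
Qed.

(** Averaging over the grid kills each frequency [k - l] with [0 < |k - l| < M], a geometric sum of
    [M]-th roots of unity. The translates thus form a partition of unity up to the factor [M], which
    stands in for integration over a period. *)
Lemma fejer_sum M (x c : R) : (0 < M)%N -> \sum_(j < M) fejer M (x - c - j%:R / M%:R) = M%:R.
Proof.
move=> M0; have MR : M%:R != 0 :> R by rewrite pnatr_eq0 -lt0n.
rewrite /fejer -mulr_sumr exchange_big/=.
rewrite (eq_bigr (fun k => M%:R)); last first.
  move=> k _; rewrite exchange_big/= (bigD1 k)//= [X in _ + X]big1 ?addr0.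
    under eq_bigr do rewrite subrr mulr0 mul0r cos0.
    by rewrite sumr_const card_ord.
  move=> l lk.
  pose z : R[i] := cis (- (2 * pi * (k%:R - l%:R) / M%:R)).
  have -> : \sum_(j < M) cos (2 * pi * (k%:R - l%:R) * (x - c - j%:R / M%:R)) =
     Re (cis (2 * pi * (k%:R - l%:R) * (x - c)) * \sum_(j < M) z ^+ j).
    rewrite mulr_sumr Re_sum; apply: eq_bigr => j _.
    rewrite /z cisX -cisD cisE /=; congr cos; ring.
  suff -> : \sum_(j < M) z ^+ j = 0 by rewrite mulr0.
  have zM : z ^+ M = 1.
    rewrite /z cisX mulrN [M%:R * _]mulrC mulfVK//.
    have cn (q : nat) : cis (2 * pi * q%:R) = 1 :> R[i].
      elim: q => [|q IH]; first by rewrite mulr0 /cis cexp0.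
      by rewrite -[q.+1]addn1 natrD mulrDr mulr1 addrC cis_periodic.
    rewrite -cis_conjE mulrBr cisD -cis_conjE !cn mul1r.
    by apply: complex_ext; rewrite /= ?oppr0 ?opprK.
  have z1 : z != 1.
    have aux (p q : 'I_M) : (p < q)%N -> cis (2 * pi * (q%:R - p%:R) / M%:R) != 1 :> R[i].
      move=> pq; apply: cis_neq1; rewrite -natrB 1?ltnW//.
      have p0 : 0 < (q - p)%:R / M%:R :> R by rewrite divr_gt0 ?ltr0n ?subn_gt0.
      have p1 : (q - p)%:R / M%:R < 1 :> R.
        by rewrite ltr_pdivrMr ?ltr0n// mul1r ltr_nat (leq_ltn_trans (leq_subr _ _)).
      rewrite -mulrA; have := twopi_gt0 R => tp.
      by rewrite mulr_gt0// gtr_pMr.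
    have [kl|kl|/val_inj kl] := ltngtP k l; last by rewrite kl eqxx in lk.
    - have := aux _ _ kl; rewrite /z; congr (cis _ != 1); ring.
    - have := aux _ _ kl; apply: contra; rewrite /z -cis_conjE => /eqP e.
      by apply/eqP; rewrite -[LHS]conjcK e; apply: complex_ext; rewrite /= ?oppr0.
  have /eqP := geom_sum z M.
  by rewrite zM subrr mulf_eq0 subr_eq0 (eq_sym 1) (negbTE z1) orbF => /eqP.
by rewrite sumr_const card_ord -(mulr_natr M%:R M) mulrA mulVf// mul1r.
Qed.
End fejer.

Lemma cos_int_period (R : realType) (x : R) (z : int) :
  cos (2 * pi * (z%:~R + x)) = cos (2 * pi * x).
Proof.
have cn (y : R) (q : nat) : cos (2 * pi * (q%:R + y)) = cos (2 * pi * y).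
  elim: q => [|q IH]; first by rewrite add0r.
  by rewrite -IH -[q.+1]addn1 natrD (_ : 2 * pi * _ = 2 * pi * (q%:R + y) + pi *+ 2) ?cosD2pi// mulr2n; ring.
case: z => q; first exact: cn.
by rewrite NegzE mulrNz -pmulrn -[LHS](cn _ q.+1) addrA subrr add0r.
Qed.

Lemma cos_le_mid (R : realType) (eta u : R) : 0 <= eta -> eta <= u -> u <= 1 - eta ->
  cos (2 * pi * u) <= cos (2 * pi * eta).
Proof.
move=> e0 eu ue; pose p := pi * (u + eta); pose q := pi * (u - eta).
have p0 : 0 < pi :> R := pi_gt0 R.
have sp : 0 <= sin p.
  apply: sin_ge0_pi; apply/andP; split; first by apply: mulr_ge0; lra.
  by rewrite /p -[leRHS]mulr1 ler_pM2l//; lra.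
have sq : 0 <= sin q.
  apply: sin_ge0_pi; apply/andP; split; first by apply: mulr_ge0; lra.
  by rewrite /q -[leRHS]mulr1 ler_pM2l//; lra.
rewrite (_ : 2 * pi * u = p + q); last by rewrite /p /q; ring.
rewrite (_ : 2 * pi * eta = p - q); last by rewrite /p /q; ring.
rewrite cosD cosB; have := mulr_ge0 sp sq; lra.
Qed.

Section weighted.
Context {d : measure_display} {T : measurableType d} {R : realType}.
Variables (P : probability T R) (w : T -> R).
Hypotheses (bw : bm w) (w0 : forall v, 0 <= w v) (Z0 : 0 < Ex P w).
Implicit Types f g : T -> R.

Definition Ew f := Ex P (fun v => w v * f v) / Ex P w.

Lemma EwD f g : bm f -> bm g -> Ew (fun v => f v + g v) = Ew f + Ew g.
Proof.
move=> bf bg; rewrite /Ew -mulrDl -ExD; [|exact: bmM..].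
by congr (Ex _ _ / _); apply/funext => v; rewrite mulrDr.
Qed.

Lemma EwZ c f : bm f -> Ew (fun v => c * f v) = c * Ew f.
Proof.
move=> bf; rewrite /Ew mulrA -ExZ; last exact: bmM.
by congr (Ex _ _ / _); apply/funext => v; rewrite mulrCA.
Qed.

Lemma Ew_cst c : Ew (fun _ => c) = c.
Proof.
rewrite /Ew (_ : (fun v => _) = (fun v => c * w v)).
  by rewrite ExZ// mulfK// gt_eqF.
by apply/funext => v; rewrite mulrC.
Qed.

Lemma Ew_sum J (r : seq J) (Q : pred J) (F : J -> T -> R) : (forall j, Q j -> bm (F j)) ->
  Ew (fun v => \sum_(j <- r | Q j) F j v) = \sum_(j <- r | Q j) Ew (F j).
Proof.
move=> h; rewrite /Ew -mulr_suml -Ex_sum; last by move=> j Qj; apply: bmM => //; exact: h.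
by congr (Ex _ _ / _); apply/funext => v; rewrite mulr_sumr.
Qed.

Lemma Ew_le f g : bm f -> bm g -> (forall v, f v <= g v) -> Ew f <= Ew g.
Proof.
move=> bf bg h; apply: ler_wpM2r; first by rewrite invr_ge0 ltW.
apply: Ex_le; [exact: bmM|exact: bmM|].
by move=> v; rewrite ler_wpM2l.
Qed.

Lemma Ew_le_ae f g : bm f -> bm g -> {ae P, forall v, f v <= g v} -> Ew f <= Ew g.
Proof.
move=> bf bg h; apply: ler_wpM2r; first by rewrite invr_ge0 ltW.
apply: Ex_le_ae; [exact: bmM|exact: bmM|].
by apply: filterS h => v fg; rewrite ler_wpM2l.
Qed.

Variables (psi : T -> R) (eps : nat -> R) (delta : R).
Hypothesis mpsi : measurable_fun [set: T] psi.
Hypothesis eps0 : forall q, 0 <= eps q.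
(** The free phase [c] makes this a bound on the modulus of the [q]-th Fourier coefficient, stated
    with real functions only. *)
Hypothesis heps : forall (q : nat) (c : R), (0 < q)%N ->
  Ew (fun v => cos (2 * pi * q%:R * psi v - c)) <= eps q.
Hypothesis hdelta : forall M, 2 * \sum_(1 <= q < M) eps q <= delta.

Lemma bm_cos (f : T -> R) : measurable_fun [set: T] f -> bm (fun v => cos (f v)).
Proof.
move=> mf; apply: (@bm_comp _ _ _ (@cos R)) => //.
  exact: (continuous_measurable_fun (@continuous_cos R)).
by exists 1 => x; rewrite ler_norml cos_geN1 cos_le1.
Qed.

Lemma bm_cos_psi a c : bm (fun v => cos (a * (psi v - c))).
Proof.
apply: bm_cos; apply: measurable_funM; first exact: measurable_cst.
by apply: measurable_funB => //; exact: measurable_cst.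
Qed.

Lemma bm_fejer M c : bm (fun v => fejer M (psi v - c)).
Proof.
by apply: bmZ; apply: bm_sum => k _; apply: bm_sum => l _; exact: bm_cos_psi.
Qed.

Lemma delta_ge0 : 0 <= delta.
Proof. by have := hdelta 1; rewrite big_geq// mulr0. Qed.

(** In each row [k] of the double sum the diagonal gives 1 and every frequency [q > 0] occurs at
    most twice, once on each side of the diagonal. *)
Lemma Ew_fejer M c : (0 < M)%N -> Ew (fun v => fejer M (psi v - c)) <= 1 + delta.
Proof.
move=> M0; have MR : 0 < M%:R :> R by rewrite ltr0n.
rewrite /fejer EwZ; last first.
  by apply: bm_sum => k _; apply: bm_sum => l _; exact: bm_cos_psi.
rewrite mulrC ler_pdivrMr// Ew_sum; last first.
  by move=> k _; apply: bm_sum => l _; exact: bm_cos_psi.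
apply: (@le_trans _ _ (\sum_(k < M) (1 + delta))); last first.
  by rewrite sumr_const card_ord -[_ *+ _]mulr_natr.
apply: ler_sum => k _; rewrite Ew_sum; last by move=> l _; exact: bm_cos_psi.
pose e (l : nat) : R := if (l == k)%N then 1 else if (l < k)%N then eps (k - l) else eps (l - k).
apply: (@le_trans _ _ (\sum_(l < M) e l)).
  apply: ler_sum => l _; rewrite /e.
  have [lk|kl|->] := ltngtP l k.
  - rewrite (_ : (fun v => _) = (fun v => cos (2 * pi * (k - l)%:R * psi v - 2 * pi * (k - l)%:R * c))).
      by apply: heps; rewrite subn_gt0.
    by apply/funext => v; rewrite natrB 1?ltnW//; congr cos; ring.
  - rewrite (_ : (fun v => _) = (fun v => cos (2 * pi * (l - k)%:R * psi v - 2 * pi * (l - k)%:R * c))).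
      by apply: heps; rewrite subn_gt0.
    by apply/funext => v; rewrite natrB 1?ltnW// -cosN; congr cos; ring.
  - rewrite (_ : (fun v => _) = (fun _ => 1)) ?Ew_cst//.
    by apply/funext => v; rewrite subrr mulr0 mul0r cos0.
rewrite -(big_mkord xpredT e) (@big_cat_nat _ _ _ k)//=; last exact: ltnW.
rewrite [X in _ + X]big_ltn// {2}/e eqxx addrCA lerD2l.
have sub (p : nat) : (p <= M)%N -> \sum_(1 <= q < p) eps q <= \sum_(1 <= q < M) eps q.
  move=> pM; case: p pM => [|p] pM; first by rewrite big_geq ?sumr_ge0.
  by rewrite [leRHS](@big_cat_nat _ _ _ p.+1)//= lerDl sumr_ge0.
apply: le_trans (hdelta M); rewrite mulr_natl mulr2n; apply: lerD.
- apply: le_trans (sub k.+1 (ltn_ord k)).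
  rewrite big_nat_rev/= add0n [leRHS]big_add1/= big_nat_cond [leRHS]big_nat_cond.
  apply: ler_sum => i /andP[/andP[_ ik] _].
  rewrite /e ltn_eqF; last by rewrite ltn_subrL/= (leq_ltn_trans _ ik).
  rewrite ltn_subrL/= (leq_ltn_trans _ ik)// subKn//.
- apply: le_trans (sub (M - k)%N (leq_subr _ _)).
  rewrite -[X in index_iota X _]addn1 addnC big_addn big_nat_cond [leRHS]big_nat_cond.
  apply: ler_sum => i /andP[/andP[i1 ik] _].
  have ki : (k < i + k)%N by rewrite -{1}(add0n k) ltn_add2r.
  by rewrite /e gtn_eqF// ltnNge (ltnW ki)/= addnK.
Qed.


(** Stated with an integer shift and not with a fractional part, so that the interval may straddle
    an integer. *)
Definition frac_itv (a b : R) : set T := [set v | exists z : int, z%:~R + a <= psi v < z%:~R + b].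

Lemma measurable_frac_itv a b : measurable (frac_itv a b).
Proof.
have -> : frac_itv a b = \bigcup_(q in [set: nat]) (psi @^-1` `[q%:R + a, q%:R + b[ `|`
    psi @^-1` `[- q%:R + a, - q%:R + b[).
  apply/seteqP; split => [v [[q|q] h]|v [q _ [h|h]]].
  - by exists q => //; left; rewrite /= in_itv.
  - exists q.+1 => //; right; rewrite /= in_itv/=.
    by move: h; rewrite NegzE mulrNz pmulrn.
  - by exists (Posz q); move: h; rewrite /= in_itv.
  - by exists (- Posz q); move: h; rewrite /= in_itv/= mulrNz pmulrn.
apply: bigcup_measurable => q _; apply: measurableU; rewrite -[X in measurable X]setTI; exact: mpsi.
Qed.

(* [tf] averages the kernels centred at the [m] consecutive points of the grid of step
   [1 / M] that cover the interval enlarged by [eta]. *)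
Lemma Ew_frac_itv_approx a b eta (M : nat) : a <= b -> 0 < eta < 1 / 2 -> (0 < M)%N ->
  Ew (fun v => \1_(frac_itv a b) v) <= (1 + delta) * (b - a + 2 * eta + M%:R^-1) +
    4 / (2 - 2 * cos (2 * pi * eta)) / M%:R.
Proof.
move=> ab /andP[e0 e1] M0; set q := 2 - _.
have MR : 0 < M%:R :> R by rewrite ltr0n.
have bA := bm_indic (measurable_frac_itv a b) (R := R).
have q0 : 0 < q.
  have -> : q = sqd (2 * pi * eta) 0 by rewrite /sqd subr0.
  rewrite lt_def sqd_ge0 andbT.
  apply/eqP => /sqd_eq0; have := pi_gt0 R => p0.
  have x0 : 0 < 2 * pi * eta by rewrite !mulr_gt0.
  have x1 : 2 * pi * eta < 2 * pi by rewrite gtr_pMr ?mulr_gt0//; lra.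
  by rewrite subr0 gtr0_norm// => /(_ (ltW x1))[]; lra.
have tail0 : 0 <= 4 / q / M%:R by rewrite !divr_ge0// ltW.
have d0 := delta_ge0.
have y0 : 0 <= M%:R * (b - a + 2 * eta) by rewrite mulr_ge0// ?ltW//; lra.
pose m := (Num.truncn (M%:R * (b - a + 2 * eta))).+1.
have /andP[m1 m2] := truncn_itv y0; rewrite -/m in m2.
have m3 : m%:R / M%:R <= b - a + 2 * eta + M%:R^-1.
  by rewrite ler_pdivrMr// mulrDl mulVf ?gt_eqF// /m -(addn1 (Num.truncn _)) natrD lerD2r [_ * M%:R]mulrC.
(* If the enlarged interval needs the whole grid, the claimed bound is at least 1. *)
have [Mm|mM] := leqP M m.
  apply: (@le_trans _ _ 1).
    apply: (@le_trans _ _ (Ew (fun _ => 1))); last by rewrite Ew_cst.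
    apply: Ew_le => //; exact: bm_cst.
  apply: (@le_trans _ _ (m%:R / M%:R)); first by rewrite ler_pdivlMr// mul1r ler_nat.
  rewrite ler_wpDr//; apply: (le_trans m3); rewrite ler_peMl//; last by lra.
  by rewrite addr_ge0 ?invr_ge0//; lra.
pose tf v := \sum_(i < m) M%:R^-1 * fejer M (psi v - (a - eta + i%:R / M%:R)).
have btf : bm tf by apply: bm_sum => i _; apply: bmZ; exact: bm_fejer.
apply: (@le_trans _ _ (Ew (fun v => tf v + 4 / q / M%:R))).
  apply: Ew_le => //; first by apply: bmD => //; exact: bm_cst.
  move=> v; rewrite indicE; have [|_] := boolP (v \in frac_itv a b); last first.
    rewrite addr_ge0// sumr_ge0// => i _.
    by rewrite mulr_ge0 ?invr_ge0 ?fejer_ge0.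
  rewrite inE => -[z /andP[z1 z2]].
  have := fejer_sum (psi v) (a - eta) M0.
  rewrite -(big_mkord xpredT (fun i => fejer M (psi v - (a - eta) - i%:R / M%:R))).
  rewrite (@big_cat_nat _ _ _ m)//=; last exact: ltnW.
  move=> hs.
  (* The grid points left out lie at distance at least [eta] modulo 1 from [psi v], where
     [fejer_tail] makes the kernel small. *)
  have ht : \sum_(m <= i < M) fejer M (psi v - (a - eta) - i%:R / M%:R) <= 4 / q.
    apply: (@le_trans _ _ (\sum_(m <= i < M) (4 / q / M%:R))).
      rewrite big_nat_cond [leRHS]big_nat_cond; apply: ler_sum => i /andP[/andP[mi iM] _].
      set x := psi v - _ - _.
      rewrite mulrAC ler_pdivlMr//; apply: le_trans (fejer_tail x M0).
      rewrite ler_wpM2l ?fejer_ge0// /sqd subr0 /q.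
      have xE : x = z%:~R + (- (a - eta + i%:R / M%:R - (psi v - z%:~R))) by rewrite /x; ring.
      rewrite xE cos_int_period mulrN cosN.
      have i1 : i%:R / M%:R < 1 :> R by rewrite ltr_pdivrMr// mul1r ltr_nat.
      have i2 : b - a + 2 * eta <= i%:R / M%:R.
        rewrite ler_pdivlMr// mulrC; apply: (le_trans (ltW m2)).
        by rewrite ler_nat.
      by have := @cos_le_mid R eta (a - eta + i%:R / M%:R - (psi v - z%:~R)); lra.
    rewrite sumr_const_nat -[_ *+ _]mulr_natr mulrAC ler_pdivrMr// ler_wpM2l//.
      by rewrite divr_ge0// ltW.
    by rewrite ler_nat leq_subr.
  have -> : tf v = M%:R^-1 * \sum_(0 <= i < m) fejer M (psi v - (a - eta) - i%:R / M%:R).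
    rewrite /tf -mulr_sumr big_mkord; congr (_ * _); apply: eq_bigr => i _.
    by congr fejer; ring.
  rewrite [4 / q / _]mulrC -mulrDr mulrC ler_pdivlMr// mul1r.
  by rewrite -{1}hs lerD2l.
rewrite EwD//; last exact: bm_cst.
rewrite Ew_cst lerD2r Ew_sum; last by move=> i _; apply: bmZ; exact: bm_fejer.
apply: (@le_trans _ _ (\sum_(i < m) M%:R^-1 * (1 + delta))).
  apply: ler_sum => i _; rewrite EwZ; last exact: bm_fejer.
  by rewrite ler_wpM2l ?invr_ge0// Ew_fejer.
rewrite sumr_const card_ord -[_ *+ _]mulr_natr mulrAC mulrC ler_wpM2l//; first by lra.
by rewrite mulrC.
Qed.

Lemma Ew_frac_itv a b : a <= b -> Ew (fun v => \1_(frac_itv a b) v) <= (1 + delta) * (b - a).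
Proof.
move=> ab; apply/ler_addgt0Pr => e e0.
have d0 := delta_ge0.
(* Half of [e] pays for enlarging the interval by [eta]; then, with [eta] fixed, [M] is taken so
   large that the terms in [1 / M] fit in the other half. *)
pose eta := Num.min (1 / 4) (e / (4 * (1 + delta))).
have d1 : 0 < 4 * (1 + delta) by lra.
have eta0 : 0 < eta by rewrite lt_min divr_gt0//= divr_gt0.
have eta1 : eta < 1 / 2 by rewrite /eta gt_min; apply/orP; left; lra.
have eta2 : (1 + delta) * (2 * eta) <= e / 2.
  have : eta <= e / (4 * (1 + delta)) by rewrite /eta ge_min lexx orbT.
  rewrite ler_pdivlMr//; lra.
pose B := 1 + delta + 4 / (2 - 2 * cos (2 * pi * eta)).
pose M := (Num.truncn (2 * `|B| / e)).+1.
have y0 : 0 <= 2 * `|B| / e by rewrite divr_ge0 ?mulr_ge0// ltW.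
have /andP[_ M2] := truncn_itv y0; rewrite -/M in M2.
have MR : 0 < M%:R :> R by rewrite ltr0n.
have := @Ew_frac_itv_approx a b eta M ab _ isT; rewrite eta0 eta1 => /(_ isT) h.
apply: (le_trans h).
have BM : B / M%:R <= e / 2.
  rewrite ler_pdivrMr//; move: M2; rewrite ltr_pdivrMr// => M2.
  by have := ler_norm B; lra.
rewrite [leLHS](_ : _ = (1 + delta) * (b - a) + (1 + delta) * (2 * eta) + B / M%:R); last first.
  by rewrite /B; ring.
by lra.
Qed.

End weighted.

(** * Benford weights of digit patterns *)

Section benford.

Lemma sum_blocks (V : nmodType) (A0 A1 B : nat) (F : nat -> V) : (A0 <= A1)%N ->
  \sum_(A0 * B <= n < A1 * B) F n = \sum_(A0 <= h < A1) \sum_(l < B) F (h * B + l)%N.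
Proof.
move=> /subnKC <-; elim: (A1 - A0)%N => [|j IH]; first by rewrite addn0 !big_geq.
rewrite addnS big_nat_recr/= ?leq_addr// -IH.
rewrite (@big_cat_nat _ _ _ ((A0 + j) * B))/=; last 2 first.
- by rewrite leq_mul2r leq_addr orbT.
- by rewrite leq_mul2r leqnSn orbT.
congr (_ + _); rewrite mulSn -[X in index_iota X _]add0n big_addn addnK big_mkord.
by apply: eq_bigr => l _; rewrite addnC.
Qed.

Lemma digit_independence (b r : nat) (phi : nat -> nat -> nat) : (0 < b)%N ->
  (\sum_(l < b ^ r) \prod_(e < r) phi e ((l %/ b ^ e) %% b) =
   \prod_(e < r) \sum_(d < b) phi e d)%N.
Proof.
move=> b0; elim: r phi => [|r IH] phi.
  by rewrite big_ord0 expn0 big_ord1 big_ord0.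
have := @sum_blocks nat 0 (b ^ r) b
  (fun l => \prod_(e < r.+1) phi e ((l %/ b ^ e) %% b))%N (leq0n _).
rewrite mul0n -expnSr !big_mkord => ->.
rewrite big_ord_recl /= -(IH (fun e => phi e.+1)) mulnC big_distrl /=.
apply: eq_bigr => l _; rewrite big_distrr /=; apply: eq_bigr => d _.
rewrite big_ord_recl /= expn0 divn1 modnMDl modn_small// mulnC; congr (_ * _)%N.
apply: eq_bigr => e _; rewrite /bump/= add1n expnS divnMA divnMDl//.
by rewrite (divn_small (ltn_ord d)) addn0.
Qed.

(** The indicator of the pattern is a product over digit positions, so [digit_independence] factors
    the count: 1 for each constrained position and [b] for each free one. *)
Lemma count_digits (b L r : nat) (pos : 'I_L -> 'I_r) (k : 'I_L -> 'I_b) :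
  (0 < b)%N -> injective pos ->
  (#|[pred l : 'I_(b ^ r) | [forall i, (l %/ b ^ pos i) %% b == k i]]| * b ^ L = b ^ r)%N.
Proof.
move=> b0 injp.
(* Indicator that the digit [d] meets the constraint at position [e]; the empty product gives 1 at a
   free position. *)
pose phi e d := (\prod_(i < L | pos i == e :> nat) (d == k i :> nat))%N.
have -> : (#|[pred l : 'I_(b ^ r) | [forall i, (l %/ b ^ pos i) %% b == k i]]| =
    \sum_(l < b ^ r) \prod_(e < r) phi e ((l %/ b ^ e) %% b))%N.
  rewrite -sum1_card big_mkcond; apply: eq_bigr => l _; rewrite inE.
  rewrite /phi (exchange_big_dep xpredT)//=.
  rewrite (eq_bigr (fun i => (l %/ b ^ pos i) %% b == k i : nat)%N); last first.
    move=> i _; rewrite (eq_bigl (fun e : 'I_r => e == pos i)).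
      by rewrite big_pred1_eq.
    by move=> e; rewrite eq_sym.
  case: ifPn => [/forallP h|]; first by rewrite big1// => i _; rewrite h.
  by move=> /forallPn[i /negbTE h]; rewrite (bigD1 i)//= h mul0n.
rewrite digit_independence//.
have -> : (b ^ L = \prod_(e < r) b ^ (e \in codom pos))%N.
  rewrite -expn_sum; congr (_ ^ _)%N.
  by transitivity #|codom pos|; [rewrite (card_codom injp) card_ord|rewrite -sum1_card big_mkcond].
rewrite -big_split /=.
rewrite (eq_bigr (fun _ => b)); first by rewrite prod_nat_const card_ord.
move=> e _; rewrite /phi; have [/codomP[i ei]|ne] := boolP (e \in codom pos).
  rewrite expn1 -[RHS]mul1n; congr (_ * _)%N.
  rewrite (eq_bigr (fun d : 'I_b => (d == k i) : nat)); last first.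
    move=> d _; rewrite (eq_bigl (fun j => j == i)) ?big_pred1_eq//.
    by move=> j; rewrite /= ei val_eqE (inj_eq injp).
  by rewrite -big_mkcond /= sum1_card card1.
rewrite expn0 muln1 (eq_bigr (fun _ => 1%N)); first by rewrite sum1_card card_ord.
move=> d _; rewrite big_pred0// => i; apply/negbTE; apply: contra ne => /eqP pe.
by apply/codomP; exists i; apply: val_inj.
Qed.
End benford.

Section benford_sum.
Variables (R : realType) (b : nat).
Hypothesis b2 : (2 <= b)%N.

Let b0 : (0 < b)%N := ltnW b2.
Let bR : 0 < b%:R :> R. Proof. by rewrite ltr0n. Qed.

Lemma lnb_gt0 : 0 < ln b%:R :> R.
Proof. by rewrite ln_gt0// ltr1n. Qed.

(** Benford's weight [log_b (1 + 1/n)]: the length, modulo 1, of the set of [log_b x] for which the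
    leading digits of [x] spell [n]. *)
Definition ell (n : nat) : R := (ln n.+1%:R - ln n%:R) / ln b%:R.

Lemma ell_ge0 n : (0 < n)%N -> 0 <= ell n.
Proof.
move=> n0; rewrite divr_ge0 ?(ltW lnb_gt0)// subr_ge0 ler_ln ?posrE ?ltr0n//.
by rewrite ler_nat.
Qed.

Lemma ellE n : (0 < n)%N -> ell n = ln (1 + n%:R^-1) / ln b%:R.
Proof.
move=> n0; have nR : 0 < n%:R :> R by rewrite ltr0n.
rewrite /ell -ln_div ?posrE ?ltr0n//; congr (ln _ / _).
by rewrite -(addn1 n) natrD mulrDl divff ?mul1r// gt_eqF.
Qed.

Lemma ell_le n n' : (0 < n)%N -> (n <= n')%N -> ell n' <= ell n.
Proof.
move=> n0 nn'; have n'0 : (0 < n')%N by exact: leq_trans nn'.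
have nR : 0 < n%:R :> R by rewrite ltr0n.
have nR' : 0 < n'%:R :> R by rewrite ltr0n.
rewrite !ellE// ler_pM2r ?invr_gt0 ?lnb_gt0// ler_ln ?posrE ?addr_gt0 ?invr_gt0//.
by rewrite lerD2l lef_pV2 ?posrE// ler_nat.
Qed.

Lemma ell_le_inv n : (0 < n)%N -> ell n <= (n%:R * ln b%:R)^-1.
Proof.
move=> n0; have nR : 0 < n%:R :> R by rewrite ltr0n.
rewrite ellE// invfM ler_pM2r ?invr_gt0 ?lnb_gt0//.
have p : 0 < 1 + n%:R^-1 :> R by rewrite addr_gt0 ?invr_gt0.
have := expR_ge1Dx (ln (1 + n%:R^-1 : R)); rewrite lnK; last by rewrite posrE.
by lra.
Qed.

Lemma sum_ell A A' : (0 < A)%N -> (A <= A')%N ->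
  \sum_(A <= n < A') ell n = (ln A'%:R - ln A%:R) / ln b%:R.
Proof.
move=> A0 AA; rewrite -mulr_suml telescope_sumr//.
Qed.

Lemma sum_ell_total mx : (0 < mx)%N -> \sum_(b ^ mx.-1 <= n < b ^ mx) ell n = 1.
Proof.
move=> mx0; rewrite sum_ell ?expn_gt0 ?b0//; last by rewrite leq_exp2l ?leq_pred.
have -> : ln (b ^ mx)%:R - ln (b ^ mx.-1)%:R = ln b%:R :> R.
  have {1}-> : mx = mx.-1.+1 by lia.
  by rewrite !natrX !lnXn// mulrS addrK.
by rewrite divff// gt_eqF// lnb_gt0.
Qed.

Variables (L m1 mx : nat) (pos : 'I_L -> nat) (k : 'I_L -> 'I_b).
Hypothesis m1_ge2 : (2 <= m1)%N.
Hypothesis pos_le : forall i, (m1 <= pos i <= mx)%N.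
Hypothesis m1mx : (m1 <= mx)%N.
Hypothesis pos_inj : injective pos.

(** For [n] with [mx] digits, position [pos i] counted from the left is position [mx - pos i] from
    the right. *)
Definition digit_pred (n : nat) := [forall i, (n %/ b ^ (mx - pos i)) %% b == k i]%N.

(** Fix the first [m1 - 1] digits [h]; the other [r] digits range over a block of length [B], of
    which the pattern selects the proportion [b^-L]. As [ell] decreases, the error on the block is
    at most [c] times the drop of [ell] from [h B] to [(h + 1) B]. The drops telescope and leave the
    value at the smallest [h], namely [A0 = b^(m1 - 2)]. *)
Lemma benford_sum :
  `| \sum_(b ^ mx.-1 <= n < b ^ mx | digit_pred n) ell n - (b%:R ^+ L)^-1 | <=
   (b%:R ^+ (m1 - 2) * ln b%:R)^-1.
Proof.
pose r := (mx - m1).+1; pose B := (b ^ r)%N.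
pose A0 := (b ^ (m1 - 2))%N; pose A1 := (b ^ m1.-1)%N.
have B0 : (0 < B)%N by rewrite expn_gt0 b0.
have A00 : (0 < A0)%N by rewrite expn_gt0 b0.
have A01 : (A0 <= A1)%N by rewrite leq_exp2l//; lia.
have e1 : (b ^ mx.-1 = A0 * B)%N by rewrite /A0 /B -expnD; congr (_ ^ _)%N; rewrite /r; lia.
have e2 : (b ^ mx = A1 * B)%N by rewrite /A1 /B -expnD; congr (_ ^ _)%N; rewrite /r; lia.
have er i : (mx - pos i < r)%N by have := pos_le i; rewrite /r; lia.
pose e i : 'I_r := Ordinal (er i).
have e_inj : injective e.
  move=> i j /(congr1 val) /= h; apply: pos_inj.
  by have := pos_le i; have := pos_le j; lia.
have cnt := count_digits k b0 e_inj.
set c := #|_| in cnt.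
have predE h (l : nat) : digit_pred (h * B + l) = [forall i, (l %/ b ^ e i) %% b == k i]%N.
  apply: eq_forallb => i /=.
  have -> : (B = b ^ (r - (mx - pos i)).-1 * b * b ^ (mx - pos i))%N.
    rewrite -expnSr -expnD /B; congr (_ ^ _)%N.
    by have := er i; lia.
  by rewrite !mulnA divnMDl ?expn_gt0 ?b0// modnMDl.
have bL0 : 0 < b%:R ^+ L :> R by rewrite exprn_gt0.
have cR : c%:R = B%:R / b%:R ^+ L :> R.
  by rewrite /B -cnt natrM natrX mulfK// gt_eqF.
have tot := sum_ell_total (leq_trans (ltnW m1_ge2) m1mx).
have bl : \sum_(A0 <= h < A1) \sum_(l < B) ell (h * B + l) = 1.
  by rewrite -sum_blocks// -e1 -e2.
rewrite big_mkcond e1 e2 sum_blocks//.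
have -> : (b%:R ^+ L)^-1 = \sum_(A0 <= h < A1) (b%:R ^+ L)^-1 * \sum_(l < B) ell (h * B + l) :> R.
  by rewrite -mulr_sumr bl mulr1.
rewrite -sumrB.
apply: (@le_trans _ _ (\sum_(A0 <= h < A1) c%:R * (ell (h * B) - ell (h.+1 * B)))).
  rewrite big_nat_cond [leRHS]big_nat_cond.
  apply: (le_trans (ler_norm_sum _ _ _)); apply: ler_sum => h /andP[/andP[A0h _] _].
  have h0 : (0 < h)%N by exact: leq_trans A0h.
  have hB0 : (0 < h * B)%N by rewrite muln_gt0 h0.
  have lo (l : 'I_B) : ell (h.+1 * B) <= ell (h * B + l).
    by apply: ell_le; rewrite ?addn_gt0 ?hB0// mulSn addnC leq_add2r ltnW.
  have hi (l : 'I_B) : ell (h * B + l) <= ell (h * B).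
    by apply: ell_le => //; rewrite leq_addr.
  set X := \sum_(l < B) _; set Y := \sum_(l < B) _.
  have XE : X = \sum_(l < B | [forall i, (l %/ b ^ e i) %% b == k i]%N) ell (h * B + l).
    by rewrite [RHS]big_mkcond; apply: eq_bigr => l _; rewrite predE.
  have X1 : X <= c%:R * ell (h * B).
    rewrite XE; apply: (le_trans (ler_sum _ (fun l _ => hi l))).
    by rewrite sumr_const mulr_natl.
  have X2 : c%:R * ell (h.+1 * B) <= X.
    rewrite XE; apply: le_trans (ler_sum _ (fun l _ => lo l)).
    by rewrite sumr_const mulr_natl.
  have Y1 : (b%:R ^+ L)^-1 * Y <= c%:R * ell (h * B).
    rewrite cR mulrC -mulrA [X in _ <= _ * X]mulrC mulrA ler_pM2r ?invr_gt0//.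
    apply: (le_trans (ler_sum _ (fun l _ => hi l))).
    by rewrite sumr_const card_ord mulr_natl.
  have Y2 : c%:R * ell (h.+1 * B) <= (b%:R ^+ L)^-1 * Y.
    rewrite cR [leRHS]mulrC -mulrA [X in _ * X <= _]mulrC mulrA ler_pM2r ?invr_gt0//.
    apply: le_trans (ler_sum _ (fun l _ => lo l)).
    by rewrite sumr_const card_ord mulr_natl.
  by rewrite ler_norml; apply/andP; split; lra.
rewrite -mulr_sumr.
have -> : \sum_(A0 <= h < A1) (ell (h * B) - ell (h.+1 * B)) = ell (A0 * B) - ell (A1 * B).
  rewrite -[RHS]opprB -(telescope_sumr (fun h => ell (h * B)))// -sumrN.
  by apply: eq_bigr => h _; rewrite opprB.
apply: (@le_trans _ _ (c%:R * ell (A0 * B))).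
  by rewrite ler_wpM2l// gerBl ell_ge0// muln_gt0 (leq_trans A00 A01).
apply: (@le_trans _ _ (c%:R * ((A0 * B)%:R * ln b%:R)^-1)).
  by rewrite ler_wpM2l// ell_le_inv// muln_gt0 A00.
rewrite cR natrM /A0 natrX.
have BR : B%:R != 0 :> R by rewrite pnatr_eq0 -lt0n.
rewrite [leLHS](_ : _ = (b%:R ^+ L)^-1 * (b%:R ^+ (m1 - 2) * ln b%:R)^-1); last first.
  have aux (x y q : R) : y != 0 -> y * x * (y * q)^-1 = x * q^-1.
    by move=> y0; rewrite invfM mulrA [y * x]mulrC mulfK.
  by rewrite (_ : _ * B%:R * _ = B%:R * (b%:R ^+ (m1 - 2) * ln b%:R)) ?aux//; ring.
apply: ler_piMl; first by rewrite invr_ge0 mulr_ge0 ?exprn_ge0// ltW// lnb_gt0.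
by rewrite invf_le1// exprn_ege1// ler1n.
Qed.
End benford_sum.

(** * Digits and logarithms *)

Section digits.
Variables (R : realType) (b : nat).
Hypothesis b2 : (2 <= b)%N.

Let b0 : (0 < b)%N := ltnW b2.
Let bR : 0 < b%:R :> R. Proof. by rewrite ltr0n. Qed.
Let lb0 : 0 < ln b%:R :> R := lnb_gt0 R b2.

(** [log_b (n / b^(mx - 1))], the left end modulo 1 of the interval of [log_b x] for which the first
    [mx] digits of [x] spell [n]. *)
Definition logidx (mx n : nat) : R := ln n%:R / ln b%:R - mx.-1%:R.

Lemma logidxS mx n : logidx mx n.+1 - logidx mx n = ell R b n.
Proof. by rewrite /logidx /ell mulrBl; ring. Qed.

Lemma ln_exprz (z : int) : ln (b%:R ^ z) = z%:~R * ln b%:R :> R.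
Proof.
have ex q : ln (b%:R ^+ q) = q%:R * ln b%:R :> R by rewrite lnXn// mulr_natl.
case: z => q; first by rewrite -exprnP ex.
by rewrite NegzE -exprnN lnV ?posrE ?exprn_gt0// ex mulrNz mulNr.
Qed.

(** The witness is the integer part of [x] scaled to have [mx] digits before the point. All digits
    up to position [mx] are read off this one integer, hence off the interval that contains
    [log_b x] modulo 1. *)
Lemma digit_index (x : R) (mx : nat) : 0 < x -> (0 < mx)%N -> exists n : nat,
  [/\ (b ^ mx.-1 <= n < b ^ mx)%N,
      exists z : int, z%:~R + logidx mx n <= ln x / ln b%:R < z%:~R + logidx mx n.+1 &
      forall k, (k <= mx)%N -> bdigit b x k = Posz ((n %/ b ^ (mx - k)) %% b)%N].
Proof.
move=> x0 mx0; pose M := bexp b x; pose y : R := x * b%:R ^ (Posz mx - 1 - M).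
have bz0 z : 0 < b%:R ^ z :> R by rewrite exprz_gt0.
have y0 : 0 < y by rewrite mulr_gt0.
have /andP[M1 M2] := floor_itv (ln x / ln b%:R); rewrite -/(bexp b x) -/M in M1 M2.
have lyE : ln y = ln x + (mx%:R - 1 - M%:~R) * ln b%:R.
  by rewrite lnM ?posrE// ln_exprz !rmorphB.
have mxE : mx%:R - 1 = mx.-1%:R :> R by rewrite -{1}(prednK mx0) -addn1 natrD addrK.
have ly1 : mx.-1%:R * ln b%:R <= ln y.
  move: M1; rewrite ler_pdivlMr// lyE -mxE; lra.
have ly2 : ln y < mx%:R * ln b%:R.
  by move: M2; rewrite ltr_pdivrMr// lyE rmorphD/=; lra.
have y1 : (b ^ mx.-1)%:R <= y.
  rewrite -ler_ln ?posrE//; last by rewrite natrX exprn_gt0.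
  by rewrite natrX lnXn// -[leLHS]mulr_natl.
have y2 : y < (b ^ mx)%:R.
  rewrite -ltr_ln ?posrE//; last by rewrite natrX exprn_gt0.
  by rewrite natrX lnXn// -[ltRHS]mulr_natl.
pose n := Num.truncn y.
have /andP[n1 n2] := truncn_itv (ltW y0); rewrite -/n in n1 n2.
have nlo : (b ^ mx.-1 <= n)%N by rewrite -ltnS -(ltr_nat R) (le_lt_trans y1 n2).
have nhi : (n < b ^ mx)%N by rewrite -(ltr_nat R) (le_lt_trans n1 y2).
have n0 : (0 < n)%N by rewrite (leq_trans _ nlo)// expn_gt0 b0.
have nR : 0 < n%:R :> R by rewrite ltr0n.
exists n; split; first by rewrite nlo.
- exists M.
  have l1 : ln n%:R <= ln y by rewrite ler_ln ?posrE.
  have l2 : ln y < ln n.+1%:R by rewrite ltr_ln ?posrE// ltr0n.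
  have xE : ln x / ln b%:R = ln y / ln b%:R - mx.-1%:R + M%:~R.
    by rewrite lyE -mxE mulrDl mulfK ?gt_eqF//; ring.
  have d1 : ln n%:R / ln b%:R <= ln y / ln b%:R by rewrite ler_pM2r ?invr_gt0.
  have d2 : ln y / ln b%:R < ln n.+1%:R / ln b%:R by rewrite ltr_pM2r ?invr_gt0.
  by rewrite xE /logidx; apply/andP; split; lra.
- move=> k kmx; rewrite /bdigit x0 -/M.
  pose D := (b ^ (mx - k))%N.
  have D0 : (0 < D)%N by rewrite expn_gt0 b0.
  have DR : 0 < D%:R :> R by rewrite ltr0n.
  have -> : x * b%:R ^ (k%:Z - 1 - M) = y / D%:R.
    rewrite /y -mulrA; congr (_ * _).
    rewrite (_ : k%:Z - 1 - M = (Posz mx - 1 - M) - Posz (mx - k)); last first.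
      by rewrite -subzn//; ring.
    by rewrite expfzDr ?gt_eqF// -exprnN natrX.
  rewrite (_ : Num.floor _ = Posz (n %/ D)); first by rewrite modz_nat.
  apply: floor_def; apply/andP; split.
    rewrite ler_pdivlMr// -pmulrn -natrM; apply: le_trans n1.
    by rewrite ler_nat leq_trunc_div.
  rewrite ltr_pdivrMr// -PoszD -pmulrn -natrM; apply: (lt_le_trans n2).
  by rewrite ler_nat addn1 ltn_ceil.
Qed.

Lemma measurable_bdigit k (kap : int) : measurable [set x : R | bdigit b x k = kap].
Proof.
have mset (w z : int) : measurable ([set x : R | 0 < x] `&` (fun x => ln x / ln b%:R) @^-1` `[w%:~R, (w + 1)%:~R[
     `&` (fun x => x * b%:R ^ (k%:Z - 1 - w)) @^-1` `[z%:~R, (z + 1)%:~R[).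
  apply: measurableI.
    apply: measurableI.
      by rewrite -set_itvoy; exact: measurable_itv.
    rewrite -[X in measurable X]setTI.
    have m1 : measurable_fun [set: R] (fun x => ln x / ln b%:R).
      by apply: measurable_funM => //; exact: measurable_cst.
    exact: m1.
  rewrite -[X in measurable X]setTI.
  have m2 : measurable_fun [set: R] (fun x => x * b%:R ^ (k%:Z - 1 - w)).
    by apply: measurable_funM => //; exact: measurable_cst.
  exact: m2.
have -> : [set x : R | bdigit b x k = kap] =
   ([set x | x <= 0] `&` [set x | 0%Z = kap]) `|`
   \bigcup_(w in [set: int]) \bigcup_(z in [set z : int | (z %% b%:Z)%Z = kap])
     ([set x : R | 0 < x] `&` (fun x => ln x / ln b%:R) @^-1` `[w%:~R, (w + 1)%:~R[
     `&` (fun x => x * b%:R ^ (k%:Z - 1 - w)) @^-1` `[z%:~R, (z + 1)%:~R[).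
  apply/seteqP; split => x /=.
    rewrite /bdigit; case: ltP => [x0 h|x0 h]; last by left.
    right; exists (bexp b x) => //; exists (Num.floor (x * b%:R ^ (k%:Z - 1 - bexp b x))) => //.
    split; last by rewrite /= in_itv/= floor_itv.
    by split => //; rewrite /= in_itv/= floor_itv.
  move=> [[x0 h]|[w _ [z hz [[x0 hw] hz']]]].
    by rewrite /bdigit ltNge x0.
  rewrite /bdigit x0; move: hw hz'; rewrite /= !in_itv/= => hw hz'.
  by rewrite (_ : bexp b x = w) ?(floor_def hz')//; exact: floor_def.
apply: measurableU.
  apply: measurableI; first by rewrite -set_itvNyc; exact: measurable_itv.
  have [->|ne] := pselect (0%Z = kap).
    by rewrite (_ : [set _ | _] = setT)//; apply/seteqP; split.
  by rewrite (_ : [set _ | _] = set0)//; apply/seteqP; split.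
apply: countable_bigcupT_measurable => // w.
rewrite bigcup_mkcond; apply: countable_bigcupT_measurable => // z.
by case: ifP => _.
Qed.
End digits.

(** * The law of the circular ensemble *)

Section law.
Variables (R : realType) (n : nat) (theta beta : R).
Hypothesis beta_gt0 : 0 < beta.
Notation T := (rseq R).
Local Notation N := n.+1.
Local Notation lam := (beta / 2).
Let lam_ge0 : 0 <= lam. Proof. by rewrite divr_ge0// ltW. Qed.

(** The density off a null set. The summand [0 * _] keeps the shape of the integrand in
    [mellin_real] at exponent 0. *)
Definition wt (v : T) := expR (0 * (logsum n theta 0 v / 2) + lam / 2 * pairsum n 0 v).

Let bwt : bm wt. Proof. exact: bm_Wreal. Qed.
Let Z0 : 0 < Ex (mu R N) wt. Proof. exact: Ex_Wreal_gt0. Qed.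

Lemma cdist_expR (a c : R) : 0 < sqd a c -> cdist a c = expR (ln (sqd a c) / 2).
Proof.
move=> p; rewrite cdist_sqd.
have sp : 0 < Num.sqrt (sqd a c) by rewrite sqrtr_gt0.
rewrite -[LHS]lnK ?posrE//; congr expR.
have : ln (Num.sqrt (sqd a c) ^+ 2) = ln (sqd a c) by rewrite sqr_sqrtr// ltW.
by rewrite lnXn// mulr2n; lra.
Qed.

Lemma pairsum_half (v : T) : pairsum n 0 v =
  2 * \sum_(j < N) \sum_(k < N | (j < k)%N) ln (sqd (v j) (v k)).
Proof.
have -> : pairsum n 0 v = \sum_(j < N) \sum_(k < N | (j < k)%N) ln (sqd (v j) (v k)) +
   \sum_(j < N) \sum_(k < N | (k < j)%N) ln (sqd (v j) (v k)).
  rewrite /pairsum -big_split; apply: eq_bigr => j _ /=.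
  rewrite big_mkcond [X in _ = X + _]big_mkcond [X in _ = _ + X]big_mkcond -big_split.
  apply: eq_bigr => k _ /=; rewrite addr0 -val_eqE/=.
  by case: ltngtP => _; rewrite ?addr0 ?add0r.
rewrite [X in _ + X](exchange_big_dep xpredT)//= mulr_natl mulr2n; congr (_ + _).
by apply: eq_bigr => j _; apply: eq_bigr => k _; rewrite sqdC.
Qed.

Lemma density_generic v : generic N theta v -> cbe_density beta N v = wt v.
Proof.
move=> [_ g2]; rewrite /cbe_density /wt mul0r add0r pairsum_half.
rewrite mulrA divfK// mulr_sumr expR_sum; apply: eq_bigr => j _.
rewrite mulr_sumr expR_sum; apply: eq_bigr => k jk.
have p : 0 < sqd (v j) (v k) by apply: g2; rewrite -val_eqE/= ltn_eqF.
rewrite cdist_expR// /powR gt_eqF ?expR_gt0// expRK; congr expR; lra.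
Qed.

Lemma absD_generic v : generic N theta v -> absD N theta v = expR (logsum n theta 0 v / 2).
Proof.
move=> [g1 _]; rewrite /absD /logsum mulr_suml expR_sum; apply: eq_bigr => j _.
by rewrite cdist_expR ?addr0.
Qed.

Lemma measurable_cdist (f g : T -> R) : measurable_fun [set: T] f ->
  measurable_fun [set: T] g -> measurable_fun [set: T] (fun v => cdist (f v) (g v)).
Proof.
move=> mf mg; rewrite (_ : (fun v => _) = (fun v => Num.sqrt (sqd (f v) (g v)))).
  apply: (@measurableT_comp _ _ _ _ _ _ (@Num.sqrt R)); last exact: measurable_sqd.
  exact: (continuous_measurable_fun (@sqrt_continuous R)).
by apply/funext => v; exact: cdist_sqd.
Qed.

Lemma measurable_density : measurable_fun [set: T] (cbe_density beta N : T -> R).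
Proof.
rewrite (_ : (cbe_density beta N : T -> R) = (fun v => \prod_(j < N) \prod_(k < N)
    (if (j < k)%N then cdist (v j) (v k) `^ beta else 1))); last first.
  by apply/funext => v; apply: eq_bigr => j _; rewrite big_mkcond.
apply: measurable_prod => j _; apply: measurable_prod => k _.
case: (_ < _)%N; last exact: measurable_cst.
apply: (@measurableT_comp _ _ _ _ _ _ (fun x : R => x `^ beta)).
  exact: measurable_powR.
by apply: measurable_cdist; exact: measurable_coord.
Qed.

Lemma measurable_absD : measurable_fun [set: T] (absD N theta : T -> R).
Proof.
apply: measurable_prod => j _.
by apply: measurable_cdist; [exact: measurable_cst|exact: measurable_coord].
Qed.

Lemma density_ge0 v : 0 <= cbe_density beta N v.
Proof. by apply: prodr_ge0 => j _; apply: prodr_ge0 => k _; exact: powR_ge0. Qed.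

Lemma integral_density (f : T -> R) : bm f -> (forall v, 0 <= f v) ->
  fine (iter_int N (fun v => (f v * cbe_density beta N v)%:E)) =
  (2 * pi) ^+ N * Ex (mu R N) (fun v => wt v * f v).
Proof.
move=> bf f0; have mf : measurable_fun [set: T] f by case: bf.
have mfd : measurable_fun [set: T] (fun v => (f v * cbe_density beta N v)%:E).
  by apply/measurable_EFinP; apply: measurable_funM => //; exact: measurable_density.
rewrite iter_intE//; last by move=> v; rewrite lee_fin mulr_ge0// density_ge0.
have bwf : bm (fun v => wt v * f v) by exact: bmM.
have -> : (\int[mu R N]_v (f v * cbe_density beta N v)%:E = (Ex (mu R N) (fun v => wt v * f v))%:E)%E.
  rewrite /Ex /Rintegral fineK; last first.
    by apply: integrable_fin_num => //; exact: (bm_integrable (mu R N) bwf).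
  apply: ae_eq_integral => //; first by apply/measurable_EFinP; case: bwf.
  apply: filterS (generic_ae N theta) => v g _ /=.
  by rewrite density_generic// mulrC.
by rewrite -EFinM.
Qed.

Lemma cbe_probE (E : set T) : measurable E ->
  cbe_prob beta N E = Ew (mu R N) wt (fun v => \1_E v).
Proof.
move=> mE; rewrite /cbe_prob /Ew.
rewrite (integral_density (bm_indic mE (R := R))); last by move=> v; rewrite indicE.
have -> : iter_int N (fun v => (cbe_density beta N v)%:E) =
   iter_int N (fun v => ((fun _ => 1) v * cbe_density beta N v)%:E).
  by congr iter_int; apply/funext => v; rewrite mul1r.
rewrite (integral_density (bm_cst 1))//.
rewrite -mulf_div divff ?mul1r; last by rewrite expf_neq0// gt_eqF// twopi_gt0.
by congr (_ / Ex _ _); apply/funext => v; rewrite mulr1.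
Qed.

Lemma Ew_cos (t c : R) : Ew (mu R N) wt (fun v => cos (t * (logsum n theta 0 v / 2) - c)) <=
  cabs (mellin n theta lam (0 +i* t)%C) / cabs (mellin n theta lam 0).
Proof.
have -> : cabs (mellin n theta lam 0) = Ex (mu R N) wt.
  by rewrite -[0]/((0 : R)%:C%C) mellin_real cabs_real// ltW.
rewrite /Ew; apply: ler_wpM2r; first by rewrite invr_ge0 ltW.
have cW : cbm (cbe_weight n theta lam (0 +i* t)%C 0) by apply: cbm_W => //=; rewrite lexx ler01.
have -> : Ex (mu R N) (fun v => wt v * cos (t * (logsum n theta 0 v / 2) - c)) =
   complex.Re (cis (- c) * mellin n theta lam (0 +i* t)%C).
  have ReCE f : complex.Re (CE (mu R N) f) = Ex (mu R N) (fun v => complex.Re (f v)) by [].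
  rewrite /mellin -CEZ// ReCE; congr Ex; apply/funext => v.
  by rewrite cReM cisE cosN sinN /cbe_weight /wt /= cosB; ring.
apply: (le_trans (ler_norm _)); apply: (le_trans (Re_le_cabs _)).
by rewrite cabsM cabs_cexp/= expR0 mul1r.
Qed.
End law.

(** * Digits of the characteristic polynomial *)

Section digit_law.
Variables (R : realType) (n : nat) (theta beta : R) (b : nat).
Hypothesis beta_gt0 : 0 < beta.
Hypothesis b2 : (2 <= b)%N.
Notation T := (rseq R).
Local Notation N := n.+1.
Local Notation lam := (beta / 2).
Let lam_ge0 : 0 <= lam. Proof. by rewrite divr_ge0// ltW. Qed.
Let lb0 : 0 < ln b%:R :> R := lnb_gt0 R b2.

Local Notation w := (wt n theta beta).
Local Notation Ewt := (Ew (mu R N) w).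
Let bw : bm w. Proof. exact: bm_Wreal. Qed.
Let w0 v : 0 <= w v. Proof. exact: expR_ge0. Qed.
Let Z0 : 0 < Ex (mu R N) w. Proof. exact: Ex_Wreal_gt0. Qed.

Definition logD (v : T) : R := logsum n theta 0 v / 2 / ln b%:R.

Lemma measurable_logD : measurable_fun [set: T] logD.
Proof.
apply: measurable_funM; last exact: measurable_cst.
by apply: measurable_funM; [exact: measurable_logsum|exact: measurable_cst].
Qed.

Variables (eps : nat -> R) (delta : R).
Hypothesis eps0 : forall q, 0 <= eps q.
Hypothesis heps : forall q : nat, (0 < q)%N ->
  cabs (mellin n theta lam (0 +i* (2 * pi * q%:R / ln b%:R))%C) / cabs (mellin n theta lam 0) <= eps q.
Hypothesis hdelta : forall M, 2 * \sum_(1 <= q < M) eps q <= delta.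

Lemma logD_frac_itv a c : a <= c -> Ewt (fun v => \1_(frac_itv logD a c) v) <= (1 + delta) * (c - a).
Proof.
move=> ac; apply: (@Ew_frac_itv _ _ _ _ _ _ _ _ _ eps) => //; first exact: measurable_logD.
move=> q e q0; apply: le_trans (heps q0).
have := @Ew_cos R n theta beta beta_gt0 (2 * pi * q%:R / ln b%:R) e.
apply: le_trans; rewrite le_eqVlt; apply/orP; left; apply/eqP.
congr (Ew _ _ _); apply/funext => v; congr (cos (_ - _)).
by rewrite /logD; field; rewrite gt_eqF.
Qed.

Variables (L m1 mx : nat) (pos : 'I_L -> nat) (k : 'I_L -> 'I_b).
Hypothesis m1_ge2 : (2 <= m1)%N.
Hypothesis pos_le : forall i, (m1 <= pos i <= mx)%N.
Hypothesis m1mx : (m1 <= mx)%N.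
Hypothesis pos_inj : injective pos.

Let E : set T := [set v | forall i, bdigit b (absD N theta v) (pos i) = (k i)%:Z].

Lemma measurable_digit_event : measurable E.
Proof.
have -> : E = \bigcap_(i in [set: 'I_L]) (absD N theta : T -> R) @^-1` [set x | bdigit b x (pos i) = (k i)%:Z].
  by apply/seteqP; split => [v h i _|v h i]; [exact: h|exact: (h i)].
apply: fin_bigcap_measurable => // i _; rewrite -[X in measurable X]setTI.
by apply: measurable_absD => //; exact: measurable_bdigit.
Qed.

Local Notation wr j := (frac_itv logD (logidx R b mx j) (logidx R b mx j.+1)).
Local Notation dp := (digit_pred mx pos k).

Let mx0 : (0 < mx)%N. Proof. exact: leq_trans (ltnW m1_ge2) m1mx. Qed.

Lemma event_index (v : T) : generic N theta v ->
  exists2 j, (b ^ mx.-1 <= j < b ^ mx)%N & wr j v /\ (E v <-> dp j).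
Proof.
move=> g; have x0 : 0 < absD N theta v by rewrite absD_generic// expR_gt0.
have [j [jr [z hz] hd]] := digit_index b2 x0 mx0.
exists j => //; split.
  by exists z; move: hz; rewrite absD_generic// expRK.
split => [Ev|/forallP h i].
  apply/forallP => i; apply/eqP.
  by have := Ev i; rewrite hd; [case|case/andP: (pos_le i)].
by rewrite hd; [rewrite (eqP (h i))|case/andP: (pos_le i)].
Qed.

(** A union bound over the intervals indexed by [Q]. The factor [1 + delta] comes out of the sum
    however many intervals there are. *)
Lemma Ew_index_sum (Q : pred nat) (A : set T) : measurable A ->
  (forall v, generic N theta v -> A v -> exists2 j, (b ^ mx.-1 <= j < b ^ mx)%N & wr j v /\ Q j) ->
  Ewt (fun v => \1_A v) <= (1 + delta) * \sum_(b ^ mx.-1 <= j < b ^ mx | Q j) ell R b j.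
Proof.
move=> mA hA.
have bwr j : bm (fun v : T => (\1_(wr j) v : R)).
  by apply: bm_indic; apply: measurable_frac_itv; exact: measurable_logD.
apply: (@le_trans _ _ (Ewt (fun v => \sum_(b ^ mx.-1 <= j < b ^ mx | Q j) \1_(wr j) v))).
  apply: Ew_le_ae => //.
  - exact: bm_indic.
  - exact: bm_sum.
  apply: filterS (generic_ae N theta) => v g.
  rewrite [leLHS]indicE; have [|_] := boolP (v \in A); last exact: sumr_ge0.
  rewrite inE => /(hA v g)[j jr [wj Qj]].
  rewrite big_mkcond (bigD1_seq j)/= ?mem_index_iota ?iota_uniq// Qj indicE mem_set//.
  by rewrite lerDl sumr_ge0// => i _; case: ifP.
rewrite Ew_sum// mulr_sumr big_nat_cond [leRHS]big_nat_cond.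
apply: ler_sum => j /andP[/andP[jr _] _]; rewrite -(logidxS R b mx).
apply: logD_frac_itv; rewrite -subr_ge0 logidxS ell_ge0//.
by apply: leq_trans jr; rewrite expn_gt0 (ltnW b2).
Qed.

Lemma digit_event_bound :
  `| cbe_prob beta N E - (b%:R ^+ L)^-1 | <= delta + (b%:R ^+ (m1 - 2) * ln b%:R)^-1.
Proof.
have mE := measurable_digit_event.
have bE := bm_indic mE (R := R).
have d0 : 0 <= delta by have := hdelta 1; rewrite big_geq// mulr0.
rewrite (cbe_probE n theta)//; set p := Ewt _.
pose muS : R := \sum_(b ^ mx.-1 <= j < b ^ mx | dp j) ell R b j.
pose muC : R := \sum_(b ^ mx.-1 <= j < b ^ mx | ~~ dp j) ell R b j.
have SC : muS + muC = 1 by rewrite -(sum_ell_total R b2 mx0) [RHS](bigID dp).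
have h1 : p <= (1 + delta) * muS.
  apply: Ew_index_sum => // v g Ev; have [j jr [wj Ej]] := event_index g.
  by exists j => //; split => //; apply/Ej.
(* As [muS + muC = 1], this reads [p >= muS - delta * muC], the missing lower bound. *)
have h2 : 1 - p <= (1 + delta) * muC.
  have -> : 1 - p = Ewt (fun v => \1_(~` E) v).
    rewrite -[X in X - p](Ew_cst bw Z0 1) -[- p]mulN1r /p -EwZ// -EwD//; last 2 first.
    - exact: bm_cst.
    - exact: bmZ.
    by congr (Ew _ _ _); apply/funext => v; rewrite !indicE in_setC; case: (v \in E) => /=; ring.
  apply: Ew_index_sum; first exact: measurableC.
  move=> v g Ev; have [j jr [wj Ej]] := event_index g.
  by exists j => //; split => //; apply/negP => /Ej.
have ge0 (Q : pred nat) : 0 <= \sum_(b ^ mx.-1 <= j < b ^ mx | Q j) ell R b j.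
  rewrite big_nat_cond; apply: sumr_ge0 => j /andP[/andP[jr _] _]; apply: ell_ge0 => //.
  by apply: leq_trans jr; rewrite expn_gt0 (ltnW b2).
have S0 : 0 <= muS := ge0 _; have C0 : 0 <= muC := ge0 _.
have := benford_sum R b2 k m1_ge2 pos_le m1mx pos_inj; rewrite -/muS => hb.
have dS : delta * muS <= delta by rewrite ler_piMr//; lra.
have dC : delta * muC <= delta by rewrite ler_piMr//; lra.
rewrite -[p - _](subrKA muS) (le_trans (ler_normD _ _))// lerD//.
by rewrite ler_norml; apply/andP; split; nra.
Qed.
End digit_law.

(** * Summing the Fourier bounds and the final rate *)

Lemma sum_inv_sqr (R : realType) (M : nat) : \sum_(1 <= q < M) (q%:R ^+ 2)^-1 <= 2 :> R.
Proof.
suff H m : \sum_(1 <= q < m.+2) (q%:R ^+ 2)^-1 <= 2 - m.+1%:R^-1 :> R.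
  case: M => [|[|m]]; [by rewrite big_geq..|].
  by apply: (le_trans (H m)); rewrite gerBl invr_ge0.
elim: m => [|m IH]; first by rewrite big_nat1 expr1n invr1; lra.
rewrite big_nat_recr//=; apply: (le_trans (lerD IH (lexx _))).
have x0 : 0 < m.+1%:R :> R by [].
rewrite -[m.+2]addn1 natrD; set x : R := m.+1%:R in x0 *.
have x1 : 0 < x + 1 by lra.
rewrite -subr_ge0 (_ : _ - _ = (x * (x + 1) ^+ 2)^-1); last first.
  by field; rewrite !gt_eqF.
by rewrite invr_ge0 mulr_ge0 ?sqr_ge0// ltW.
Qed.

(** [C] and [N0] depend only on [beta] and [b], so the positions may later be chosen as functions of
    [N]. *)
Lemma digit_law_rate (R : realType) (beta : R) (b : nat) : 0 < beta -> (2 <= b)%N ->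
  exists2 C : R, 0 <= C & exists N0 : nat, forall (theta : R) (n : nat), (N0 <= n)%N ->
  forall (L m1 mx : nat) (pos : 'I_L -> nat) (k : 'I_L -> 'I_b), (2 <= m1)%N ->
  (forall i, (m1 <= pos i <= mx)%N) -> (m1 <= mx)%N -> injective pos ->
  `| cbe_prob beta n.+1 [set v | forall i, bdigit b (absD n.+1 theta v) (pos i) = (k i)%:Z]
     - (b%:R ^+ L)^-1 | <= C / ln n.+1%:R ^+ 2 + (b%:R ^+ (m1 - 2) * ln b%:R)^-1.
Proof.
move=> beta0 b2; have lb0 : 0 < ln b%:R :> R := lnb_gt0 R b2.
have lam0 : 0 < beta / 2 by rewrite divr_gt0.
(* The [q]-th Fourier mode of [log_b |D|] is the Mellin transform at [i t0 q], so [t0] is the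
   smallest frequency that occurs. *)
pose t0 : R := 2 * pi / ln b%:R.
have t00 : 0 < t0 by rewrite divr_gt0// twopi_gt0.
have [C C0 [N0 hN]] := decay_main lam0 t00.
exists (4 * C / t0 ^+ 2).
  by apply: divr_ge0; [apply: mulr_ge0 => //; exact: ltW|exact: sqr_ge0].
exists N0 => theta n nN L m1 mx pos k m12 hpos m1mx injp.
pose l : R := ln n.+1%:R.
pose eps (q : nat) : R := C / ((t0 * q%:R) ^+ 2 * l ^+ 2).
apply: (@digit_event_bound R n theta beta b beta0 b2 eps) => //.
- by move=> q; exact: divr_ge0 (ltW C0) (mulr_ge0 (sqr_ge0 _) (sqr_ge0 _)).
- move=> q q0.
  have tq : t0 <= t0 * q%:R by rewrite ler_peMr ?ler1n// ltW.
  have [K hK] := hN n _ nN tq.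
  have F0 : 0 < cabs (mellin n theta (beta / 2) 0).
    by have := @mellin_real_gt0 R n theta (beta / 2) (ltW lam0) 0 (lexx _).
  rewrite ler_pdivrMr// (_ : 2 * pi * q%:R / ln b%:R = t0 * q%:R); last by rewrite /t0; ring.
  apply: (le_trans (mellin_decay n theta (ltW lam0) (t0 * q%:R) K)).
  by rewrite ler_pM2r.
- move=> M; rewrite (eq_bigr (fun q => C / (t0 ^+ 2 * l ^+ 2) * (q%:R ^+ 2)^-1)); last first.
    by move=> q _; rewrite /eps exprMn !invfM; ring.
  rewrite -mulr_sumr.
  have c0 : 0 <= C / (t0 ^+ 2 * l ^+ 2).
    exact: divr_ge0 (ltW C0) (mulr_ge0 (sqr_ge0 _) (sqr_ge0 _)).
  have := ler_wpM2l c0 (sum_inv_sqr R M) => h.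
  rewrite [leRHS](_ : _ = 2 * (C / (t0 ^+ 2 * l ^+ 2) * 2)); first by rewrite ler_pM2l.
  have aux (c x y : R) : 4 * c * x * y = 2 * (c * (x * y) * 2) by ring.
  by rewrite (invfM (t0 ^+ 2)); exact: aux.
Qed.

Theorem theorem1p2 (R : realType) (beta : R) (b : nat) (theta : R)
  (L : nat) (m : 'I_L -> nat -> nat) (hL : (0 < L)%N) :
  0 < beta -> (2 <= b)%N -> 0 <= theta < 2 * pi ->
  (forall i : 'I_L, forall A : nat, \forall N \near \oo, (A <= m i N)%N) ->
  (forall (i j : 'I_L) (N : nat), (i < j)%N -> (m i N < m j N)%N) ->
  forall (k : 'I_L -> 'I_b) (eps : R), 0 < eps ->
  exists C : R, \forall N \near \oo,
    `| cbe_prob beta N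
          [set v | forall i : 'I_L,
                     bdigit b (absD N theta v) (m i N) = (k i)%:Z]
       - 1 / (b%:R ^+ L) |
    <= C * (1 / (ln (N%:R : R)) `^ (3 / 2 - eps)
            + 1 / (b%:R ^+ (m (Ordinal hL) N))).
Proof.
move=> beta0 b2 _ minf mmono k eps eps0.
have lb0 : 0 < ln b%:R :> R := lnb_gt0 R b2.
have bR : 0 < b%:R :> R by rewrite ltr0n ltnW.
have [C C0 [N0 hN]] := digit_law_rate beta0 b2.
(* Converts the error [1 / (b^(m_1 - 2) ln b)] into a multiple of [b^-m_1]. *)
pose C1 : R := b%:R ^+ 2 / ln b%:R.
have C10 : 0 <= C1 by rewrite divr_ge0 ?exprn_ge0// ltW.
exists (C + C1).
have ml : \forall N \near \oo, (2 <= m (Ordinal hL) N)%N by exact: minf.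
near=> N.
have N1 : (N0 < N)%N by near: N; exists N0.+1.
have m2 : (2 <= m (Ordinal hL) N)%N by near: N.
(* Ensures [ln N >= 1], so that lowering the exponent from 2 to [3/2 - eps] only weakens the
   bound. *)
have Ne : expR 1 <= N%:R :> R.
  near: N; exists (Num.truncn (expR 1 : R)).+1 => //= M hM.
  have /andP[_ h] := truncn_itv (expR_ge0 (1 : R)).
  by apply: (le_trans (ltW h)); rewrite ler_nat.
have NE : N = N.-1.+1 by rewrite prednK// (leq_ltn_trans _ N1).
pose mx := \max_(i < L) m i N.
have pos_le i : (m (Ordinal hL) N <= m i N <= mx)%N.
  rewrite (leq_bigmax i) andbT; have [->//|ne] := eqVneq i (Ordinal hL).
  by apply/ltnW/mmono => /=; rewrite lt0n; apply: contra ne => /eqP e; apply/eqP/val_inj.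
have injm : injective (m ^~ N).
  move=> i j e; apply: val_inj; have [ij|ij|//] := ltngtP i j.
    by have := mmono _ _ N ij; rewrite e ltnn.
  by have := mmono _ _ N ij; rewrite e ltnn.
have m1mx : (m (Ordinal hL) N <= mx)%N by rewrite (leq_bigmax (Ordinal hL)).
have Nn : (N0 <= N.-1)%N by rewrite -ltnS -NE.
have := hN theta N.-1 Nn L _ mx (m ^~ N) k m2 pos_le m1mx injm.
rewrite -NE !div1r => h; apply: (le_trans h).
have l1 : 1 <= ln N%:R :> R.
  have Np := lt_le_trans (expR_gt0 _) Ne.
  by move: Ne; rewrite -ler_ln ?posrE ?expR_gt0// expRK.
have l0 : 0 < ln N%:R :> R by lra.
have hp : (ln N%:R ^+ 2)^-1 <= (ln N%:R `^ (3 / 2 - eps))^-1 :> R.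
  rewrite lef_pV2 ?posrE ?powR_gt0 ?exprn_gt0//.
  rewrite -powR_mulrn; last exact: ltW.
  by apply: (ler_powR l1); lra.
have p0 : 0 <= (ln N%:R `^ (3 / 2 - eps))^-1 :> R by rewrite invr_ge0 powR_ge0.
have q0 : 0 <= (b%:R ^+ m (Ordinal hL) N)^-1 :> R by rewrite invr_ge0 exprn_ge0// ltW.
have e2 : (b%:R ^+ (m (Ordinal hL) N - 2) * ln b%:R)^-1 = C1 * (b%:R ^+ m (Ordinal hL) N)^-1 :> R.
  rewrite -{2}(subnK m2) exprD /C1; field.
  by rewrite !expf_neq0 ?gt_eqF.
rewrite e2 mulrDr; apply: lerD.
  apply: ler_pM => //; [by rewrite invr_ge0 exprn_ge0// ltW|lra].
by apply: ler_wpM2r => //; lra.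
Unshelve. all: by end_near.
Qed.
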